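(* Let $n \ge 3$ and $u_+=0$. Then, for any $\rho_+>0$ and $\theta_+>0$, there exist positive constants $\epsilon_0$ and $C$ satisfying the following: (I) Let $u_->0$. If $|u_-|+|\rho_--\rho_+|+|\theta_--\theta_+| \le \epsilon_0$, there exists a unique smooth solution $(\rho,u,\theta)$ of the stationary problem below (with the inflow boundary condition $(\rho,u,\theta)(r_0)=(\rho_-,u_-,\theta_-)$) satisfying $$|\rho(r)-\rho_+|,\ |\theta(r)-\theta_+|\le Cr^{-(n-2)}(|u_-|+|\rho_--\rho_+|+|\theta_--\theta_+|),$$ $$C^{-1}r^{-(n-1)}|u_-| \le |u(r)| \le Cr^{-(n-1)}|u_-|, \qquad r\ge r_0.$$ (II) Let $u_-< 0$. If $|u_-|+|\theta_--\theta_+|\le \epsilon_0$, there exists a unique smooth solution $(\rho, u, \theta)$ of the stationary problem below (with the outflow boundary condition $(u,\theta)(r_0)=(u_-,\theta_-)$) satisfying $$|\rho(r)-\rho_+|,\ |\theta(r)-\theta_+|\le Cr^{-(n-2)}(|u_-|+|\theta_--\theta_+|),$$ $$C^{-1}r^{-(n-1)}|u_-| \le |u(r)|\le Cr^{-(n-1)}|u_-|, \qquad r\ge r_0.$$ Here the stationary problem is: for $r\ge r_0$, $$\frac{(r^{n-1}\rho u)_r}{r^{n-1}}=0,\qquad \frac{(r^{n-1}\rho u^2)_r}{r^{n-1}}+ p_r =\mu \Big(\frac{(r^{n-1}u)_r}{r^{n-1}}\Big)_r,$$ $$\frac{\{r^{n-1}\rho u (e + \tfrac{1}{2}u^2)\}_r}{r^{n-1}}+\frac{(r^{n-1}pu)_r}{r^{n-1}}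 = \kappa\frac{(r^{n-1}\theta_r)_r}{r^{n-1}} +\mu \Big(\frac{(r^{n-1}u)_r}{r^{n-1}}\Big)_r u +\Psi,$$ $$\lim_{r\to \infty} (\rho, u, \theta)(r) =(\rho_+, u_+, \theta_+),$$ $$(\rho, u, \theta)(r_0)=(\rho_-, u_-, \theta_-)\ (u_->0),\qquad (u, \theta)(r_0)=(u_-, \theta_-)\ (u_- \le 0),$$ with $p= R\rho\theta$, $e=c_V \theta$, $\Psi = 2\nu u_r^2 +2\nu(n-1)(u/r)^2+\lambda(u_r+\tfrac{n-1}{r}u)^2$.
   Context: Radially symmetric stationary solutions $(\rho(r),u(r),\theta(r))$, $r=|x|$, of the compressible Navier–Stokes equations for a viscous heat-conductive polytropic ideal gas in the exterior domain $\{x\in\mathbb{R}^n: |x|>r_0\}$ ($r_0>0$), with velocity field $U=\frac{x}{r}u(r)$, density $\rho>0$, absolute temperature $\theta>0$. Constants $c_V>0$, $R>0$ (specific heat at constant volume and gas constant), viscosity coefficients $\nu,\lambda$ and heat conductivity $\kappa$ are constants with $\nu>0$, $2\nu+n\lambda\ge 0$, $\kappa>0$, and $\mu:=2\nu+\lambda>0$. $\rho_\pm>0$, $u_\pm$, $\theta_\pm$ are given constants; $u_->0$ is the inflow problem, $u_-<0$ the outflow problem. *)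

(* Defs.v *)
From Stdlib Require Import Reals.
From Coquelicot Require Import Coquelicot.
Open Scope R_scope.

(* f is C^infinity at every point of [r0, +oo) (f is a function on all of R;
   every iterated derivative exists at each r >= r0, two-sided). *)
Definition smooth_on_half_line (r0 : R) (f : R -> R) : Prop :=
  forall (k : nat) (r : R), r0 <= r -> ex_derive (Derive_n f k) r.

(* The stationary Navier--Stokes system (radial, exterior domain |x| > r0),
   equations holding for every r >= r0, with p = Rgas rho theta,
   e = cV theta, mu = 2 nu + lambda. *)
Definition stationary_eqs (n : nat) (r0 cV Rgas nu lambda kappa : R)
    (rho u theta : R -> R) : Prop :=
  let mu := 2 * nu + lambda in
  let p := fun s => Rgas * rho s * theta s in
  let e := fun s => cV * theta s in
  let divu := fun s => Derive (fun t => t ^ (n - 1) * u t) s / s ^ (n - 1) in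
  forall r, r0 <= r ->
    Derive (fun s => s ^ (n - 1) * rho s * u s) r / r ^ (n - 1) = 0 /\
    Derive (fun s => s ^ (n - 1) * rho s * (u s) ^ 2) r / r ^ (n - 1)
      + Derive p r
      = mu * Derive divu r /\
    Derive (fun s => s ^ (n - 1) * rho s * u s * (e s + / 2 * (u s) ^ 2)) r
        / r ^ (n - 1)
      + Derive (fun s => s ^ (n - 1) * p s * u s) r / r ^ (n - 1)
      = kappa * Derive (fun s => s ^ (n - 1) * Derive theta s) r / r ^ (n - 1)
        + mu * Derive divu r * u r
        + (2 * nu * (Derive u r) ^ 2
           + 2 * nu * INR (n - 1) * (u r / r) ^ 2
           + lambda * (Derive u r + INR (n - 1) / r * u r) ^ 2).

(* A smooth solution with rho, theta > 0 of the stationary problem with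
   far-field state (rho_p, u_p, theta_p); boundary conditions are stated
   separately (inflow / outflow). *)
Definition stationary_solution (n : nat) (r0 cV Rgas nu lambda kappa : R)
    (rho_p u_p theta_p : R) (rho u theta : R -> R) : Prop :=
  smooth_on_half_line r0 rho /\ smooth_on_half_line r0 u /\
  smooth_on_half_line r0 theta /\
  (forall r, r0 <= r -> 0 < rho r /\ 0 < theta r) /\
  stationary_eqs n r0 cV Rgas nu lambda kappa rho u theta /\
  is_lim rho p_infty rho_p /\ is_lim u p_infty u_p /\
  is_lim theta p_infty theta_p.

(* Main.v *)
Require Import Defs.
From Stdlib Require Import Reals Lra Lia Psatz ClassicalEpsilon.
From Coquelicot Require Import Coquelicot.
Open Scope R_scope.

(* Write [k = n - 2], [N = n - 1 = S k], [v = 1 / rho = v+ + phi], [theta = theta+ + psi].  The whole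
   system has first integrals.  Mass conservation reads [r^N rho u = m], so [u = m v / r^N]; the
   momentum equation integrates to [mu m v' = r^N (R theta / v - p+ + m^2 Q)] with
   [Q = v / r^(2N) - N I] and [I (r) = int_r^oo v / s^(2N+1) ds] (the constant is [p+] because [v] is
   bounded); the energy equation is in conservation form as well and integrates to
   [kappa r^N theta' = m q - K] with [q] an explicit bounded expression in [v], [theta] and [I].

   The second equation is a first-order relaxation of [v] towards [R theta / p+] at the rate
   [r^N / m]: for inflow ([m > 0]) it is solved forward from [v (r0)], for outflow ([m < 0]) it has
   exactly one bounded solution.  The third one is a two-point problem for [theta] whose right-hand
   side carries the small factor [m] and whose solutions decay like [r^(-(n-2))].  Updating first
   [theta], then [v], gives a contraction of small balls in the supremum norm, uniformly as [m] tends
   to 0.  The fixed point is constructed on [[A, oo)] with [A < r0] so that the solution is smooth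
   in a two-sided neighbourhood of [r0]; for inflow [A] must approach [r0] as [m] tends to 0. *)

(** The order of the updates matters because [phi] follows [psi] with a factor of order one: to
    leading order [phi] is [Rg * psi / p+]. Changing both at once would not contract. The difference
    of two new [psi'] carries the factor [m], so once [psi'] is known all that drives [phi'] is
    small: [psi'] itself, a term quadratic in [phi], and [m^2 Q].

    The rate [r^N / m] blows up as [m] tends to 0. No power of [1 / m] is lost, since relaxation
    towards a target of size [B] gives a solution of size comparable to [B], whatever the rate.

    For outflow the density at [r0], and hence [m], is unknown. Two iterates then relax at different
    rates, and what has to be small is the relative difference of their fluxes; it is controlled by
    the difference of the values of [phi] at [r0].

    The energy constant [K] is the free parameter that fits [theta] at [r0]: it multiplies the
    harmonic function [r^(-k)], which vanishes at infinity exactly because [n >= 3]. The momentum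
    constant is not free: any other value would make the bounded [v] drift off to infinity. *)

(** * Monotonicity, tail integrals and a fixed-point theorem *)

Lemma small_enough (a b : R) : 0 <= a -> 0 < b ->
  exists e, 0 < e /\ forall x, x <= e -> a * x <= b.
Proof.
intros ha hb. exists (b / (a + 1)). split; [apply Rdiv_lt_0_compat; lra|].
intros x hx. apply Rle_trans with (a * (b / (a + 1))); [now apply Rmult_le_compat_l|].
replace b with ((a + 1) * (b / (a + 1))) at 2 by (field; lra).
apply Rmult_le_compat_r; [|lra]. apply Rlt_le, Rdiv_lt_0_compat; lra.
Qed.

Lemma decr_of_derive (g dg : R -> R) (a b : R) : a <= b ->
  (forall r, a <= r <= b -> continuous g r) ->
  (forall r, a < r < b -> is_derive g r (dg r)) ->
  (forall r, a < r < b -> dg r <= 0) -> g b <= g a.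
Proof.
intros hab hc hd hs.
(* [MVT_gen] places the mean value only in the closed interval. The derivative is therefore replaced
   by 0 at the endpoints, where no sign is assumed. *)
pose (dg' := fun x => if excluded_middle_informative (a < x < b) then dg x else 0).
destruct (MVT_gen g a b dg') as [c [_ hc2]].
- rewrite Rmin_left, Rmax_right by lra. intros x hx. unfold dg'.
  destruct (excluded_middle_informative (a < x < b)); [now apply hd | tauto].
- rewrite Rmin_left, Rmax_right by lra. intros x hx.
  apply continuity_pt_filterlim. now apply hc.
- assert (dg' c <= 0).
  { unfold dg'. destruct (excluded_middle_informative (a < c < b)); [now apply hs | lra]. }
  nra.
Qed.

Lemma decr_half_line (g dg : R -> R) (A : R) :
  (forall r, A <= r -> continuous g r) ->
  (forall r, A < r -> is_derive g r (dg r)) ->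
  (forall r, A < r -> dg r <= 0) ->
  forall a b, A <= a -> a <= b -> g b <= g a.
Proof.
intros hc hd hs a b ha hab.
apply (decr_of_derive g dg); auto; intros r hr; [apply hc | apply hd | apply hs]; lra.
Qed.

Lemma const_half_line (g : R -> R) (A : R) :
  (forall r, A <= r -> continuous g r) ->
  (forall r, A < r -> is_derive g r 0) ->
  forall r, A <= r -> g r = g A.
Proof.
intros hc hd r hr. apply Rle_antisym.
- apply (decr_half_line g (fun _ => 0) A); auto; intros; lra.
- apply Ropp_le_cancel.
  apply (decr_half_line (fun s => - g s) (fun _ => - 0) A); auto; intros; try lra.
  + apply (continuous_opp g). now apply hc.
  + apply (is_derive_opp g). now apply hd.
Qed.

Lemma const_open_half_line (g : R -> R) (A : R) : (forall r, A < r -> is_derive g r 0) ->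
  forall r s, A < r -> A < s -> g r = g s.
Proof.
intros hg.
assert (h : forall r s, A < r -> r <= s -> g s = g r).
{ intros r s hr hs. apply (const_half_line g r); trivial.
  - intros x hx. apply (ex_derive_continuous g). exists 0. apply hg. lra.
  - intros x hx. apply hg. lra. }
intros r s hr hs. destruct (Rle_dec r s); [symmetry|]; apply h; trivial; lra.
Qed.

(** The comparison principle at infinity. It is mostly used with [l = 0], as a proof that a barrier
    minus the function under study is nonnegative. *)
Lemma lim_le_of_decr (g dg : R -> R) (A l : R) :
  (forall r, A <= r -> continuous g r) ->
  (forall r, A < r -> is_derive g r (dg r)) ->
  (forall r, A < r -> dg r <= 0) ->
  is_lim g p_infty l -> forall r, A <= r -> l <= g r.
Proof.
intros hc hd hs hl r hr.
apply (is_lim_le_loc g (fun _ => g r) p_infty l (g r)); trivial.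
- exists r. intros y hy. apply (decr_half_line g dg A); auto; lra.
- apply is_lim_const.
Qed.

Lemma is_lim_scal0 (c : R) (f : R -> R) :
  is_lim f p_infty 0 -> is_lim (fun r => c * f r) p_infty 0.
Proof.
intros hf.
replace (Finite 0) with (Rbar_mult c 0) by (simpl; f_equal; ring).
now apply is_lim_scal_l.
Qed.

Lemma is_lim_plus0 (f g : R -> R) :
  is_lim f p_infty 0 -> is_lim g p_infty 0 -> is_lim (fun r => f r + g r) p_infty 0.
Proof.
intros hf hg. replace 0 with (0 + 0) by ring. now apply is_lim_plus'.
Qed.

Lemma is_lim_dominated (f h : R -> R) (A : R) :
  (forall r, A <= r -> Rabs (f r) <= h r) ->
  is_lim h p_infty 0 -> is_lim f p_infty 0.
Proof.
intros hf hh.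
apply (is_lim_le_le_loc (fun r => - 1 * h r) h).
- exists A. intros y hy. generalize (hf y (Rlt_le _ _ hy)).
  intros h1; apply Rabs_le_between in h1; lra.
- now apply is_lim_scal0.
- trivial.
Qed.

(** Both [H + F] and [H - F] are nonincreasing with limit 0, hence nonnegative. *)
Lemma dominated_by_decay (F dF H dH : R -> R) (A : R) :
  (forall r, A <= r -> continuous F r) -> (forall r, A <= r -> continuous H r) ->
  (forall r, A < r -> is_derive F r (dF r)) ->
  (forall r, A < r -> is_derive H r (dH r)) ->
  (forall r, A < r -> Rabs (dF r) <= - dH r) ->
  is_lim F p_infty 0 -> is_lim H p_infty 0 ->
  forall r, A <= r -> Rabs (F r) <= H r.
Proof.
intros cF cH hF hH hb lF lH r hr.
apply Rabs_le_between. split.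
- enough (0 <= H r + F r) by lra.
  apply (lim_le_of_decr (fun s => H s + F s) (fun s => dH s + dF s) A); trivial.
  + intros; apply (continuous_plus H F); auto.
  + intros; apply (is_derive_plus H F); auto.
  + intros s hs. generalize (hb s hs); intros h1; apply Rabs_le_between in h1; lra.
  + now apply is_lim_plus0.
- enough (0 <= H r + - 1 * F r) by lra.
  apply (lim_le_of_decr (fun s => H s + - 1 * F s) (fun s => dH s + - 1 * dF s) A); trivial.
  + intros; apply (continuous_plus H (fun s => -1 * F s)); auto.
    apply (continuous_scal_r (-1) F); auto.
  + intros; apply (is_derive_plus H (fun s => -1 * F s)); auto.
    apply (is_derive_scal F); auto.
  + intros s hs. generalize (hb s hs); intros h1; apply Rabs_le_between in h1; lra.
  + apply is_lim_plus0; trivial. now apply is_lim_scal0.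
Qed.

Lemma is_derive_inv_pow (j : nat) (r : R) : r <> 0 ->
  is_derive (fun s => / s ^ j) r (- INR j / r ^ S j).
Proof.
intros hr. assert (r ^ j <> 0) by now apply pow_nonzero.
auto_derive; trivial.
destruct j as [|j]; [simpl; field; trivial|].
rewrite Nat.pred_succ. simpl pow. assert (r ^ j <> 0) by now apply pow_nonzero.
field. split; trivial.
Qed.

Lemma is_lim_inv_pow (j : nat) : (1 <= j)%nat -> is_lim (fun s => / s ^ j) p_infty 0.
Proof.
intros hj. apply (is_lim_dominated _ (fun s => / s) 1).
- intros r hr. rewrite Rabs_right.
  + apply Rinv_le_contravar; [lra|].
    rewrite <- (pow_1 r) at 1. now apply Rle_pow.
  + apply Rle_ge, Rlt_le, Rinv_0_lt_compat, pow_lt. lra.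
- apply (is_lim_inv (fun s => s) p_infty p_infty); [apply is_lim_id | easy].
Qed.

(* Continuity on [[A, oo)], encoded by extending [f] to the left of [A] by a constant; primitives of
   such functions then have two-sided derivatives at [A]. *)
Definition ccont (A : R) (f : R -> R) := forall r, continuous (fun s => f (Rmax A s)) r.

Lemma continuous_Rmax (A r : R) : continuous (Rmax A) r.
Proof.
apply continuous_ext with (fun s => / 2 * (A + s + Rabs (s - A))).
- intros s. unfold Rmax. destruct (Rle_dec A s).
  + rewrite Rabs_right; lra.
  + rewrite Rabs_left; lra.
- apply (continuous_scal_r (/2) (fun s => A + s + Rabs (s - A))).
  apply (continuous_plus (fun s => A + s)).
  + apply (ex_derive_continuous (fun s => A + s)). auto_derive; trivial.
  + apply (continuous_comp (fun s => s - A) Rabs).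
    * apply (ex_derive_continuous (fun s => s - A)). auto_derive; trivial.
    * apply continuous_Rabs.
Qed.

Lemma ccont_of_continuous (A : R) (f : R -> R) :
  (forall r, A <= r -> continuous f r) -> ccont A f.
Proof.
intros hf r. apply (continuous_comp (Rmax A) f).
- apply continuous_Rmax.
- apply hf, Rmax_l.
Qed.

Lemma ccont_plus (A : R) (f g : R -> R) :
  ccont A f -> ccont A g -> ccont A (fun r => f r + g r).
Proof. intros hf hg r. apply (continuous_plus (fun s => f (Rmax A s))); auto. Qed.

Lemma ccont_mult (A : R) (f g : R -> R) :
  ccont A f -> ccont A g -> ccont A (fun r => f r * g r).
Proof. intros hf hg r. apply (continuous_mult (fun s => f (Rmax A s))); auto. Qed.

Lemma ccont_const (A c : R) : ccont A (fun _ => c).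
Proof. intros r. apply continuous_const. Qed.

Lemma ccont_inv (A : R) (f : R -> R) : (forall r, A <= r -> f r <> 0) ->
  ccont A f -> ccont A (fun r => / f r).
Proof.
intros h0 hf r. apply (continuous_comp (fun s => f (Rmax A s)) Rinv); [apply hf|].
apply continuous_Rinv. apply h0, Rmax_l.
Qed.

Lemma ccont_uniform_limit (A : R) (u : nat -> R -> R) (f : R -> R) :
  (forall j, ccont A (u j)) ->
  (forall eps, 0 < eps -> exists j, forall r, A <= r -> Rabs (u j r - f r) <= eps) ->
  ccont A f.
Proof.
intros hu hl r. apply filterlim_locally. intros eps.
destruct (hl (eps / 4)) as [j hj]; [apply Rdiv_lt_0_compat; [apply cond_pos | lra]|].
assert (h4 : 0 < eps / 4) by (apply Rdiv_lt_0_compat; [apply cond_pos | lra]).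
generalize (proj1 (filterlim_locally _ _) (hu j r) (mkposreal _ h4)).
apply filter_imp. intros s hs.
change (Rabs (u j (Rmax A s) - u j (Rmax A r)) < eps / 4) in hs.
change (Rabs (f (Rmax A s) - f (Rmax A r)) < eps).
generalize (hj _ (Rmax_l A s)) (hj _ (Rmax_l A r)). intros h1 h2.
apply Rabs_le_between in h1. apply Rabs_le_between in h2.
apply Rabs_lt_between in hs. apply Rabs_lt_between. simpl in hs. lra.
Qed.

Lemma primitive_exists (f : R -> R) (A : R) : ccont A f ->
  exists g : R -> R, g A = 0 /\ forall r, is_derive g r (f (Rmax A r)).
Proof.
intros hf. exists (fun r => RInt (fun s => f (Rmax A s)) A r). split.
- apply (RInt_point A (fun s => f (Rmax A s))).
- intros r. apply (is_derive_RInt (fun s => f (Rmax A s)) _ A r); [|apply hf].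
  apply filter_forall. intros b. apply (RInt_correct (fun s => f (Rmax A s))).
  apply (ex_RInt_continuous (fun s => f (Rmax A s))). intros; apply hf.
Qed.

(** [F] is the improper integral of [f] from [r] to infinity, obtained without a theory of improper
    integrals. If [g] is a primitive of [f], then [H + g] and [H - g] are nonincreasing and bounded
    below, so both converge along [A + j], and so does half their difference [g]. The limit of [H]
    need not be 0. *)
Lemma tail_exists (f H dH : R -> R) (A : R) : ccont A f ->
  (forall r, A <= r -> continuous H r) ->
  (forall r, A < r -> is_derive H r (dH r)) ->
  (forall r, A < r -> Rabs (f r) <= - dH r) ->
  (forall r, A <= r -> 0 <= H r) ->
  exists F : R -> R, (forall r, is_derive F r (- f (Rmax A r))) /\
    forall r, A <= r -> Rabs (F r) <= H r.
Proof.
intros hf cH hH hb h0.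
destruct (primitive_exists f A hf) as [g [gA hg]].
assert (cg : forall r, continuous g r)
  by (intros r; apply (ex_derive_continuous g); eexists; apply hg).
assert (hp : forall a b, A <= a -> a <= b -> H b + g b <= H a + g a).
{ apply (decr_half_line (fun s => H s + g s) (fun s => dH s + f (Rmax A s)) A).
  - intros; apply (continuous_plus H g); auto.
  - intros; apply (is_derive_plus H g); auto.
  - intros r hr. rewrite Rmax_right by lra.
    generalize (hb r hr); intros h1; apply Rabs_le_between in h1; lra. }
assert (hm : forall a b, A <= a -> a <= b -> H b + - 1 * g b <= H a + - 1 * g a).
{ apply (decr_half_line (fun s => H s + - 1 * g s) (fun s => dH s + - 1 * f (Rmax A s)) A).
  - intros; apply (continuous_plus H (fun s => -1 * g s)); auto.
    apply (continuous_scal_r (-1) g); auto.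
  - intros; apply (is_derive_plus H (fun s => -1 * g s)); auto.
    apply (is_derive_scal g); auto.
  - intros r hr. rewrite Rmax_right by lra.
    generalize (hb r hr); intros h1; apply Rabs_le_between in h1; lra. }
set (x := fun j => A + INR j).
assert (hx : forall j, A <= x j) by (intros j; unfold x; generalize (pos_INR j); lra).
assert (hx1 : forall j, x j <= x (S j)) by (intros j; unfold x; rewrite S_INR; lra).
destruct (ex_finite_lim_seq_decr (fun j => H (x j) + g (x j)) (- H A)) as [l1 hl1].
{ intros j. apply hp; auto. }
{ intros j. generalize (hm A (x j) (Rle_refl _) (hx j)) (h0 _ (hx j)). rewrite gA. lra. }
destruct (ex_finite_lim_seq_decr (fun j => H (x j) + - 1 * g (x j)) (- H A)) as [l2 hl2].
{ intros j. apply hm; auto. }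
{ intros j. generalize (hp A (x j) (Rle_refl _) (hx j)) (h0 _ (hx j)). rewrite gA. lra. }
set (l := / 2 * (l1 - l2)).
assert (hl : is_lim_seq (fun j => g (x j)) l).
{ apply is_lim_seq_ext with
    (fun j => / 2 * ((H (x j) + g (x j)) - (H (x j) + - 1 * g (x j)))).
  - intros j. lra.
  - change (Finite l) with (Rbar_mult (/ 2) (l1 - l2)).
    apply is_lim_seq_scal_l. now apply is_lim_seq_minus'. }
exists (fun r => l - g r). split.
- intros r. replace (- f (Rmax A r)) with (0 - f (Rmax A r)) by ring.
  apply (is_derive_minus (fun _ => l) g); [apply (@is_derive_const R_AbsRing) | apply hg].
- intros r hr.
  assert (ev : exists J, forall j, (J <= j)%nat -> r <= x j).
  { destruct (INR_unbounded (r - A)) as [J hJ]. exists J. intros j hj.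
    apply le_INR in hj. unfold x. lra. }
  destruct ev as [J hJ].
  apply Rabs_le_between. split.
  + assert (h1 : Rbar_le (g r - H r) l).
    { apply (is_lim_seq_le_loc (fun _ => g r - H r) (fun j => g (x j))); trivial.
      - exists J. intros j hj. generalize (hm r (x j) hr (hJ j hj)) (h0 _ (hx j)). lra.
      - apply is_lim_seq_const. }
    simpl in h1. lra.
  + assert (h1 : Rbar_le l (g r + H r)).
    { apply (is_lim_seq_le_loc (fun j => g (x j)) (fun _ => g r + H r)); trivial.
      - exists J. intros j hj. generalize (hp r (x j) hr (hJ j hj)) (h0 _ (hx j)). lra.
      - apply is_lim_seq_const. }
    simpl in h1. lra.
Qed.

Lemma half_power_series_tail (d0 : R) (u : nat -> R) (l : R) :
  (forall j, Rabs (u (S j) - u j) <= d0 * (/ 2) ^ j) -> is_lim_seq u l ->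
  forall j, Rabs (u j - l) <= 2 * d0 * (/ 2) ^ j.
Proof.
intros hu hl j.
assert (h1 : forall i, Rabs (u (j + i)%nat - u j) <= 2 * d0 * (/ 2) ^ j * (1 - (/ 2) ^ i)).
{ induction i as [|i IH].
  - rewrite Nat.add_0_r, Rminus_diag, Rabs_R0. simpl. lra.
  - rewrite Nat.add_succ_r.
    replace (u (S (j + i)) - u j) with ((u (S (j + i)) - u (j + i)%nat) + (u (j + i)%nat - u j)) by ring.
    eapply Rle_trans; [apply Rabs_triang|].
    eapply Rle_trans; [apply Rplus_le_compat; [apply hu | apply IH]|].
    rewrite pow_add. simpl. lra. }
assert (hd : 0 <= d0).
{ generalize (hu 0%nat) (Rabs_pos (u 1%nat - u 0%nat)). simpl. lra. }
assert (h2 : forall i, Rabs (u (j + i)%nat - u j) <= 2 * d0 * (/ 2) ^ j).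
{ intros i. eapply Rle_trans; [apply h1|].
  assert (0 < (/ 2) ^ i) by (apply pow_lt; lra).
  assert (0 <= 2 * d0 * (/ 2) ^ j)
    by (apply Rmult_le_pos; [lra | apply pow_le; lra]). nra. }
assert (hl' : is_lim_seq (fun i => Rabs (u (j + i)%nat - u j)) (Rabs (l - u j))).
{ apply (is_lim_seq_abs _ (Finite (l - u j))).
  apply is_lim_seq_minus'; [|apply is_lim_seq_const].
  apply is_lim_seq_ext with (fun i => u (i + j)%nat); [intros; f_equal; lia|].
  now apply -> (is_lim_seq_incr_n u j). }
rewrite Rabs_minus_sym.
generalize (is_lim_seq_le _ _ _ _ h2 hl' (is_lim_seq_const _)). easy.
Qed.

Lemma half_power_series_cv (d0 : R) (u : nat -> R) :
  (forall j, Rabs (u (S j) - u j) <= d0 * (/ 2) ^ j) -> ex_finite_lim_seq u.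
Proof.
intros hu.
assert (e1 : ex_series (fun j => u (S j) - u j)).
{ apply (@ex_series_le R_AbsRing R_CompleteNormedModule _ (fun j => d0 * (/ 2) ^ j)); [exact hu|].
  apply (ex_series_scal_l d0 (fun j => (/ 2) ^ j)).
  apply ex_series_geom. rewrite Rabs_right; lra. }
destruct e1 as [s hs].
exists (u 0%nat + s).
apply is_lim_seq_incr_1.
apply is_lim_seq_ext with (fun j => u 0%nat + sum_n (fun j => u (S j) - u j) j).
- intros j. induction j as [|j IH].
  + rewrite sum_O. ring.
  + rewrite sum_Sn. change plus with Rplus. lra.
- apply is_lim_seq_plus'; [apply is_lim_seq_const | exact hs].
Qed.

(** Banach iteration for a relation instead of a map: one step solves differential equations whose
    solutions are only known to exist, so the iterates are picked by choice. Distances are measured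
    on [D] alone. This is why the conclusion is [T y z] with [y = z] on [D], and not [T y y]:
    outside [D] nothing ties [z] to [y]. *)
Lemma half_contraction_fixpoint (X : Type) (D : X -> Prop) (S : (X -> R) -> Prop)
    (T : (X -> R) -> (X -> R) -> Prop) (y0 : X -> R) (d0 : R) :
  S y0 ->
  (forall y, S y -> exists z, T y z /\ S z) ->
  (forall y1 y2 z1 z2 d, S y1 -> S y2 -> S z1 -> S z2 -> T y1 z1 -> T y2 z2 ->
     (forall t, D t -> Rabs (y1 t - y2 t) <= d) ->
     forall t, D t -> Rabs (z1 t - z2 t) <= / 2 * d) ->
  (forall y1 y2, S y1 -> S y2 -> forall t, D t -> Rabs (y1 t - y2 t) <= d0) ->
  (forall (u : nat -> X -> R) y, (forall j, S (u j)) ->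
     (forall eps, 0 < eps -> exists J, forall j, (J <= j)%nat ->
        forall t, D t -> Rabs (u j t - y t) <= eps) -> S y) ->
  exists y z, S y /\ T y z /\ S z /\ forall t, D t -> y t = z t.
Proof.
intros hS0 hT hK hd hcl.
(* The iteration runs on the subset type, so that membership in [S] is carried along and the choice
   is always possible. *)
set (nxt := fun y : {y | S y} =>
  let e := constructive_indefinite_description _ (hT (proj1_sig y) (proj2_sig y)) in
  exist S (proj1_sig e) (proj2 (proj2_sig e))).
assert (hnxt : forall y, T (proj1_sig y) (proj1_sig (nxt y))).
{ intros y. unfold nxt. simpl.
  apply (proj2_sig (constructive_indefinite_description _ (hT (proj1_sig y) (proj2_sig y)))). }
set (it := fun j => Nat.iter j nxt (exist S y0 hS0)).
set (u := fun j => proj1_sig (it j)).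
assert (hu : forall j, S (u j)) by (intros j; exact (proj2_sig (it j))).
assert (huT : forall j, T (u j) (u (Datatypes.S j))) by (intros j; apply hnxt).
assert (hdu : forall j t, D t -> Rabs (u (Datatypes.S j) t - u j t) <= d0 * (/ 2) ^ j).
{ induction j as [|j IH]; intros t ht.
  - simpl. rewrite Rmult_1_r. apply hd; auto.
  - simpl. replace (d0 * (/ 2 * (/ 2) ^ j)) with (/ 2 * (d0 * (/ 2) ^ j)) by ring.
    apply (hK (u (Datatypes.S j)) (u j) _ _ _ (hu _) (hu _) (hu _) (hu _) (huT _) (huT _)); auto. }
set (y := fun t => real (Lim_seq (fun j => u j t))).
assert (hy : forall t, D t -> is_lim_seq (fun j => u j t) (y t)).
{ intros t ht. apply Lim_seq_correct'. apply (half_power_series_cv d0). intros j; now apply hdu. }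
assert (hyu : forall j t, D t -> Rabs (u j t - y t) <= 2 * d0 * (/ 2) ^ j).
{ intros j t ht. apply (half_power_series_tail d0 (fun j => u j t)); auto. }
assert (hcv : is_lim_seq (fun j => 2 * d0 * (/ 2) ^ j) 0).
{ replace (Finite 0) with (Rbar_mult (2 * d0) 0) by (simpl; f_equal; ring).
  apply is_lim_seq_scal_l, is_lim_seq_geom. rewrite Rabs_right; lra. }
assert (Sy : S y).
{ apply (hcl u y hu). intros eps heps.
  apply is_lim_seq_spec in hcv. destruct (hcv (mkposreal eps heps)) as [J hJ].
  exists J. intros j hj t ht. eapply Rle_trans; [now apply hyu|].
  generalize (hJ j hj). simpl. rewrite Rminus_0_r. intros h1.
  apply Rabs_lt_between in h1. lra. }
destruct (hT y Sy) as [z [hz Sz]].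
exists y, z. repeat split; trivial.
intros t ht.
assert (h1 : forall j, Rabs (y t - z t) <= 2 * (2 * d0 * (/ 2) ^ j)).
{ intros j.
  replace (y t - z t) with (- (u (Datatypes.S j) t - y t) + (u (Datatypes.S j) t - z t)) by ring.
  eapply Rle_trans; [apply Rabs_triang|]. rewrite Rabs_Ropp.
  generalize (Rle_trans _ _ _ (Rabs_pos _) (hyu j t ht)).
  generalize (hyu (Datatypes.S j) t ht). rewrite <- tech_pow_Rmult.
  generalize (hK (u j) y _ _ _ (hu _) Sy (hu _) Sz (huT j) hz (fun t => hyu j t) t ht).
  lra. }
assert (h2 : Rabs (y t - z t) <= 0).
{ assert (hc2 : is_lim_seq (fun j => 2 * (2 * d0 * (/ 2) ^ j)) 0).
  { replace (Finite 0) with (Rbar_mult 2 0) by (simpl; f_equal; ring).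
    now apply is_lim_seq_scal_l. }
  apply (is_lim_seq_le _ _ _ _ h1 (is_lim_seq_const _) hc2). }
generalize (Rabs_pos (y t - z t)). intros h3.
destruct (Req_dec (y t - z t) 0) as [h4|h4]; [lra|].
apply Rabs_pos_lt in h4. lra.
Qed.

(** * Smoothness on a half-line *)

(** The derivative is existential, so a differential equation can supply it directly as an
    expression in the unknowns. The open half-line makes the notion local, which allows equality on
    it to be transported to derivatives. *)
Fixpoint Ck (A : R) (j : nat) (f : R -> R) : Prop :=
  match j with
  | O => forall r, A < r -> continuous f r
  | S i => exists g : R -> R, (forall r, A < r -> is_derive f r (g r)) /\ Ck A i g
  end.

Lemma Ck_pred (A : R) (j : nat) (f : R -> R) : Ck A (S j) f -> Ck A j f.
Proof.
revert f; induction j as [|j IH]; intros f [g [hg h]].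
- intros r hr. apply (ex_derive_continuous f). exists (g r). now apply hg.
- exists g. split; trivial. now apply IH.
Qed.

Lemma locally_gt (A r : R) : A < r -> locally r (fun s => A < s).
Proof. intros h. apply (open_gt A r h). Qed.

Lemma Ck_ext (A : R) (j : nat) (f g : R -> R) :
  (forall r, A < r -> f r = g r) -> Ck A j f -> Ck A j g.
Proof.
intros h. assert (hl : forall r, A < r -> locally r (fun s => f s = g s)).
{ intros r hr. generalize (locally_gt A r hr). apply filter_imp. exact h. }
destruct j as [|j].
- intros hf r hr. apply (continuous_ext_loc _ f); auto.
- intros [df [hd hf]]. exists df. split; trivial.
  intros r hr. apply (is_derive_ext_loc f); auto.
Qed.

Lemma Ck_const (A c : R) (j : nat) : Ck A j (fun _ => c).
Proof.
revert c; induction j as [|j IH]; intros c.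
- intros r _. apply continuous_const.
- exists (fun _ => 0). split; [|apply IH]. intros r _. apply (@is_derive_const R_AbsRing).
Qed.

Lemma Ck_id (A : R) (j : nat) : Ck A j (fun r => r).
Proof.
destruct j as [|j].
- intros r _. apply continuous_id.
- exists (fun _ => 1). split; [|apply Ck_const]. intros r _. apply (@is_derive_id R_AbsRing).
Qed.

Lemma Ck_plus (A : R) (j : nat) (f g : R -> R) :
  Ck A j f -> Ck A j g -> Ck A j (fun r => f r + g r).
Proof.
revert f g; induction j as [|j IH]; intros f g hf hg.
- intros r hr. apply (continuous_plus f g); auto.
- destruct hf as [df [hd hf]], hg as [dg [he hg]].
  exists (fun r => df r + dg r). split; [|now apply IH].
  intros r hr. apply (is_derive_plus f g); auto.
Qed.

Lemma Ck_mult (A : R) (j : nat) (f g : R -> R) :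
  Ck A j f -> Ck A j g -> Ck A j (fun r => f r * g r).
Proof.
revert f g; induction j as [|j IH]; intros f g hf hg.
- intros r hr. apply (continuous_mult f g); auto.
- generalize (Ck_pred _ _ _ hf) (Ck_pred _ _ _ hg). intros wf wg.
  destruct hf as [df [hd hf]], hg as [dg [he hg]].
  exists (fun r => df r * g r + f r * dg r). split.
  + intros r hr. apply (is_derive_mult f g); auto. intros; apply Rmult_comm.
  + apply Ck_plus; apply IH; trivial.
Qed.

Lemma Ck_inv (A : R) (j : nat) (f : R -> R) : (forall r, A < r -> f r <> 0) ->
  Ck A j f -> Ck A j (fun r => / f r).
Proof.
intros h0. induction j as [|j IH]; intros hf.
- intros r hr. apply (continuous_comp f Rinv); auto. apply continuous_Rinv; auto.
- generalize (IH (Ck_pred _ _ _ hf)). intros hi.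
  destruct hf as [df [hd hf]].
  exists (fun r => (-1) * df r * (/ f r * / f r)). split.
  + intros r hr. replace (-1 * df r * (/ f r * / f r)) with (- df r / f r ^ 2)
      by (field; auto).
    apply is_derive_inv; auto.
  + apply Ck_mult; [|now apply Ck_mult]. apply Ck_mult; trivial. apply Ck_const.
Qed.

Lemma Ck_pow (A : R) (j i : nat) (f : R -> R) : Ck A j f -> Ck A j (fun r => f r ^ i).
Proof.
intros hf. induction i as [|i IH]; simpl; [apply Ck_const | now apply Ck_mult].
Qed.

Lemma Ck_Derive_n (A : R) (i j : nat) (f : R -> R) :
  Ck A (j + i) f -> Ck A i (Derive_n f j).
Proof.
revert i; induction j as [|j IH]; intros i hf; trivial.
destruct (IH (S i)) as [g [hg h]].
{ now replace (j + S i)%nat with (S j + i)%nat by lia. }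
apply Ck_ext with g; trivial. intros r hr. symmetry. now apply is_derive_unique, hg.
Qed.

Lemma smooth_of_Ck (A r0 : R) (f : R -> R) : A < r0 ->
  (forall j, Ck A j f) -> smooth_on_half_line r0 f.
Proof.
intros hA hf j r hr.
destruct (Ck_Derive_n A 1 j f (hf _)) as [g [hg _]].
exists (g r). apply hg. lra.
Qed.

Lemma inv_pow_pos (r : R) (j : nat) : 0 < r -> 0 < / r ^ j.
Proof. intros; now apply Rinv_0_lt_compat, pow_lt. Qed.

Lemma inv_pow_antitone (A r : R) (j : nat) : 0 < A -> A <= r -> / r ^ j <= / A ^ j.
Proof.
intros h1 h2. apply Rinv_le_contravar; [now apply pow_lt|]. apply pow_incr. lra.
Qed.

Lemma continuous_inv_pow (j : nat) (r : R) : r <> 0 -> continuous (fun s => / s ^ j) r.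
Proof.
intros hr. apply (ex_derive_continuous (fun s => / s ^ j)).
eexists. now apply is_derive_inv_pow.
Qed.

(** * The radial heat and relaxation equations *)

Section RadialHeat.
Variables (k : nat) (A r0 : R).
Hypotheses (hk : (1 <= k)%nat) (hA : 0 < A) (hAr : A <= r0).

Let hkR : 0 < INR k.
Proof. apply lt_0_INR. lia. Qed.

(* Both [D (r0) = 0] and [D (oo) = 0] force the constant [K] into the range of [g]. *)
Lemma radial_heat_estimate (D g : R -> R) (K B : R) :
  (forall r, A <= r -> continuous D r) ->
  (forall r, A < r -> is_derive D r ((g r - K) / r ^ S k)) ->
  (forall r, A < r -> Rabs (g r) <= B) ->
  D r0 = 0 -> is_lim D p_infty 0 ->
  forall r, A <= r -> Rabs (D r) <= 2 * B / INR k * / r ^ k.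
Proof.
intros cD hD hg h0 hl.
assert (hK : Rabs K <= B).
{ apply Rnot_lt_le. intros hK.
  set (sg := if Rle_dec 0 K then 1 else -1).
  assert (hs : sg * K = Rabs K).
  { unfold sg. destruct (Rle_dec 0 K); [rewrite Rabs_right | rewrite Rabs_left]; lra. }
  assert (hsg : forall r, A < r -> sg * g r <= B).
  { intros r hr. generalize (hg r hr); intros h1. apply Rabs_le_between in h1.
    unfold sg. destruct (Rle_dec 0 K); lra. }
  (* With this [c] the function [sg * D - c / r^k] has the derivative [(sg * g - B) / r^(k+1) <= 0]
     and the limit 0, hence is nonnegative. At [r0], where [D] vanishes, it equals
     [- c / r0^k < 0]. *)
  set (c := (Rabs K - B) / INR k).
  assert (hc : 0 < c) by (apply Rdiv_lt_0_compat; lra).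
  assert (h1 : 0 <= sg * D r0 + - c * / r0 ^ k).
  { apply (lim_le_of_decr (fun s => sg * D s + - c * / s ^ k)
      (fun s => sg * ((g s - K) / s ^ S k) + - c * (- INR k / s ^ S k)) A); trivial.
    - intros r hr. apply (continuous_plus (fun s => sg * D s)).
      + apply (continuous_scal_r sg D); auto.
      + apply (continuous_scal_r (- c) (fun s => / s ^ k)). apply continuous_inv_pow. lra.
    - intros r hr. apply (is_derive_plus (fun s => sg * D s)).
      + apply (is_derive_scal D); auto.
      + apply (is_derive_scal (fun s => / s ^ k)). apply is_derive_inv_pow. lra.
    - intros r hr.
      replace (sg * ((g r - K) / r ^ S k) + - c * (- INR k / r ^ S k))
        with (- (sg * K - sg * g r - c * INR k) * / r ^ S k) by (unfold Rdiv; ring).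
      assert (0 < / r ^ S k) by (apply inv_pow_pos; lra).
      assert (c * INR k = Rabs K - B) by (unfold c; field; lra).
      generalize (hsg r hr). rewrite hs. nra.
    - apply is_lim_plus0; apply is_lim_scal0; trivial. now apply is_lim_inv_pow. }
  rewrite h0 in h1. assert (0 < / r0 ^ k) by (apply inv_pow_pos; lra). nra. }
assert (hB : 0 <= B) by (generalize (Rabs_pos K); lra).
apply (dominated_by_decay D (fun r => (g r - K) / r ^ S k)
  (fun r => 2 * B / INR k * / r ^ k) (fun r => 2 * B / INR k * (- INR k / r ^ S k)) A); auto.
- intros r hr. apply (continuous_scal_r (2 * B / INR k) (fun s => / s ^ k)).
  apply continuous_inv_pow. lra.
- intros r hr. apply (is_derive_scal (fun s => / s ^ k)). apply is_derive_inv_pow. lra.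
- intros r hr. replace (- (2 * B / INR k * (- INR k / r ^ S k))) with (2 * B * / r ^ S k)
    by (field; split; [apply pow_nonzero; lra | lra]).
  unfold Rdiv. rewrite Rabs_mult.
  assert (0 < / r ^ S k) by (apply inv_pow_pos; lra).
  rewrite (Rabs_right (/ r ^ S k)) by lra.
  apply Rmult_le_compat_r; [lra|].
  eapply Rle_trans; [apply Rabs_triang|]. rewrite Rabs_Ropp.
  generalize (hg r hr). lra.
- apply is_lim_scal0. now apply is_lim_inv_pow.
Qed.

Lemma radial_heat_exists (q : R -> R) (B psi0 : R) :
  ccont A q -> (forall r, A <= r -> Rabs (q r) <= B) ->
  exists (psi : R -> R) (K : R), (forall r, A <= r -> is_derive psi r ((q r - K) / r ^ S k)) /\
    psi r0 = psi0 /\ is_lim psi p_infty 0.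
Proof.
intros cq hq.
assert (hB : 0 <= B) by (eapply Rle_trans; [apply Rabs_pos | apply (hq A); lra]).
destruct (tail_exists (fun r => q r * / r ^ S k) (fun r => B / INR k * / r ^ k)
  (fun r => B / INR k * (- INR k / r ^ S k)) A) as [F [hF bF]].
- apply ccont_mult; trivial. apply ccont_of_continuous.
  intros r hr. apply continuous_inv_pow. lra.
- intros r hr. apply (continuous_scal_r (B / INR k) (fun s => / s ^ k)).
  apply continuous_inv_pow. lra.
- intros r hr. apply (is_derive_scal (fun s => / s ^ k)). apply is_derive_inv_pow. lra.
- intros r hr. replace (- (B / INR k * (- INR k / r ^ S k))) with (B * / r ^ S k)
    by (field; split; [apply pow_nonzero; lra | lra]).
  assert (0 < / r ^ S k) by (apply inv_pow_pos; lra).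
  rewrite Rabs_mult, (Rabs_right (/ r ^ S k)) by lra.
  apply Rmult_le_compat_r; [lra|]. apply hq. lra.
- intros r hr. apply Rmult_le_pos; [apply Rle_mult_inv_pos; trivial|].
  apply Rlt_le, inv_pow_pos. lra.
(* The multiple of [/ r^k] corrects the value at [r0] without disturbing the limit. Its derivative
   [- c k / r^(k+1)] is what [K = c k] contributes to the equation. *)
- set (c := (psi0 + F r0) * r0 ^ k).
  exists (fun r => c * / r ^ k + - 1 * F r), (c * INR k). split; [|split].
  + intros r hr. replace ((q r - c * INR k) / r ^ S k)
      with (c * (- INR k / r ^ S k) + - 1 * - (q (Rmax A r) * / Rmax A r ^ S k))
      by (rewrite Rmax_right by lra; unfold Rdiv; ring).
    apply (is_derive_plus (fun s => c * / s ^ k) (fun s => - 1 * F s)).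
    * apply (is_derive_scal (fun s => / s ^ k)). apply is_derive_inv_pow. lra.
    * apply (is_derive_scal F). apply hF.
  + cbv beta. unfold c. field. apply pow_nonzero. lra.
  + apply is_lim_plus0; apply is_lim_scal0; [now apply is_lim_inv_pow|].
    apply (is_lim_dominated _ (fun r => B / INR k * / r ^ k) A); trivial.
    apply is_lim_scal0. now apply is_lim_inv_pow.
Qed.

End RadialHeat.

(** The integrating factor of the relaxation equation: the exponent is a primitive of
    [b r^(k+1)]. *)
Definition expo (k : nat) (b r : R) := exp (b * (r ^ S (S k) / INR (S (S k)))).

Lemma is_derive_expo (k : nat) (b r : R) :
  is_derive (expo k b) r (b * r ^ S k * expo k b r).
Proof.
unfold expo. assert (INR (S (S k)) <> 0) by (apply not_0_INR; lia).
auto_derive; trivial.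
change (match k with 0%nat => 1 | S _ => INR k + 1 end + 1) with (INR (S (S k))).
unfold Rdiv. simpl pow. field; trivial.
Qed.

Lemma expo_pos (k : nat) (b r : R) : 0 < expo k b r.
Proof. apply exp_pos. Qed.

Lemma is_lim_expo (k : nat) (b : R) : b < 0 -> is_lim (expo k b) p_infty 0.
Proof.
intros hb. assert (hn : 0 < INR (S (S k))) by (apply lt_0_INR; lia).
apply (is_lim_dominated _ (fun r => INR (S (S k)) / - b * / r ^ S (S k)) 1).
- intros r hr. rewrite Rabs_right by (apply Rle_ge, Rlt_le, expo_pos).
  unfold expo. set (y := - b * (r ^ S (S k) / INR (S (S k)))).
  assert (hp : 0 < r ^ S (S k)) by (apply pow_lt; lra).
  assert (hy : 0 < y).
  { apply Rmult_lt_0_compat; [lra|]. now apply Rdiv_lt_0_compat. }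
  replace (b * (r ^ S (S k) / INR (S (S k)))) with (- y) by (unfold y; ring).
  replace (INR (S (S k)) / - b * / r ^ S (S k)) with (/ y) by (unfold y; field; lra).
  rewrite exp_Ropp. apply Rinv_le_contravar; trivial.
  generalize (exp_ineq1 y (Rgt_not_eq _ _ hy)). lra.
- apply is_lim_scal0, is_lim_inv_pow. lia.
Qed.

Section Relaxation.
Variables (k : nat) (A r0 b : R).
Hypotheses (hA : 0 < A) (hAr : A <= r0).

(** Variation of constants: [F = expo * phi] must have the derivative [b r^(k+1) expo h]. For
    [b > 0] the constant of integration fits the value at [r0]. For [b < 0] the factor [expo] tends
    to 0, so a bounded [phi] requires the tail integral. It is dominated by [B * expo], whose
    derivative is the bound of the integrand up to sign, and dividing by [expo] leaves exactly
    [B]. *)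
Lemma relaxation_exists (h : R -> R) (B phi0 : R) : b <> 0 ->
  ccont A h -> (forall r, A <= r -> Rabs (h r) <= B) ->
  exists phi : R -> R, (forall r, A <= r -> is_derive phi r (b * r ^ S k * (h r - phi r))) /\
    (0 < b -> phi r0 = phi0) /\ (b < 0 -> forall r, A <= r -> Rabs (phi r) <= B).
Proof.
intros hb ch hh.
assert (hB : 0 <= B) by (eapply Rle_trans; [apply Rabs_pos | apply (hh A); lra]).
set (f := fun r => - b * r ^ S k * expo k b r * h r).
assert (cf : ccont A f).
{ apply ccont_mult; trivial. apply ccont_of_continuous. intros r _.
  apply (continuous_mult (fun r => - b * r ^ S k) (expo k b)).
  - apply (ex_derive_continuous (fun r => - b * r ^ S k)). auto_derive; trivial.
  - apply (ex_derive_continuous (expo k b)). eexists. apply is_derive_expo. }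
assert (hF : exists F : R -> R, (forall r, is_derive F r (- f (Rmax A r))) /\
  (0 < b -> F r0 = phi0 * expo k b r0) /\
  (b < 0 -> forall r, A <= r -> Rabs (F r) <= B * expo k b r)).
{ destruct (Rlt_le_dec 0 b) as [hp|hn].
  - destruct (primitive_exists (fun r => -1 * f r) A) as [g [_ hg]].
    { apply ccont_mult; trivial. apply ccont_const. }
    exists (fun r => (phi0 * expo k b r0 - g r0) + g r). split; [|split; intros; lra].
    intros r. replace (- f (Rmax A r)) with (0 + -1 * f (Rmax A r)) by ring.
    apply (is_derive_plus (fun _ => phi0 * expo k b r0 - g r0) g); trivial.
    apply (@is_derive_const R_AbsRing).
  - destruct (tail_exists f (fun r => B * expo k b r)
      (fun r => B * (b * r ^ S k * expo k b r)) A) as [F [h1 h2]]; trivial.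
    + intros r _. apply (ex_derive_continuous (fun r => B * expo k b r)).
      eexists. apply (is_derive_scal (expo k b)). apply is_derive_expo.
    + intros r _. apply (is_derive_scal (expo k b)). apply is_derive_expo.
    + intros r hr. unfold f. assert (0 < expo k b r) by apply expo_pos.
      assert (0 < r ^ S k) by (apply pow_lt; lra).
      rewrite Rabs_mult, Rabs_right.
      * generalize (hh r (Rlt_le _ _ hr)). intros h1.
        replace (- (B * (b * r ^ S k * expo k b r))) with (- b * r ^ S k * expo k b r * B) by ring.
        apply Rmult_le_compat_l; trivial.
        apply Rmult_le_pos; [apply Rmult_le_pos|]; lra.
      * apply Rle_ge. apply Rmult_le_pos; [apply Rmult_le_pos|]; lra.
    + intros r hr. apply Rmult_le_pos; trivial. apply Rlt_le, expo_pos.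
    + exists F. split; [|split]; auto. lra. }
destruct hF as [F [hF [h1 h2]]].
exists (fun r => / expo k b r * F r). split; [|split].
- intros r hr.
  assert (he : expo k b r <> 0) by (apply Rgt_not_eq, expo_pos).
  replace (b * r ^ S k * (h r - / expo k b r * F r)) with
    (- (b * r ^ S k * expo k b r) / expo k b r ^ 2 * F r + / expo k b r * - f (Rmax A r)).
  + apply (is_derive_mult (fun s => / expo k b s) F); trivial.
    * apply is_derive_inv; trivial. apply is_derive_expo.
    * intros; apply Rmult_comm.
  + rewrite Rmax_right by lra. unfold f. field; trivial.
- intros hp. cbv beta. rewrite h1 by trivial. field. apply Rgt_not_eq, expo_pos.
- intros hn r hr. assert (he : 0 < expo k b r) by apply expo_pos.
  rewrite Rabs_mult, Rabs_right by (apply Rle_ge, Rlt_le, Rinv_0_lt_compat; trivial).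
  generalize (h2 hn r hr). intros h3.
  apply (Rmult_le_reg_l (expo k b r)); trivial.
  rewrite <- Rmult_assoc, Rinv_r by lra. lra.
Qed.

(* For [b > 0] the equation is stiff: the solution may be continued to the left of [r0] only over
   a distance of order [1 / b]. *)
Definition relaxation_adm :=
  b < 0 \/
  (0 < b /\ 2 * INR k <= b * r0 ^ S (S k) /\
   b * (r0 ^ S (S k) / INR (S (S k)) - A ^ S (S k) / INR (S (S k))) <= ln 2).

(** The point is that the constant does not depend on [b]. The weight [/ r^j] is used with [j = 0]
    for differences of iterates and with [j = k] for decay. Only the upper bound is proved; the
    lower one follows by applying it to [- h] and [- phi]. The proof yields at most [3 * 2^k], so 5
    leaves room. *)
Lemma relaxation_upper (h phi : R -> R) (B M : R) (j : nat) :
  r0 / 2 <= A -> relaxation_adm -> (j <= k)%nat ->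
  (forall r, A <= r -> continuous phi r) ->
  (forall r, A < r -> is_derive phi r (b * r ^ S k * (h r - phi r))) ->
  (forall r, A < r -> Rabs (h r) <= B * / r ^ j) -> 0 <= B ->
  (b < 0 -> forall r, A <= r -> Rabs (phi r) <= M) ->
  (0 < b -> Rabs (phi r0) <= B * / r0 ^ j) ->
  forall r, A <= r -> phi r <= 5 * 2 ^ k * B * / r ^ j.
Proof.
intros hA2 adm hj cphi dphi hh hB hM h0 r hr.
assert (h2k : 1 <= 2 ^ k) by (apply pow_R1_Rle; lra).
assert (hwA : forall s, A <= s -> 0 < / s ^ j) by (intros; apply inv_pow_pos; lra).
destruct adm as [hn|[hp [adm1 adm2]]].
(* For [b < 0] the barrier [B / r^j] works unchanged: the equation is solved from infinity inwards
   and the barrier grows in that direction. The bound [M] only serves to make the product with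
   [expo] tend to 0. *)
- assert (h1 : 0 <= expo k b r * (B * / r ^ j - phi r)).
  { apply (lim_le_of_decr (fun s => expo k b s * (B * / s ^ j - phi s))
      (fun s => b * s ^ S k * expo k b s * (B * / s ^ j - phi s) +
         expo k b s * (B * (- INR j / s ^ S j) - b * s ^ S k * (h s - phi s))) A); trivial.
    - intros s hs. apply (continuous_mult (expo k b) (fun s => B * / s ^ j - phi s)).
      + apply (ex_derive_continuous (expo k b)). eexists. apply is_derive_expo.
      + apply (continuous_minus (fun s => B * / s ^ j) phi); auto.
        apply (continuous_scal_r B (fun s => / s ^ j)). apply continuous_inv_pow. lra.
    - intros s hs. apply (is_derive_mult (expo k b) (fun s => B * / s ^ j - phi s)).
      + apply is_derive_expo.
      + apply (is_derive_minus (fun s => B * / s ^ j) phi); auto.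
        apply (is_derive_scal (fun s => / s ^ j)). apply is_derive_inv_pow. lra.
      + intros; apply Rmult_comm.
    - intros s hs.
      replace (b * s ^ S k * expo k b s * (B * / s ^ j - phi s) +
         expo k b s * (B * (- INR j / s ^ S j) - b * s ^ S k * (h s - phi s))) with
       (- (expo k b s * ((- b * s ^ S k) * (B * / s ^ j - h s) + B * (INR j * / s ^ S j))))
       by (unfold Rdiv; ring).
      generalize (hh s hs). intros h1. apply Rabs_le_between in h1.
      assert (0 < expo k b s) by apply expo_pos.
      assert (0 < s ^ S k) by (apply pow_lt; lra).
      assert (0 < / s ^ S j) by (apply inv_pow_pos; lra).
      generalize (pos_INR j). intros hj0.
      assert (0 <= (- b * s ^ S k) * (B * / s ^ j - h s)).
      { apply Rmult_le_pos; [apply Rmult_le_pos; lra | lra]. }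
      assert (0 <= B * (INR j * / s ^ S j)).
      { apply Rmult_le_pos; trivial. apply Rmult_le_pos; lra. }
      nra.
    - apply (is_lim_dominated _ (fun s => (B * / A ^ j + M) * expo k b s) A).
      + intros s hs. rewrite Rabs_mult, Rabs_right by (apply Rle_ge, Rlt_le, expo_pos).
        rewrite Rmult_comm. apply Rmult_le_compat_r; [apply Rlt_le, expo_pos|].
        eapply Rle_trans; [apply Rabs_triang|]. rewrite Rabs_Ropp.
        apply Rplus_le_compat; auto.
        rewrite Rabs_right.
        * apply Rmult_le_compat_l; trivial. now apply inv_pow_antitone.
        * apply Rle_ge, Rmult_le_pos; trivial. apply Rlt_le, hwA. lra.
      + now apply is_lim_scal0, is_lim_expo. }
  assert (he : 0 < expo k b r) by apply expo_pos.
  assert (phi r <= B * / r ^ j) by nra.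
  assert (0 <= B * / r ^ j) by (apply Rmult_le_pos; [trivial | apply Rlt_le, hwA; lra]).
  replace (5 * 2 ^ k * B * / r ^ j) with (5 * 2 ^ k * (B * / r ^ j)) by ring. nra.
(* Going outwards, [phi] has to keep up with a target that decays at the logarithmic rate [j / r].
   Doubling the barrier suffices because the relaxation rate [b r^(k+1)] is at least [2 j / r]; this
   is the second condition in [relaxation_adm]. *)
- assert (hfwd : forall s, r0 <= s -> phi s <= 2 * B * / s ^ j).
  { intros s hs.
    assert (h1 : expo k b s * (phi s - 2 * B * / s ^ j) <= expo k b r0 * (phi r0 - 2 * B * / r0 ^ j)).
    { apply (decr_half_line (fun s => expo k b s * (phi s - 2 * B * / s ^ j))
        (fun s => b * s ^ S k * expo k b s * (phi s - 2 * B * / s ^ j) +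
           expo k b s * (b * s ^ S k * (h s - phi s) - 2 * B * (- INR j / s ^ S j))) r0);
        trivial; try lra.
      - intros x hx. apply (continuous_mult (expo k b) (fun s => phi s - 2 * B * / s ^ j)).
        + apply (ex_derive_continuous (expo k b)). eexists. apply is_derive_expo.
        + apply (continuous_minus phi (fun s => 2 * B * / s ^ j)); [apply cphi; lra|].
          apply (continuous_scal_r (2 * B) (fun s => / s ^ j)). apply continuous_inv_pow. lra.
      - intros x hx. apply (is_derive_mult (expo k b) (fun s => phi s - 2 * B * / s ^ j)).
        + apply is_derive_expo.
        + apply (is_derive_minus phi (fun s => 2 * B * / s ^ j)); [apply dphi; lra|].
          apply (is_derive_scal (fun s => / s ^ j)). apply is_derive_inv_pow. lra.
        + intros; apply Rmult_comm.
      - intros x hx.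
        assert (hx0 : 0 < x) by lra.
        assert (hxk : 0 < x ^ S k) by (apply pow_lt; lra).
        assert (hxj : 0 < / x ^ j) by (apply inv_pow_pos; lra).
        replace (b * x ^ S k * expo k b x * (phi x - 2 * B * / x ^ j) +
           expo k b x * (b * x ^ S k * (h x - phi x) - 2 * B * (- INR j / x ^ S j))) with
         (- (expo k b x * (b * x ^ S k * (B * / x ^ j - h x) +
              B * (/ x ^ j * / x) * (b * x ^ S (S k) - 2 * INR j)))).
        2:{ simpl pow. field. split; [apply pow_nonzero|]; lra. }
        assert (he : 0 < expo k b x) by apply expo_pos.
        generalize (hh x ltac:(lra)). intros h1. apply Rabs_le_between in h1.
        assert (p1 : 0 <= b * x ^ S k * (B * / x ^ j - h x)).
        { apply Rmult_le_pos; [apply Rmult_le_pos; lra | lra]. }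
        assert (p2 : 0 <= B * (/ x ^ j * / x) * (b * x ^ S (S k) - 2 * INR j)).
        { apply Rmult_le_pos.
          - apply Rmult_le_pos; trivial. apply Rmult_le_pos; [lra|].
            now apply Rlt_le, Rinv_0_lt_compat.
          - assert (r0 ^ S (S k) <= x ^ S (S k)) by (apply pow_incr; lra).
            apply le_INR in hj. nra. }
        nra. }
    generalize (h0 hp). intros h3. apply Rabs_le_between in h3.
    assert (he : 0 < expo k b s) by apply expo_pos.
    assert (he0 : 0 < expo k b r0) by apply expo_pos.
    assert (0 <= B * / r0 ^ j) by (apply Rmult_le_pos; [trivial | apply Rlt_le, hwA; lra]).
    nra. }
  destruct (Rle_lt_dec r0 r) as [h1|h1].
  + generalize (hfwd r h1). intros h3.
    assert (0 <= B * / r ^ j) by (apply Rmult_le_pos; [trivial | apply Rlt_le, hwA; lra]).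
    replace (5 * 2 ^ k * B * / r ^ j) with (5 * 2 ^ k * (B * / r ^ j)) by ring. nra.
  (* To the left of [r0] a constant barrier is enough: [expo * (phi + BA)] is nondecreasing, and
     [expo] changes at most by the factor 2 between [r] and [r0], which is what [ln 2] in
     [relaxation_adm] provides. *)
  + set (BA := B * / A ^ j).
    assert (hBA : 0 <= BA) by (apply Rmult_le_pos; [trivial | apply Rlt_le, hwA; lra]).
    assert (h3 : expo k b r * (phi r + BA) <= expo k b r0 * (phi r0 + BA)).
    { apply Ropp_le_cancel.
      apply (decr_of_derive (fun s => - (expo k b s * (phi s + BA)))
        (fun s => - (b * s ^ S k * expo k b s * (phi s + BA) +
           expo k b s * (b * s ^ S k * (h s - phi s) + 0))) r r0).
      - lra.
      - intros s hs. apply (continuous_opp (fun s => expo k b s * (phi s + BA))).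
        apply (continuous_mult (expo k b) (fun s => phi s + BA)).
        + apply (ex_derive_continuous (expo k b)). eexists. apply is_derive_expo.
        + apply (continuous_plus phi (fun _ => BA)); [apply cphi; lra | apply continuous_const].
      - intros s hs. apply (is_derive_opp (fun s => expo k b s * (phi s + BA))).
        apply (is_derive_mult (expo k b) (fun s => phi s + BA)).
        + apply is_derive_expo.
        + apply (is_derive_plus phi (fun _ => BA)); [apply dphi; lra|].
          apply (@is_derive_const R_AbsRing).
        + intros; apply Rmult_comm.
      - intros s hs.
        replace (- (b * s ^ S k * expo k b s * (phi s + BA) +
           expo k b s * (b * s ^ S k * (h s - phi s) + 0))) with
           (- (expo k b s * (b * s ^ S k) * (BA + h s))) by ring.
        generalize (hh s ltac:(lra)). intros h3. apply Rabs_le_between in h3.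
        assert (/ s ^ j <= / A ^ j) by (apply inv_pow_antitone; lra).
        assert (0 < expo k b s) by apply expo_pos.
        assert (0 < s ^ S k) by (apply pow_lt; lra).
        assert (0 <= expo k b s * (b * s ^ S k)).
        { apply Rmult_le_pos; [lra|]. apply Rmult_le_pos; lra. }
        assert (0 <= BA + h s) by (unfold BA; nra).
        nra. }
    assert (he2 : expo k b r0 <= 2 * expo k b r).
    { replace (expo k b r0) with (exp (b * (r0 ^ S (S k) / INR (S (S k)) - r ^ S (S k) / INR (S (S k))))
        * expo k b r).
      - apply Rmult_le_compat_r; [apply Rlt_le, expo_pos|].
        assert (hE : b * (r0 ^ S (S k) / INR (S (S k)) - r ^ S (S k) / INR (S (S k))) <= ln 2).
        { eapply Rle_trans; [|apply adm2]. apply Rmult_le_compat_l; [lra|].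
          apply Rplus_le_compat_l, Ropp_le_contravar.
          apply Rmult_le_compat_r.
          - apply Rlt_le, Rinv_0_lt_compat, lt_0_INR. lia.
          - apply pow_incr. lra. }
        apply Rle_trans with (exp (ln 2)); [|rewrite exp_ln; lra].
        destruct hE as [hE|hE]; [left; now apply exp_increasing | rewrite hE; lra].
      - unfold expo. rewrite <- exp_plus. f_equal. ring. }
    generalize (h0 hp). intros h4. apply Rabs_le_between in h4.
    assert (he : 0 < expo k b r) by apply expo_pos.
    assert (he0 : 0 < expo k b r0) by apply expo_pos.
    (* The factor [2^k] of the final bound enters here, as [A] may be as small as [r0 / 2]. *)
    assert (hw0 : / A ^ j <= 2 ^ k * / r0 ^ j).
    { replace (2 ^ k * / r0 ^ j) with (2 ^ k * / 2 ^ j * / (r0 / 2) ^ j).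
      2:{ unfold Rdiv. rewrite Rpow_mult_distr, pow_inv.
          field. split; apply pow_nonzero; lra. }
      assert (/ A ^ j <= / (r0 / 2) ^ j) by (apply inv_pow_antitone; lra).
      assert (1 <= 2 ^ k * / 2 ^ j).
      { replace k with (j + (k - j))%nat by lia. rewrite pow_add.
        replace (2 ^ j * 2 ^ (k - j) * / 2 ^ j) with (2 ^ (k - j))
          by (field; apply pow_nonzero; lra).
        apply pow_R1_Rle; lra. }
      assert (0 < / (r0 / 2) ^ j) by (apply inv_pow_pos; lra).
      nra. }
    assert (hw1 : / r0 ^ j <= / r ^ j) by (apply inv_pow_antitone; lra).
    assert (hB0 : 0 <= B * / r0 ^ j) by (apply Rmult_le_pos; [trivial | apply Rlt_le, hwA; lra]).
    assert (hBA2 : BA <= 2 ^ k * (B * / r0 ^ j)).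
    { unfold BA. replace (2 ^ k * (B * / r0 ^ j)) with (B * (2 ^ k * / r0 ^ j)) by ring.
      now apply Rmult_le_compat_l. }
    assert (h5 : phi r + BA <= 2 * (B * / r0 ^ j + BA)).
    { assert (expo k b r0 * (phi r0 + BA) <= expo k b r0 * (B * / r0 ^ j + BA)).
      { apply Rmult_le_compat_l; lra. }
      assert (expo k b r0 * (B * / r0 ^ j + BA) <= 2 * expo k b r * (B * / r0 ^ j + BA)).
      { apply Rmult_le_compat_r; lra. }
      apply (Rmult_le_reg_l (expo k b r)); trivial. lra. }
    assert (B * / r0 ^ j <= B * / r ^ j) by now apply Rmult_le_compat_l.
    replace (5 * 2 ^ k * B * / r ^ j) with (5 * (2 ^ k * (B * / r ^ j))) by ring.
    assert (2 ^ k * (B * / r0 ^ j) <= 2 ^ k * (B * / r ^ j)) by (apply Rmult_le_compat_l; lra).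
    assert (B * / r0 ^ j <= 2 ^ k * (B * / r0 ^ j)) by nra.
    lra.
Qed.

Lemma relaxation_estimate (h phi : R -> R) (B M : R) (j : nat) :
  r0 / 2 <= A -> relaxation_adm -> (j <= k)%nat ->
  (forall r, A <= r -> continuous phi r) ->
  (forall r, A < r -> is_derive phi r (b * r ^ S k * (h r - phi r))) ->
  (forall r, A < r -> Rabs (h r) <= B * / r ^ j) -> 0 <= B ->
  (b < 0 -> forall r, A <= r -> Rabs (phi r) <= M) ->
  (0 < b -> Rabs (phi r0) <= B * / r0 ^ j) ->
  forall r, A <= r -> Rabs (phi r) <= 5 * 2 ^ k * B * / r ^ j.
Proof.
intros hA2 adm hj cphi dphi hh hB hM h0 r hr.
apply Rabs_le_between. split.
- apply Ropp_le_cancel. rewrite Ropp_involutive.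
  apply (relaxation_upper (fun s => - h s) (fun s => - phi s) B M j); auto.
  + intros s hs. apply (continuous_opp phi); auto.
  + intros s hs. replace (b * s ^ S k * (- h s - - phi s)) with
      (- (b * s ^ S k * (h s - phi s))) by ring.
    apply (is_derive_opp phi); auto.
  + intros s hs. rewrite Rabs_Ropp; auto.
  + intros hb s hs. rewrite Rabs_Ropp; auto.
  + intros hb. rewrite Rabs_Ropp; auto.
- now apply (relaxation_upper h phi B M j).
Qed.

End Relaxation.

(** * The contraction *)

Lemma Rabs_mult_le (a b A B : R) : Rabs a <= A -> Rabs b <= B -> Rabs (a * b) <= A * B.
Proof. intros; rewrite Rabs_mult; apply Rmult_le_compat; auto using Rabs_pos. Qed.

Lemma Rabs_plus_le (a b A B : R) : Rabs a <= A -> Rabs b <= B -> Rabs (a + b) <= A + B.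
Proof. intros; eapply Rle_trans; [apply Rabs_triang|]; lra. Qed.

Lemma Rabs_mult_minus_le (a1 a2 b1 b2 A A' B B' : R) :
  Rabs a1 <= A -> Rabs (b1 - b2) <= B' -> Rabs b2 <= B -> Rabs (a1 - a2) <= A' ->
  Rabs (a1 * b1 - a2 * b2) <= A * B' + B * A'.
Proof.
intros. replace (a1 * b1 - a2 * b2) with (a1 * (b1 - b2) + b2 * (a1 - a2)) by ring.
apply Rabs_plus_le; now apply Rabs_mult_le.
Qed.

(** * Bounded Lipschitz functions, an algebra containing all coefficients *)

Section BoundedLipschitz.
Variables (Z : Type) (dom : Z -> Prop) (dist : Z -> Z -> R).
Hypothesis dist_pos : forall z w, 0 <= dist z w.

(** One constant serves as bound and as Lipschitz constant. The class is closed under sums, products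
    and inverses of functions bounded below by a positive number, so estimates for long expressions
    follow from their syntax. *)
Definition bdlip (F : Z -> R) := exists M, 0 <= M /\
  (forall z, dom z -> Rabs (F z) <= M) /\
  (forall z w, dom z -> dom w -> Rabs (F z - F w) <= M * dist z w).

Lemma bdlip_const (c : R) : bdlip (fun _ => c).
Proof.
exists (Rabs c). split; [apply Rabs_pos|]. split; [intros; lra|].
intros z w _ _. rewrite Rminus_diag, Rabs_R0.
apply Rmult_le_pos; [apply Rabs_pos | apply dist_pos].
Qed.

Lemma bdlip_plus (F G : Z -> R) : bdlip F -> bdlip G -> bdlip (fun z => F z + G z).
Proof.
intros [M [hM [bF lF]]] [M' [hM' [bG lG]]]. exists (M + M'). split; [lra|]. split.
- intros z hz. eapply Rle_trans; [apply Rabs_triang|].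
  generalize (bF z hz) (bG z hz). lra.
- intros z w hz hw. replace (F z + G z - (F w + G w)) with ((F z - F w) + (G z - G w)) by ring.
  eapply Rle_trans; [apply Rabs_triang|].
  generalize (lF z w hz hw) (lG z w hz hw). lra.
Qed.

Lemma bdlip_mult (F G : Z -> R) : bdlip F -> bdlip G -> bdlip (fun z => F z * G z).
Proof.
intros [M [hM [bF lF]]] [M' [hM' [bG lG]]].
exists (M * M' + M * M'). split; [nra|]. split.
- intros z hz. rewrite Rabs_mult.
  generalize (bF z hz) (bG z hz) (Rabs_pos (F z)) (Rabs_pos (G z)). nra.
- intros z w hz hw.
  replace (F z * G z - F w * G w) with (F z * (G z - G w) + G w * (F z - F w)) by ring.
  eapply Rle_trans; [apply Rabs_triang|]. rewrite !Rabs_mult.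
  rewrite Rmult_plus_distr_r. apply Rplus_le_compat.
  + rewrite Rmult_assoc. apply Rmult_le_compat; auto using Rabs_pos.
  + rewrite (Rmult_comm M), Rmult_assoc. apply Rmult_le_compat; auto using Rabs_pos.
Qed.

Lemma bdlip_inv (F : Z -> R) (c : R) : 0 < c -> (forall z, dom z -> c <= F z) ->
  bdlip F -> bdlip (fun z => / F z).
Proof.
intros hc hF [M [hM [_ lF]]].
assert (hi : forall z, dom z -> 0 < / F z <= / c).
{ intros z hz. generalize (hF z hz). intros h. split.
  - apply Rinv_0_lt_compat. lra.
  - apply Rinv_le_contravar; lra. }
assert (hci : 0 < / c) by now apply Rinv_0_lt_compat.
exists (/ c + / c * / c * M). split.
{ assert (0 <= / c * / c * M) by (apply Rmult_le_pos; nra). lra. }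
split.
- intros z hz. generalize (hi z hz). intros h.
  rewrite Rabs_right by lra.
  assert (0 <= / c * / c * M) by (apply Rmult_le_pos; nra). lra.
- intros z w hz hw. generalize (hF z hz) (hF w hw). intros h1 h2.
  replace (/ F z - / F w) with ((/ F z * / F w) * - (F z - F w)) by (field; lra).
  rewrite Rabs_mult, Rabs_Ropp.
  generalize (hi z hz) (hi w hw) (lF z w hz hw) (Rabs_pos (F z - F w)) (dist_pos z w).
  intros p1 p2 p3 p4 p5.
  rewrite (Rabs_right (/ F z * / F w)) by nra.
  apply Rle_trans with (/ c * / c * (M * dist z w)).
  + apply Rmult_le_compat; trivial; [nra|]. apply Rmult_le_compat; lra.
  + assert (0 <= / c * dist z w) by (apply Rmult_le_pos; lra). lra.
Qed.

End BoundedLipschitz.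

(* A point [(r^(-2N), r^(-N-1), phi, psi, I, m)] at which the right-hand sides are evaluated. *)
Record point := Point { pa : R; pb : R; pphi : R; ppsi : R; pI : R; pm : R }.

Definition pdist (z w : point) :=
  Rabs (pa z - pa w) + Rabs (pb z - pb w) + Rabs (pphi z - pphi w) +
  Rabs (ppsi z - ppsi w) + Rabs (pI z - pI w) + Rabs (pm z - pm w).

(** The bound [vp / 2] on [phi] keeps the specific volume [vp + phi] above [vp / 2]. *)
Definition pdom (vp W : R) (z : point) :=
  Rabs (pa z) <= W /\ Rabs (pb z) <= W /\ Rabs (pphi z) <= vp / 2 /\
  Rabs (ppsi z) <= 1 /\ Rabs (pI z) <= W /\ Rabs (pm z) <= 1.

Lemma pdist_pos (z w : point) : 0 <= pdist z w.
Proof.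
unfold pdist. generalize (Rabs_pos (pa z - pa w)) (Rabs_pos (pb z - pb w))
  (Rabs_pos (pphi z - pphi w)) (Rabs_pos (ppsi z - ppsi w)) (Rabs_pos (pI z - pI w))
  (Rabs_pos (pm z - pm w)). lra.
Qed.

Lemma bdlip_proj (vp W : R) (F : point -> R) (M : R) :
  (forall z, pdom vp W z -> Rabs (F z) <= M) ->
  (forall z w, Rabs (F z - F w) <= pdist z w) -> bdlip point (pdom vp W) pdist F.
Proof.
intros h1 h2. exists (1 + Rabs M). generalize (Rabs_pos M) (Rle_abs M). intros p1 p2. split; [lra|].
split.
- intros z hz. generalize (h1 z hz). lra.
- intros z w _ _. generalize (h2 z w) (pdist_pos z w). nra.
Qed.

(** * The reduced system for [phi] and [psi]: one step of the iteration, contraction, fixed point *)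

Section Reduced.
Variables (k : nat) (r0 cV Rg nu kap mu vp tp : R).
Hypotheses (hk : (1 <= k)%nat) (hr0 : 0 < r0) (hcV : 0 < cV) (hRg : 0 < Rg) (hnu : 0 < nu)
  (hkap : 0 < kap) (hmu : 0 < mu) (hvp : 0 < vp) (htp : 0 < tp).

Definition ppl := Rg * tp / vp.
(** Minus the derivative of [v -> Rg * tp / v] at [vp]: the linearised pressure response, and hence
    the coefficient in the relaxation rate [apl / (mu * m)]. *)
Definition apl := Rg * tp / vp ^ 2.

Definition Qz (z : point) := pa z * (vp + pphi z) + - INR (S k) * pI z.

(** The energy flux per unit mass, [e + u^2 / 2 + v (p - mu div u) + 2 nu N r^(N-1) u^2 / m], less
    its constant part. The momentum integral replaces [p - mu div u] by [p+ - m^2 Q], so no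
    derivative of the unknowns survives. The last term comes from [mu (div u)^2 - Psi = 2 nu N
    r^(-N) (r^(N-1) u^2)']. *)
Definition qz (z : point) :=
  cV * ppsi z + ppl * pphi z +
  pm z * ((vp + pphi z) * (pm z * (INR (S k) * pI z + - / 2 * (pa z * (vp + pphi z))) +
    2 * nu * INR (S k) * (pb z * (vp + pphi z)))).

(** The exact identity [Rg theta / v - p+ + m^2 Q = fz - apl phi]: the linear part in [phi] is split
    off as the relaxation term, and what remains of it, [apl phi^2 / v], is quadratic. *)
Definition fz (z : point) :=
  Rg * (ppsi z * / (vp + pphi z)) + apl * (pphi z * (pphi z * / (vp + pphi z))) +
  pm z * (pm z * Qz z).

Definition state_at (phi psi I : R -> R) (m r : R) :=
  Point (/ r ^ (2 * S k)) (/ r ^ S (S k)) (phi r) (psi r) (I r) m.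

(* One step of the iteration [(phi, psi) -> (phi', psi')]; [phi'] is driven by the new [psi']. *)
Definition step (A m phi0 psi0 : R) (phi psi phi' psi' I : R -> R) : Prop :=
  (forall r, A <= r -> continuous I r) /\
  (forall r, A < r -> is_derive I r (- ((vp + phi r) * / r ^ S (2 * S k)))) /\
  is_lim I p_infty 0 /\
  (forall r, A <= r -> continuous psi' r) /\
  (exists K, forall r, A < r ->
     is_derive psi' r ((m * qz (state_at phi psi I m r) / kap - K) / r ^ S k)) /\
  psi' r0 = psi0 /\ is_lim psi' p_infty 0 /\
  (forall r, A <= r -> continuous phi' r) /\
  (forall r, A < r ->
     is_derive phi' r (apl / (mu * m) * r ^ S k * (fz (state_at phi psi' I m r) / apl - phi' r))) /\
  (0 < m -> phi' r0 = phi0) /\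
  (m < 0 -> exists M, forall r, A <= r -> Rabs (phi' r) <= M).

(** Upper bounds on [[r0 / 2, oo)], where all admissible [A] lie: [Wb] for the weights [/ r^j] that
    occur, [Wc] also for the tail integral [I]. *)
Definition Wb := 1 + / (r0 / 2) ^ k + / (r0 / 2) ^ (2 * S k) + / (r0 / 2) ^ S (S k).
Definition Wc := Wb + 2 * vp * Wb.

Lemma Wb_ge (r : R) : r0 / 2 <= r ->
  / r ^ k <= Wb /\ / r ^ (2 * S k) <= Wb /\ / r ^ S (S k) <= Wb.
Proof.
intros hr. assert (h0 : 0 < r0 / 2) by lra.
generalize (inv_pow_antitone _ _ k h0 hr) (inv_pow_antitone _ _ (2 * S k) h0 hr)
  (inv_pow_antitone _ _ (S (S k)) h0 hr) (inv_pow_pos (r0 / 2) k h0)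
  (inv_pow_pos (r0 / 2) (2 * S k) h0) (inv_pow_pos (r0 / 2) (S (S k)) h0).
unfold Wb. lra.
Qed.

Lemma Wb_ge1 : 1 <= Wb.
Proof.
assert (h0 : 0 < r0 / 2) by lra.
generalize (inv_pow_pos (r0 / 2) k h0)
  (inv_pow_pos (r0 / 2) (2 * S k) h0) (inv_pow_pos (r0 / 2) (S (S k)) h0).
unfold Wb. lra.
Qed.

Lemma apl_pos : 0 < apl.
Proof. unfold apl. apply Rdiv_lt_0_compat; [nra|]. apply pow_lt; lra. Qed.

Let BL := bdlip point (pdom vp Wc) pdist.

Let bl_a : BL pa.
Proof.
apply (bdlip_proj _ _ _ Wc); [now intros z [h _]|]. intros z w. unfold pdist.
generalize (Rabs_pos (pb z - pb w))
  (Rabs_pos (pphi z - pphi w)) (Rabs_pos (ppsi z - ppsi w)) (Rabs_pos (pI z - pI w))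
  (Rabs_pos (pm z - pm w)). lra.
Qed.
Let bl_b : BL pb.
Proof.
apply (bdlip_proj _ _ _ Wc); [now intros z [_ [h _]]|]. intros z w. unfold pdist.
generalize (Rabs_pos (pa z - pa w))
  (Rabs_pos (pphi z - pphi w)) (Rabs_pos (ppsi z - ppsi w)) (Rabs_pos (pI z - pI w))
  (Rabs_pos (pm z - pm w)). lra.
Qed.
Let bl_phi : BL pphi.
Proof.
apply (bdlip_proj _ _ _ (vp / 2)); [now intros z [_ [_ [h _]]]|]. intros z w. unfold pdist.
generalize (Rabs_pos (pa z - pa w))
  (Rabs_pos (pb z - pb w)) (Rabs_pos (ppsi z - ppsi w)) (Rabs_pos (pI z - pI w))
  (Rabs_pos (pm z - pm w)). lra.
Qed.
Let bl_psi : BL ppsi.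
Proof.
apply (bdlip_proj _ _ _ 1); [now intros z [_ [_ [_ [h _]]]]|]. intros z w. unfold pdist.
generalize (Rabs_pos (pa z - pa w))
  (Rabs_pos (pphi z - pphi w)) (Rabs_pos (pb z - pb w)) (Rabs_pos (pI z - pI w))
  (Rabs_pos (pm z - pm w)). lra.
Qed.
Let bl_I : BL pI.
Proof.
apply (bdlip_proj _ _ _ Wc); [now intros z [_ [_ [_ [_ [h _]]]]]|]. intros z w. unfold pdist.
generalize (Rabs_pos (pa z - pa w))
  (Rabs_pos (pphi z - pphi w)) (Rabs_pos (ppsi z - ppsi w)) (Rabs_pos (pb z - pb w))
  (Rabs_pos (pm z - pm w)). lra.
Qed.
Let bl_m : BL pm.
Proof.
apply (bdlip_proj _ _ _ 1); [now intros z [_ [_ [_ [_ [_ h]]]]]|]. intros z w. unfold pdist.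
generalize (Rabs_pos (pa z - pa w))
  (Rabs_pos (pphi z - pphi w)) (Rabs_pos (ppsi z - ppsi w)) (Rabs_pos (pI z - pI w))
  (Rabs_pos (pb z - pb w)). lra.
Qed.
Let bl_c (c : R) : BL (fun _ => c).
Proof. apply bdlip_const, pdist_pos. Qed.
Let bl_v : BL (fun z => vp + pphi z).
Proof. apply (bdlip_plus _ _ _ (fun _ => vp)); fold BL; auto. Qed.
Let bl_iv : BL (fun z => / (vp + pphi z)).
Proof.
apply (bdlip_inv _ _ _ pdist_pos _ (vp / 2)); [lra | | exact bl_v].
intros z [_ [_ [h _]]]. apply Rabs_le_between in h. lra.
Qed.
Let bl_phv : BL (fun z => pphi z * / (vp + pphi z)).
Proof. apply (bdlip_mult _ _ _ pphi); fold BL; auto. Qed.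
Let bl_av : BL (fun z => pa z * (vp + pphi z)).
Proof. apply (bdlip_mult _ _ _ pa); fold BL; auto. Qed.
Let bl_bv : BL (fun z => pb z * (vp + pphi z)).
Proof. apply (bdlip_mult _ _ _ pb); fold BL; auto. Qed.
Let bl_mQ : BL (fun z => pm z * Qz z).
Proof.
apply (bdlip_mult _ _ _ pm); fold BL; auto.
apply (bdlip_plus _ _ _ (fun z => pa z * (vp + pphi z))); fold BL; auto.
apply (bdlip_mult _ _ _ (fun _ => - INR (S k))); fold BL; auto.
Qed.
Let bl_q : BL qz.
Proof.
apply (bdlip_plus _ _ _ (fun z => cV * ppsi z + ppl * pphi z)).
- apply (bdlip_plus _ _ _ (fun z => cV * ppsi z)).
  + apply (bdlip_mult _ _ _ (fun _ => cV)); fold BL; auto.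
  + apply (bdlip_mult _ _ _ (fun _ => ppl)); fold BL; auto.
- apply (bdlip_mult _ _ _ pm); fold BL; auto. apply (bdlip_mult _ _ _ (fun z => vp + pphi z)); fold BL; auto.
  apply (bdlip_plus _ _ _ (fun z => pm z * (INR (S k) * pI z + - / 2 * (pa z * (vp + pphi z))))).
  + apply (bdlip_mult _ _ _ pm); fold BL; auto. apply (bdlip_plus _ _ _ (fun z => INR (S k) * pI z)).
    * apply (bdlip_mult _ _ _ (fun _ => INR (S k))); fold BL; auto.
    * apply (bdlip_mult _ _ _ (fun _ => - / 2)); fold BL; auto.
  + apply (bdlip_mult _ _ _ (fun _ => 2 * nu * INR (S k))); fold BL; auto.
Qed.

(** [fz] is missing on purpose. Its estimates must show the small factors [psi], [phi] and [m], so
    only the cofactors [/ v], [phi / v] and [m Q] are bounded here. *)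
Lemma rhs_bounds : exists M, 0 < M /\
  (forall z, pdom vp Wc z -> Rabs (qz z) <= M /\ Rabs (/ (vp + pphi z)) <= M /\
     Rabs (pphi z * / (vp + pphi z)) <= M /\ Rabs (pm z * Qz z) <= M) /\
  (forall z w, pdom vp Wc z -> pdom vp Wc w ->
     Rabs (qz z - qz w) <= M * pdist z w /\
     Rabs (/ (vp + pphi z) - / (vp + pphi w)) <= M * pdist z w /\
     Rabs (pphi z * / (vp + pphi z) - pphi w * / (vp + pphi w)) <= M * pdist z w /\
     Rabs (pm z * Qz z - pm w * Qz w) <= M * pdist z w).
Proof.
destruct bl_q as [M1 [p1 [b1 l1]]], bl_iv as [M2 [p2 [b2 l2]]], bl_phv as [M3 [p3 [b3 l3]]],
  bl_mQ as [M4 [p4 [b4 l4]]].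
exists (1 + M1 + M2 + M3 + M4). split; [lra|]. split.
- intros z hz. generalize (b1 z hz) (b2 z hz) (b3 z hz) (b4 z hz). intros; repeat split; lra.
- intros z w hz hw.
  generalize (l1 z w hz hw) (l2 z w hz hw) (l3 z w hz hw) (l4 z w hz hw) (pdist_pos z w).
  intros q1 q2 q3 q4 q5. rewrite !Rmult_plus_distr_r.
  generalize (Rmult_le_pos _ _ p1 q5) (Rmult_le_pos _ _ p2 q5) (Rmult_le_pos _ _ p3 q5)
    (Rmult_le_pos _ _ p4 q5).
  intros; repeat split; lra.
Qed.


Let h2N : 2 <= INR (2 * S k).
Proof. apply (le_INR 2). lia. Qed.

Lemma tail_bound (A : R) (phi I : R -> R) : r0 / 2 <= A ->
  (forall r, A <= r -> continuous I r) ->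
  (forall r, A < r -> is_derive I r (- ((vp + phi r) * / r ^ S (2 * S k)))) ->
  is_lim I p_infty 0 -> (forall r, A <= r -> Rabs (phi r) <= vp / 2) ->
  forall r, A <= r -> Rabs (I r) <= vp * / r ^ (2 * S k).
Proof.
intros hA cI dI lI hphi.
apply (dominated_by_decay I (fun r => - ((vp + phi r) * / r ^ S (2 * S k)))
  (fun r => vp * / r ^ (2 * S k)) (fun r => vp * (- INR (2 * S k) / r ^ S (2 * S k))) A); trivial.
- intros r hr. apply (continuous_scal_r vp (fun s => / s ^ (2 * S k))).
  apply continuous_inv_pow. lra.
- intros r hr. apply (is_derive_scal (fun s => / s ^ (2 * S k))).
  apply is_derive_inv_pow. lra.
- intros r hr. rewrite Rabs_Ropp.
  assert (hp : 0 < / r ^ S (2 * S k)) by (apply inv_pow_pos; lra).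
  replace (- (vp * (- INR (2 * S k) / r ^ S (2 * S k)))) with
    (vp * INR (2 * S k) * / r ^ S (2 * S k)) by (unfold Rdiv; ring).
  apply Rabs_mult_le; [|rewrite Rabs_right; lra].
  generalize (hphi r (Rlt_le _ _ hr)). intros h1. apply Rabs_le_between in h1.
  rewrite Rabs_right by lra. nra.
- apply is_lim_scal0, is_lim_inv_pow. lia.
Qed.

Lemma tail_diff (A d : R) (phi1 I1 phi2 I2 : R -> R) : r0 / 2 <= A ->
  (forall r, A <= r -> continuous I1 r) ->
  (forall r, A < r -> is_derive I1 r (- ((vp + phi1 r) * / r ^ S (2 * S k)))) ->
  is_lim I1 p_infty 0 ->
  (forall r, A <= r -> continuous I2 r) ->
  (forall r, A < r -> is_derive I2 r (- ((vp + phi2 r) * / r ^ S (2 * S k)))) ->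
  is_lim I2 p_infty 0 -> (forall r, A <= r -> Rabs (phi1 r - phi2 r) <= d) ->
  forall r, A <= r -> Rabs (I1 r - I2 r) <= d * / r ^ (2 * S k).
Proof.
intros hA cI1 dI1 lI1 cI2 dI2 lI2 hphi.
assert (hd : 0 <= d) by (eapply Rle_trans; [apply Rabs_pos | apply (hphi A); lra]).
apply (dominated_by_decay (fun r => I1 r - I2 r)
  (fun r => - ((vp + phi1 r) * / r ^ S (2 * S k)) - - ((vp + phi2 r) * / r ^ S (2 * S k)))
  (fun r => d * / r ^ (2 * S k)) (fun r => d * (- INR (2 * S k) / r ^ S (2 * S k))) A).
- intros r hr. apply (continuous_minus I1 I2); auto.
- intros r hr. apply (continuous_scal_r d (fun s => / s ^ (2 * S k))).
  apply continuous_inv_pow. lra.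
- intros r hr. apply (is_derive_minus I1 I2); auto.
- intros r hr. apply (is_derive_scal (fun s => / s ^ (2 * S k))).
  apply is_derive_inv_pow. lra.
- intros r hr.
  assert (hp : 0 < / r ^ S (2 * S k)) by (apply inv_pow_pos; lra).
  replace (- ((vp + phi1 r) * / r ^ S (2 * S k)) - - ((vp + phi2 r) * / r ^ S (2 * S k)))
    with (- (phi1 r - phi2 r) * / r ^ S (2 * S k)) by ring.
  replace (- (d * (- INR (2 * S k) / r ^ S (2 * S k)))) with
    (d * INR (2 * S k) * / r ^ S (2 * S k)) by (unfold Rdiv; ring).
  apply Rabs_mult_le; [|rewrite Rabs_right; lra].
  rewrite Rabs_Ropp. generalize (hphi r (Rlt_le _ _ hr)). nra.
- apply is_lim_ext with (fun r => I1 r + - 1 * I2 r); [intros; ring|].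
  apply is_lim_plus0; trivial. now apply is_lim_scal0.
- apply is_lim_scal0, is_lim_inv_pow. lia.
Qed.

Lemma state_at_dom (phi psi I : R -> R) (m r : R) : r0 / 2 <= r ->
  Rabs (phi r) <= vp / 2 -> Rabs (psi r) <= 1 -> Rabs m <= 1 ->
  Rabs (I r) <= vp * / r ^ (2 * S k) -> pdom vp Wc (state_at phi psi I m r).
Proof.
intros hr h1 h2 h3 h4. destruct (Wb_ge r hr) as [w1 [w2 w3]].
generalize Wb_ge1. intros w4.
assert (0 < / r ^ (2 * S k)) by (apply inv_pow_pos; lra).
assert (0 < / r ^ S (S k)) by (apply inv_pow_pos; lra).
assert (hW : Wb <= Wc) by (unfold Wc; nra).
repeat split; unfold state_at; cbn [pa pb pphi ppsi pI pm]; trivial.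
- rewrite Rabs_right; lra.
- rewrite Rabs_right; lra.
- eapply Rle_trans; [apply h4|]. unfold Wc. nra.
Qed.

(** The forcing of [psi'] carries [m], which gives the factor [eps]. In the forcing of [phi'] each
    product has one factor bounded by [delta] or [eps], or contains the difference of the new
    [psi'], which is already small. The fluxes [m1] and [m2] may differ, but only by a relative
    amount of order [d]. *)
Lemma step_contraction : exists C, 0 < C /\
  forall (A m1 m2 phi0 psi0 delta eps d : R)
    (phi1 psi1 phi1' psi1' I1 phi2 psi2 phi2' psi2' I2 : R -> R),
  r0 / 2 <= A <= r0 -> relaxation_adm k A r0 (apl / (mu * m1)) ->
  (0 < m1 /\ 0 < m2 \/ m1 < 0 /\ m2 < 0) ->
  Rabs m1 <= eps -> Rabs m2 <= eps -> eps <= 1 ->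
  Rabs (m1 - m2) <= 2 / vp * d * Rabs m2 ->
  delta <= vp / 2 -> delta <= 1 ->
  (forall r, A <= r -> Rabs (phi1 r) <= delta /\ Rabs (psi1 r) <= delta /\
    Rabs (phi1' r) <= delta /\ Rabs (psi1' r) <= delta) ->
  (forall r, A <= r -> Rabs (phi2 r) <= delta /\ Rabs (psi2 r) <= delta /\
    Rabs (phi2' r) <= delta /\ Rabs (psi2' r) <= delta) ->
  (forall r, A <= r -> Rabs (phi1 r - phi2 r) <= d /\ Rabs (psi1 r - psi2 r) <= d) ->
  step A m1 phi0 psi0 phi1 psi1 phi1' psi1' I1 ->
  step A m2 phi0 psi0 phi2 psi2 phi2' psi2' I2 ->
  forall r, A <= r -> Rabs (psi1' r - psi2' r) <= C * eps * d /\
    Rabs (phi1' r - phi2' r) <= C * (delta + eps) * d.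
Proof.
destruct rhs_bounds as [M [hM [bM lM]]].
assert (hap := apl_pos). assert (hW1 := Wb_ge1).
assert (hkR : 0 < INR k) by (apply lt_0_INR; lia).
set (Lm := 2 / vp). assert (hLm : 0 < Lm) by (apply Rdiv_lt_0_compat; lra).
set (L := 2 + Wb + Lm). assert (hL : 0 < L) by (unfold L; lra).
set (Cg := (M * L + M * Lm) / kap).
assert (hCg : 0 < Cg) by (apply Rdiv_lt_0_compat; nra).
set (Cs := 2 * Cg / INR k * Wb).
assert (hCs : 0 < Cs) by (apply Rmult_lt_0_compat; [apply Rdiv_lt_0_compat|]; lra).
set (Cf := Rg * (M * L + M * Cs) + apl * (M * L + M) + (M * L + M * Lm)).
set (Cv := Rg * M + apl * M + M).
assert (hML : 0 < M * L) by nra. assert (hMC : 0 < M * Cs) by nra.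
assert (hMLm : 0 < M * Lm) by nra.
assert (hRM : 0 < Rg * M) by nra. assert (haM : 0 < apl * M) by nra.
assert (hCf : 0 < Cf).
{ unfold Cf. assert (0 < Rg * (M * L + M * Cs)) by (apply Rmult_lt_0_compat; lra).
  assert (0 < apl * (M * L + M)) by (apply Rmult_lt_0_compat; lra). lra. }
assert (hCv : 0 < Cv) by (unfold Cv; lra).
set (Ch := Cf / apl + Lm * (Cv / apl + 1)).
assert (hCfa : 0 < Cf / apl) by now apply Rdiv_lt_0_compat.
assert (hCva : 0 < Cv / apl) by now apply Rdiv_lt_0_compat.
assert (hCh : 0 < Ch).
{ unfold Ch. assert (0 < Lm * (Cv / apl + 1)) by (apply Rmult_lt_0_compat; lra). lra. }
assert (h2k : 0 < 5 * 2 ^ k) by (assert (0 < 2 ^ k) by (apply pow_lt; lra); lra).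
assert (hC2 : 0 < 5 * 2 ^ k * Ch) by now apply Rmult_lt_0_compat.
exists (Cs + 5 * 2 ^ k * Ch). split; [lra|].
intros A m1 m2 phi0 psi0 delta eps d phi1 psi1 phi1' psi1' I1 phi2 psi2 phi2' psi2' I2
  [hA hAr] adm sg hm1 hm2 heps hm12 hdel1 hdel2 b1 b2 hd
  [cI1 [dI1 [lI1 [cs1 [[K1 ds1] [s01 [ls1 [cp1 [dp1 [p01 Mp1]]]]]]]]]]
  [cI2 [dI2 [lI2 [cs2 [[K2 ds2] [s02 [ls2 [cp2 [dp2 [p02 Mp2]]]]]]]]]].
assert (hdp : 0 <= d).
{ eapply Rle_trans; [apply Rabs_pos|]. apply (hd r0). lra. }
assert (hep : 0 <= eps) by (eapply Rle_trans; [apply Rabs_pos | apply hm1]).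
assert (hde : 0 <= delta).
{ eapply Rle_trans; [apply Rabs_pos|]. apply (b1 r0). lra. }
assert (bI1 : forall r, A <= r -> Rabs (I1 r) <= vp * / r ^ (2 * S k)).
{ apply (tail_bound A phi1); trivial. intros r hr. destruct (b1 r hr). lra. }
assert (bI2 : forall r, A <= r -> Rabs (I2 r) <= vp * / r ^ (2 * S k)).
{ apply (tail_bound A phi2); trivial. intros r hr. destruct (b2 r hr). lra. }
assert (bI : forall r, A <= r -> Rabs (I1 r - I2 r) <= d * / r ^ (2 * S k)).
{ apply (tail_diff A d phi1 I1 phi2 I2); trivial. intros r hr. now destruct (hd r hr). }
assert (hm12' : Rabs (m1 - m2) <= Lm * eps * d).
{ eapply Rle_trans; [apply hm12|]. fold Lm.
  replace (Lm * eps * d) with (Lm * d * eps) by ring.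
  apply Rmult_le_compat_l; trivial. apply Rmult_le_pos; lra. }
assert (D1 : forall r, A <= r -> pdom vp Wc (state_at phi1 psi1 I1 m1 r)).
{ intros r hr. destruct (b1 r hr) as [? [? _]]. apply state_at_dom; auto; lra. }
assert (D2 : forall r, A <= r -> pdom vp Wc (state_at phi2 psi2 I2 m2 r)).
{ intros r hr. destruct (b2 r hr) as [? [? _]]. apply state_at_dom; auto; lra. }
assert (dist12 : forall r, A <= r ->
  pdist (state_at phi1 psi1 I1 m1 r) (state_at phi2 psi2 I2 m2 r) <= L * d).
{ intros r hr. destruct (hd r hr) as [e1 e2]. generalize (bI r hr). intros e3.
  destruct (Wb_ge r) as [_ [w _]]; [lra|].
  assert (d * / r ^ (2 * S k) <= d * Wb) by now apply Rmult_le_compat_l.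
  assert (Lm * eps * d <= Lm * 1 * d).
  { apply Rmult_le_compat_r; trivial. apply Rmult_le_compat_l; lra. }
  unfold pdist, state_at. cbn [pa pb pphi ppsi pI pm].
  rewrite !Rminus_diag, Rabs_R0. unfold L. lra. }
assert (Q1 : forall r, A <= r ->
  Rabs (m1 * qz (state_at phi1 psi1 I1 m1 r) / kap - m2 * qz (state_at phi2 psi2 I2 m2 r) / kap)
    <= Cg * eps * d).
{ intros r hr.
  replace (m1 * qz (state_at phi1 psi1 I1 m1 r) / kap - m2 * qz (state_at phi2 psi2 I2 m2 r) / kap)
    with ((m1 * qz (state_at phi1 psi1 I1 m1 r) - m2 * qz (state_at phi2 psi2 I2 m2 r)) * / kap)
    by (unfold Rdiv; ring).
  replace (Cg * eps * d) with ((eps * (M * (L * d)) + M * (Lm * eps * d)) * / kap)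
    by (unfold Cg, Rdiv; ring).
  assert (0 < / kap) by now apply Rinv_0_lt_compat.
  apply Rabs_mult_le; [|rewrite Rabs_right; lra].
  apply Rabs_mult_minus_le; trivial.
  - eapply Rle_trans; [apply lM; auto|]. apply Rmult_le_compat_l; [lra|]. auto.
  - apply bM; auto. }
assert (S1 : forall r, A <= r -> Rabs (psi1' r - psi2' r) <= Cs * eps * d).
{ intros r hr.
  eapply Rle_trans.
  - apply (radial_heat_estimate k A r0 hk ltac:(lra) hAr (fun s => psi1' s - psi2' s)
      (fun s => m1 * qz (state_at phi1 psi1 I1 m1 s) / kap - m2 * qz (state_at phi2 psi2 I2 m2 s) / kap)
      (K1 - K2) (Cg * eps * d)); trivial.
    + intros s hs. apply (continuous_minus psi1' psi2'); auto.
    + intros s hs.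
      replace ((m1 * qz (state_at phi1 psi1 I1 m1 s) / kap -
        m2 * qz (state_at phi2 psi2 I2 m2 s) / kap - (K1 - K2)) / s ^ S k) with
       ((m1 * qz (state_at phi1 psi1 I1 m1 s) / kap - K1) / s ^ S k -
        (m2 * qz (state_at phi2 psi2 I2 m2 s) / kap - K2) / s ^ S k) by (unfold Rdiv; ring).
      apply (is_derive_minus psi1' psi2'); auto.
    + intros s hs. apply Q1. lra.
    + rewrite s01, s02. ring.
    + apply is_lim_ext with (fun r => psi1' r + - 1 * psi2' r); [intros; ring|].
      apply is_lim_plus0; trivial. now apply is_lim_scal0.
  - destruct (Wb_ge r) as [w _]; [lra|].
    replace (Cs * eps * d) with (2 * (Cg * eps * d) / INR k * Wb) by (unfold Cs, Rdiv; ring).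
    apply Rmult_le_compat_l; trivial.
    apply Rmult_le_pos; [|apply Rlt_le, Rinv_0_lt_compat; trivial].
    apply Rmult_le_pos; [lra|]. apply Rmult_le_pos; trivial. apply Rmult_le_pos; lra. }
set (e := delta + eps).
assert (he : 0 <= e) by (unfold e; lra).
assert (F1 : forall r, A <= r ->
  Rabs (fz (state_at phi1 psi1' I1 m1 r) - fz (state_at phi2 psi2' I2 m2 r)) <= Cf * e * d).
{ intros r hr. generalize (S1 r hr). intros hS.
  destruct (b1 r hr) as [u1 [_ [_ u2]]]. destruct (b2 r hr) as [u3 [_ [_ u4]]].
  destruct (hd r hr) as [u5 _].
  (* The bounds are taken at the old [psi], while [fz] is evaluated at the new one. This is
     legitimate because none of the three cofactors involves the [psi] coordinate. *)
  destruct (lM _ _ (D1 r hr) (D2 r hr)) as [_ [l1 [l2 l3]]].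
  destruct (bM _ (D2 r hr)) as [_ [n1 [n2 n3]]].
  generalize (Rmult_le_compat_l M _ _ (Rlt_le _ _ hM) (dist12 r hr)). intros dd.
  unfold state_at in *. unfold fz. cbn [pa pb pphi ppsi pI pm] in *.
  unfold Qz in *. cbn [pa pb pphi ppsi pI pm] in *.
  match type of l3 with Rabs (m1 * ?x - m2 * ?y) <= _ =>
    set (Q1' := m1 * x) in *; set (Q2' := m2 * y) in * end.
  set (i1 := / (vp + phi1 r)) in *. set (i2 := / (vp + phi2 r)) in *.
  replace (_ - _) with
    (Rg * (psi1' r * i1 - psi2' r * i2) + apl * (phi1 r * (phi1 r * i1) - phi2 r * (phi2 r * i2))
     + (m1 * Q1' - m2 * Q2')) by ring.
  apply Rle_trans with
    (Rg * (delta * (M * (L * d)) + M * (Cs * eps * d))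
     + apl * (delta * (M * (L * d)) + (delta * M) * d)
     + (eps * (M * (L * d)) + M * (Lm * eps * d))).
  - apply Rabs_plus_le; [apply Rabs_plus_le|].
    + apply Rabs_mult_le; [rewrite Rabs_right; lra|].
      apply Rabs_mult_minus_le; trivial; lra.
    + apply Rabs_mult_le; [rewrite Rabs_right; lra|].
      apply Rabs_mult_minus_le; trivial; [lra|]. now apply Rabs_mult_le.
    + apply Rabs_mult_minus_le; trivial; lra.
  - replace (Cf * e * d) with
     (Rg * (delta * (M * (L * d)) + M * (Cs * eps * d))
     + apl * (delta * (M * (L * d)) + (delta * M) * d)
     + (eps * (M * (L * d)) + M * (Lm * eps * d))
     + (Rg * (eps * (M * (L * d)) + M * Cs * (delta * d))
     + apl * (eps * (M * (L * d)) + (eps * M) * d)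
     + (delta * (M * (L * d)) + M * Lm * (delta * d)))) by (unfold Cf, e; ring).
    assert (q1 : 0 <= M * (L * d)) by (apply Rmult_le_pos; [|apply Rmult_le_pos]; lra).
    assert (q2 : 0 <= delta * d) by now apply Rmult_le_pos.
    assert (q3 : 0 <= eps * (M * (L * d))) by now apply Rmult_le_pos.
    assert (q4 : 0 <= delta * (M * (L * d))) by now apply Rmult_le_pos.
    assert (q5 : 0 <= M * Cs * (delta * d)) by (apply Rmult_le_pos; lra).
    assert (q6 : 0 <= M * Lm * (delta * d)) by (apply Rmult_le_pos; lra).
    assert (q7 : 0 <= eps * M * d) by (apply Rmult_le_pos; [apply Rmult_le_pos|]; lra).
    assert (q8 : 0 <= Rg * (eps * (M * (L * d)) + M * Cs * (delta * d))) by (apply Rmult_le_pos; lra).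
    assert (q9 : 0 <= apl * (eps * (M * (L * d)) + (eps * M) * d)) by (apply Rmult_le_pos; lra).
    lra. }
assert (F2 : forall r, A <= r -> Rabs (fz (state_at phi2 psi2' I2 m2 r)) <= Cv * e).
{ intros r hr. destruct (b2 r hr) as [u3 [_ [_ u4]]].
  destruct (bM _ (D2 r hr)) as [_ [n1 [n2 n3]]].
  unfold state_at in *. unfold fz. cbn [pa pb pphi ppsi pI pm] in *.
  unfold Qz in *. cbn [pa pb pphi ppsi pI pm] in *.
  apply Rle_trans with (Rg * (delta * M) + apl * (delta * M) + eps * M).
  - apply Rabs_plus_le; [apply Rabs_plus_le|].
    + apply Rabs_mult_le; [rewrite Rabs_right; lra|]. now apply Rabs_mult_le.
    + apply Rabs_mult_le; [rewrite Rabs_right; lra|]. now apply Rabs_mult_le.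
    + now apply Rabs_mult_le.
  - replace (Cv * e) with (Rg * (delta * M) + apl * (delta * M) + eps * M +
      (Rg * M * eps + apl * M * eps + M * delta)) by (unfold Cv, e; ring).
    assert (0 <= Rg * M * eps) by (apply Rmult_le_pos; lra).
    assert (0 <= apl * M * eps) by (apply Rmult_le_pos; lra).
    assert (0 <= M * delta) by (apply Rmult_le_pos; lra). lra. }
assert (hm20 : m2 <> 0) by lra. assert (hm10 : m1 <> 0) by lra.
assert (hratio : Rabs (1 - m1 / m2) <= Lm * d).
{ replace (1 - m1 / m2) with (- (m1 - m2) * / m2) by (field; trivial).
  rewrite Rabs_mult, Rabs_Ropp, Rabs_inv.
  assert (hp : 0 < Rabs m2) by now apply Rabs_pos_lt.
  apply (Rmult_le_reg_r (Rabs m2)); trivial.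
  rewrite Rmult_assoc, Rinv_l by lra. rewrite Rmult_1_r. exact hm12. }
intros r hr. split.
{ eapply Rle_trans; [now apply S1|].
  replace ((Cs + 5 * 2 ^ k * Ch) * eps * d) with (Cs * eps * d + 5 * 2 ^ k * Ch * (eps * d)) by ring.
  assert (0 <= 5 * 2 ^ k * Ch * (eps * d)) by (apply Rmult_le_pos; [lra | now apply Rmult_le_pos]).
  lra. }
(* The difference of the two relaxation equations, written with the rate of [m1] alone. Since rate
   times flux is the same for both, changing the rate of the second equation costs the extra forcing
   [(1 - m1 / m2) (fz / apl - phi2')], in which only the relative flux difference appears. *)
set (hh := fun s => (fz (state_at phi1 psi1' I1 m1 s) - fz (state_at phi2 psi2' I2 m2 s)) * / apl
  + (1 - m1 / m2) * (fz (state_at phi2 psi2' I2 m2 s) * / apl + - phi2' s)).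
assert (hia : 0 < / apl) by now apply Rinv_0_lt_compat.
eapply Rle_trans.
- apply (relaxation_estimate k A r0 (apl / (mu * m1)) ltac:(lra) hAr hh
    (fun s => phi1' s - phi2' s) (Ch * e * d) (2 * delta) 0); trivial.
  + lia.
  + intros s hs. apply (continuous_minus phi1' phi2'); auto.
  + intros s hs.
    replace (apl / (mu * m1) * s ^ S k * (hh s - (phi1' s - phi2' s))) with
      (apl / (mu * m1) * s ^ S k * (fz (state_at phi1 psi1' I1 m1 s) / apl - phi1' s) -
       apl / (mu * m2) * s ^ S k * (fz (state_at phi2 psi2' I2 m2 s) / apl - phi2' s)).
    * apply (is_derive_minus phi1' phi2'); auto.
    * unfold hh. field. repeat split; lra.
  + intros s hs. simpl pow. rewrite Rinv_1, Rmult_1_r. unfold hh.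
    apply Rle_trans with (Cf * e * d * / apl + Lm * d * (Cv * e * / apl + e)).
    * apply Rabs_plus_le.
      -- apply Rabs_mult_le; [apply F1; lra | rewrite Rabs_right; lra].
      -- apply Rabs_mult_le; trivial. apply Rabs_plus_le.
         ++ apply Rabs_mult_le; [apply F2; lra | rewrite Rabs_right; lra].
         ++ rewrite Rabs_Ropp. destruct (b2 s ltac:(lra)) as [_ [_ [u _]]]. unfold e. lra.
    * right. unfold Ch, Rdiv. ring.
  + apply Rmult_le_pos; trivial. apply Rmult_le_pos; lra.
  + intros _ s hs. destruct (b1 s hs) as [_ [_ [u1 _]]]. destruct (b2 s hs) as [_ [_ [u2 _]]].
    replace (2 * delta) with (delta + delta) by ring.
    apply Rabs_plus_le; trivial. now rewrite Rabs_Ropp.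
  + intros hb. assert (hm : 0 < m1).
    { destruct sg as [[sg _]|[sg _]]; trivial.
      assert (apl / (mu * m1) < 0); [|lra].
      apply Rmult_pos_neg; trivial. apply Rinv_lt_0_compat. nra. }
    assert (hm' : 0 < m2) by lra.
    rewrite (p01 hm), (p02 hm'), Rminus_diag, Rabs_R0.
    simpl pow. rewrite Rinv_1, Rmult_1_r.
    apply Rmult_le_pos; trivial. apply Rmult_le_pos; lra.
- simpl pow. rewrite Rinv_1, Rmult_1_r. fold e.
  replace ((Cs + 5 * 2 ^ k * Ch) * e * d) with (5 * 2 ^ k * (Ch * e * d) + Cs * e * d) by ring.
  assert (0 <= Cs * e * d) by (apply Rmult_le_pos; [apply Rmult_le_pos|]; lra).
  lra.
Qed.

(** Subtracting the harmonic function [psi0 (r0 / r)^k], which only shifts [K], reduces this to a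
    vanishing value at [r0], where [radial_heat_estimate] applies. *)
Lemma heat_bound (A m psi0 M K : R) (g psi' : R -> R) : 0 < A -> A <= r0 ->
  (forall r, A <= r -> continuous psi' r) ->
  (forall r, A < r -> is_derive psi' r ((m * g r / kap - K) / r ^ S k)) ->
  (forall r, A < r -> Rabs (g r) <= M) -> psi' r0 = psi0 -> is_lim psi' p_infty 0 ->
  forall r, A <= r ->
    Rabs (psi' r) <= (Rabs psi0 * r0 ^ k + 2 * (Rabs m * M / kap) / INR k) * / r ^ k.
Proof.
intros hA hAr cs ds hg s0 ls r hr.
assert (hkR : 0 < INR k) by (apply lt_0_INR; lia).
assert (hrk : 0 < / r ^ k) by (apply inv_pow_pos; lra).
assert (h1 : Rabs (psi' r + - (psi0 * r0 ^ k) * / r ^ k) <= 2 * (Rabs m * M / kap) / INR k * / r ^ k).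
{ apply (radial_heat_estimate k A r0 hk hA hAr
    (fun s => psi' s + - (psi0 * r0 ^ k) * / s ^ k) (fun s => m * g s / kap)
    (K - psi0 * r0 ^ k * INR k)); trivial.
  - intros s hs. apply (continuous_plus psi' (fun s => - (psi0 * r0 ^ k) * / s ^ k)); auto.
    apply (continuous_scal_r (- (psi0 * r0 ^ k)) (fun s => / s ^ k)). apply continuous_inv_pow. lra.
  - intros s hs. replace ((m * g s / kap - (K - psi0 * r0 ^ k * INR k)) / s ^ S k) with
      ((m * g s / kap - K) / s ^ S k + - (psi0 * r0 ^ k) * (- INR k / s ^ S k))
      by (unfold Rdiv; ring).
    apply (is_derive_plus psi' (fun s => - (psi0 * r0 ^ k) * / s ^ k)); auto.
    apply (is_derive_scal (fun s => / s ^ k)). apply is_derive_inv_pow. lra.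
  - intros s hs. assert (0 < / kap) by now apply Rinv_0_lt_compat.
    unfold Rdiv. apply Rabs_mult_le; [|rewrite Rabs_right; lra].
    apply Rabs_mult_le; auto. lra.
  - rewrite s0. field. apply pow_nonzero. lra.
  - apply is_lim_plus0; trivial. apply is_lim_scal0. now apply is_lim_inv_pow. }
replace (psi' r) with (psi0 * (r0 ^ k * / r ^ k) + (psi' r + - (psi0 * r0 ^ k) * / r ^ k)) by ring.
rewrite Rmult_plus_distr_r, Rmult_assoc. apply Rabs_plus_le; trivial.
assert (0 < r0 ^ k) by now apply pow_lt.
apply Rabs_mult_le; [lra|]. rewrite Rabs_right; [lra|]. apply Rle_ge, Rmult_le_pos; lra.
Qed.

Lemma ccont_inv_pow (A : R) (j : nat) : 0 < A -> ccont A (fun r => / r ^ j).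
Proof.
intros hA. apply ccont_of_continuous. intros r hr. apply continuous_inv_pow. lra.
Qed.

Lemma ccont_qz (A m : R) (phi psi I : R -> R) : 0 < A ->
  ccont A phi -> ccont A psi -> ccont A I -> ccont A (fun r => qz (state_at phi psi I m r)).
Proof.
intros hA h1 h2 h3. unfold qz, state_at. cbn [pa pb pphi ppsi pI pm].
assert (hv : ccont A (fun r => vp + phi r)) by (apply ccont_plus; [apply ccont_const | trivial]).
assert (c : forall x, ccont A (fun _ => x)) by apply ccont_const.
apply (ccont_plus A (fun r => cV * psi r + ppl * phi r)).
- apply (ccont_plus A (fun r => cV * psi r)); apply ccont_mult; auto.
- apply (ccont_mult A (fun _ => m)); auto. apply (ccont_mult A (fun r => vp + phi r)); trivial.
  apply (ccont_plus A (fun r => m * _)).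
  + apply (ccont_mult A (fun _ => m)); auto. apply (ccont_plus A (fun r => INR (S k) * I r)).
    * apply ccont_mult; auto.
    * apply (ccont_mult A (fun _ => - / 2)); auto.
      apply (ccont_mult A (fun r => / r ^ (2 * S k))); trivial. now apply ccont_inv_pow.
  + apply (ccont_mult A (fun _ => 2 * nu * INR (S k))); auto.
    apply (ccont_mult A (fun r => / r ^ S (S k))); trivial. now apply ccont_inv_pow.
Qed.

Lemma ccont_fz (A m : R) (phi psi I : R -> R) : 0 < A ->
  (forall r, A <= r -> Rabs (phi r) <= vp / 2) ->
  ccont A phi -> ccont A psi -> ccont A I -> ccont A (fun r => fz (state_at phi psi I m r)).
Proof.
intros hA hb h1 h2 h3. unfold fz, Qz, state_at. cbn [pa pb pphi ppsi pI pm].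
assert (hv : ccont A (fun r => vp + phi r)) by (apply ccont_plus; [apply ccont_const | trivial]).
assert (hi : ccont A (fun r => / (vp + phi r))).
{ apply ccont_inv; trivial. intros r hr. generalize (hb r hr). intros h.
  apply Rabs_le_between in h. lra. }
assert (c : forall x, ccont A (fun _ => x)) by apply ccont_const.
apply (ccont_plus A (fun r => Rg * (psi r * / (vp + phi r)) + apl * (phi r * (phi r * / (vp + phi r))))).
- apply (ccont_plus A (fun r => Rg * (psi r * / (vp + phi r)))).
  + apply (ccont_mult A (fun _ => Rg)); auto. apply (ccont_mult A psi); auto.
  + apply (ccont_mult A (fun _ => apl)); auto. apply (ccont_mult A phi); auto.
    apply (ccont_mult A phi); auto.
- apply (ccont_mult A (fun _ => m)); auto. apply (ccont_mult A (fun _ => m)); auto.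
  apply (ccont_plus A (fun r => / r ^ (2 * S k) * (vp + phi r))).
  + apply (ccont_mult A (fun r => / r ^ (2 * S k))); trivial. now apply ccont_inv_pow.
  + apply (ccont_mult A (fun _ => - INR (S k))); auto.
Qed.

Lemma tail_integral_exists (A : R) (phi : R -> R) : 0 < A -> ccont A phi ->
  (forall r, A <= r -> Rabs (phi r) <= vp / 2) ->
  exists I : R -> R,
    (forall r, A <= r -> is_derive I r (- ((vp + phi r) * / r ^ S (2 * S k)))) /\
    (forall r, A <= r -> Rabs (I r) <= vp * / r ^ (2 * S k)) /\ is_lim I p_infty 0.
Proof.
intros hA cphi hphi.
destruct (tail_exists (fun r => (vp + phi r) * / r ^ S (2 * S k)) (fun r => vp * / r ^ (2 * S k))
  (fun r => vp * (- INR (2 * S k) / r ^ S (2 * S k))) A) as [I [dI bI]].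
- apply ccont_mult; [|now apply ccont_inv_pow].
  apply ccont_plus; [apply ccont_const | trivial].
- intros r hr. apply (continuous_scal_r vp (fun s => / s ^ (2 * S k))).
  apply continuous_inv_pow. lra.
- intros r hr. apply (is_derive_scal (fun s => / s ^ (2 * S k))).
  apply is_derive_inv_pow. lra.
- intros r hr.
  assert (hp : 0 < / r ^ S (2 * S k)) by (apply inv_pow_pos; lra).
  replace (- (vp * (- INR (2 * S k) / r ^ S (2 * S k)))) with
    (vp * INR (2 * S k) * / r ^ S (2 * S k)) by (unfold Rdiv; ring).
  apply Rabs_mult_le; [|rewrite Rabs_right; lra].
  generalize (hphi r (Rlt_le _ _ hr)). intros h1. apply Rabs_le_between in h1.
  rewrite Rabs_right by lra. nra.
- intros r hr. apply Rmult_le_pos; [lra|]. apply Rlt_le, inv_pow_pos. lra.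
- exists I. split; [|split]; trivial.
  + intros r hr. generalize (dI r). rewrite Rmax_right by lra. trivial.
  + apply (is_lim_dominated _ (fun r => vp * / r ^ (2 * S k)) A); trivial.
    apply is_lim_scal0, is_lim_inv_pow. lia.
Qed.

Lemma step_exists (A m phi0 psi0 : R) (phi psi : R -> R) :
  r0 / 2 <= A <= r0 -> m <> 0 -> Rabs m <= 1 -> ccont A phi -> ccont A psi ->
  (forall r, A <= r -> Rabs (phi r) <= vp / 2 /\ Rabs (psi r) <= 1) ->
  exists phi' psi' I, step A m phi0 psi0 phi psi phi' psi' I.
Proof.
intros [hA hAr] hm0 hm cphi cpsi hb.
destruct rhs_bounds as [M [hM [bM _]]]. assert (hap := apl_pos).
assert (hA0 : 0 < A) by lra.
assert (hphi : forall r, A <= r -> Rabs (phi r) <= vp / 2) by (intros; now apply hb).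
destruct (tail_integral_exists A phi hA0 cphi hphi) as [I [dI [bI lI]]].
assert (cI : forall r, A <= r -> continuous I r).
{ intros r hr. apply (ex_derive_continuous I). eexists. now apply dI. }
assert (D : forall r, A <= r -> pdom vp Wc (state_at phi psi I m r)).
{ intros r hr. destruct (hb r hr). apply state_at_dom; auto; lra. }
destruct (radial_heat_exists k A r0 hk hA0 hAr (fun r => m * qz (state_at phi psi I m r) * / kap)
  (Rabs m * M * / kap) psi0) as [psi' [K [ds [s0 ls]]]].
{ apply ccont_mult; [|apply ccont_const]. apply ccont_mult; [apply ccont_const|].
  apply ccont_qz; trivial. now apply ccont_of_continuous. }
{ intros r hr. assert (0 < / kap) by now apply Rinv_0_lt_compat.
  apply Rabs_mult_le; [|rewrite Rabs_right; lra].
  apply Rabs_mult_le; [lra|]. apply bM; auto. }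
assert (cs : forall r, A <= r -> continuous psi' r).
{ intros r hr. apply (ex_derive_continuous psi'). eexists. now apply ds. }
assert (bs := heat_bound A m psi0 M K (fun r => qz (state_at phi psi I m r)) psi' hA0 hAr cs
  (fun r hr => ds r (Rlt_le _ _ hr)) (fun r hr => proj1 (bM _ (D r (Rlt_le _ _ hr)))) s0 ls).
set (c := Rabs psi0 * r0 ^ k + 2 * (Rabs m * M / kap) / INR k) in *.
assert (hia : 0 < / apl) by now apply Rinv_0_lt_compat.
destruct (relaxation_exists k A r0 (apl / (mu * m)) hA0
  (fun r => fz (state_at phi psi' I m r) * / apl)
  ((Rg * (c * / A ^ k * M) + apl * (vp / 2 * M) + 1 * M) * / apl) phi0)
  as [phi' [dp [p0 bp]]].
{ apply Rmult_integral_contrapositive_currified; [lra|].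
  apply Rinv_neq_0_compat. apply Rmult_integral_contrapositive_currified; lra. }
{ apply ccont_mult; [|apply ccont_const]. apply ccont_fz; trivial; now apply ccont_of_continuous. }
{ intros r hr. apply Rabs_mult_le; [|rewrite Rabs_right; lra].
  destruct (bM _ (D r hr)) as [_ [n1 [n2 n3]]].
  unfold state_at in *. unfold fz. cbn [pa pb pphi ppsi pI pm] in *.
  unfold Qz in *. cbn [pa pb pphi ppsi pI pm] in *.
  apply Rabs_plus_le; [apply Rabs_plus_le|].
  - apply Rabs_mult_le; [rewrite Rabs_right; lra|]. apply Rabs_mult_le; trivial.
    eapply Rle_trans; [now apply bs|]. apply Rmult_le_compat_l.
    + assert (hkR : 0 < INR k) by (apply lt_0_INR; lia).
      assert (0 < r0 ^ k) by now apply pow_lt.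
      generalize (Rabs_pos psi0) (Rabs_pos m). intros q1 q2.
      assert (0 <= Rabs psi0 * r0 ^ k) by (apply Rmult_le_pos; lra).
      assert (0 <= 2 * (Rabs m * M / kap) / INR k); [|unfold c; lra].
      apply Rle_mult_inv_pos; trivial. apply Rmult_le_pos; [lra|].
      apply Rle_mult_inv_pos; trivial. apply Rmult_le_pos; lra.
    + now apply inv_pow_antitone.
  - apply Rabs_mult_le; [rewrite Rabs_right; lra|]. apply Rabs_mult_le; auto.
  - apply Rabs_mult_le; auto. }
exists phi', psi', I. repeat apply conj; trivial.
- intros r hr. apply dI. lra.
- exists K. intros r hr. apply ds. lra.
- intros r hr. apply (ex_derive_continuous phi'). eexists. now apply dp.
- intros r hr. apply dp. lra.
- intros hm'. apply p0. apply Rdiv_lt_0_compat; nra.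
- intros hm'. eexists. apply bp.
  apply Rmult_pos_neg; trivial. apply Rinv_lt_0_compat. nra.
Qed.

(** This makes a weighted ball of radius [eta] of order [eps] invariant: the data, the flux and the
    new [psi'] are of order [eps], and the only contribution of the old [phi] of lower order in
    [eps] is its square, whence [eta ^ 2]. *)
Lemma step_decay : exists C, 0 < C /\
  forall (A m phi0 psi0 eps eta : R) (phi psi phi' psi' I : R -> R),
  r0 / 2 <= A <= r0 -> relaxation_adm k A r0 (apl / (mu * m)) -> m <> 0 ->
  Rabs m <= eps -> eps <= 1 -> Rabs phi0 <= eps -> Rabs psi0 <= eps ->
  0 <= eta -> eta * Wb <= vp / 2 -> eta * Wb <= 1 ->
  (forall r, A <= r -> Rabs (phi r) <= eta * / r ^ k /\ Rabs (psi r) <= eta * / r ^ k) ->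
  step A m phi0 psi0 phi psi phi' psi' I ->
  forall r, A <= r -> Rabs (psi' r) <= C * eps * / r ^ k /\
    Rabs (phi' r) <= C * (eps + eta ^ 2) * / r ^ k.
Proof.
destruct rhs_bounds as [M [hM [bM _]]].
assert (hap := apl_pos). assert (hW1 := Wb_ge1).
assert (hkR : 0 < INR k) by (apply lt_0_INR; lia).
assert (hr0k : 0 < r0 ^ k) by now apply pow_lt.
set (Cs := r0 ^ k + 2 * (M / kap) / INR k).
assert (hCs : 0 < Cs).
{ unfold Cs. assert (0 < 2 * (M / kap) / INR k); [|lra].
  apply Rdiv_lt_0_compat; trivial. assert (0 < M / kap) by now apply Rdiv_lt_0_compat. lra. }
assert (hN : 0 < INR (S k)) by (apply lt_0_INR; lia).
set (CQ := (2 + INR (S k)) * vp * Wb).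
assert (hCQ : 0 < CQ) by (repeat apply Rmult_lt_0_compat; lra).
(* The summand [r0 ^ k] makes room for the inflow value: [phi0] is bounded by [eps], which has to be
   of the form constant times [/ r0 ^ k]. *)
set (Ch := (Rg * (Cs * M) + apl * (Wb * M) + CQ) / apl + r0 ^ k).
assert (hC1 : 0 < Rg * (Cs * M)) by (repeat apply Rmult_lt_0_compat; lra).
assert (hC2 : 0 < apl * (Wb * M)) by (apply Rmult_lt_0_compat; [|apply Rmult_lt_0_compat]; lra).
assert (hCh : 0 < Ch).
{ unfold Ch. assert (0 < (Rg * (Cs * M) + apl * (Wb * M) + CQ) / apl); [|lra].
  apply Rdiv_lt_0_compat; lra. }
assert (h2k : 0 < 5 * 2 ^ k) by (assert (0 < 2 ^ k) by (apply pow_lt; lra); lra).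
assert (hC3 : 0 < 5 * 2 ^ k * Ch) by now apply Rmult_lt_0_compat.
exists (Cs + 5 * 2 ^ k * Ch). split; [lra|].
intros A m phi0 psi0 eps eta phi psi phi' psi' I [hA hAr] adm hm0 hm heps hphi0 hpsi0
  heta heta1 heta2 hb [cI [dI [lI [cs [[K ds] [s0 [ls [cp [dp [p0 Mp]]]]]]]]]].
assert (hep : 0 <= eps) by (eapply Rle_trans; [apply Rabs_pos | apply hm]).
assert (hb' : forall r, A <= r -> Rabs (phi r) <= eta * Wb /\ Rabs (psi r) <= eta * Wb).
{ intros r hr. destruct (hb r hr). destruct (Wb_ge r) as [w _]; [lra|].
  assert (eta * / r ^ k <= eta * Wb) by now apply Rmult_le_compat_l. split; lra. }
assert (bI : forall r, A <= r -> Rabs (I r) <= vp * / r ^ (2 * S k)).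
{ apply (tail_bound A phi); trivial. intros r hr. destruct (hb' r hr). lra. }
assert (D : forall r, A <= r -> pdom vp Wc (state_at phi psi I m r)).
{ intros r hr. destruct (hb' r hr). apply state_at_dom; auto; lra. }
assert (S1 : forall r, A <= r -> Rabs (psi' r) <= Cs * eps * / r ^ k).
{ intros r hr. eapply Rle_trans.
  - apply (heat_bound A m psi0 M K (fun r => qz (state_at phi psi I m r)) psi' ltac:(lra) hAr cs ds
      (fun r hr => proj1 (bM _ (D r (Rlt_le _ _ hr)))) s0 ls); trivial.
  - apply Rmult_le_compat_r; [apply Rlt_le, inv_pow_pos; lra|].
    replace (Cs * eps) with (eps * r0 ^ k + 2 * (eps * M / kap) / INR k) by (unfold Cs, Rdiv; ring).
    apply Rplus_le_compat; [apply Rmult_le_compat_r; lra|].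
    apply Rmult_le_compat_r; [now apply Rlt_le, Rinv_0_lt_compat|].
    apply Rmult_le_compat_l; [lra|].
    apply Rmult_le_compat_r; [now apply Rlt_le, Rinv_0_lt_compat|].
    apply Rmult_le_compat_r; lra. }
set (e := eps + eta ^ 2).
assert (heta3 : 0 <= eta ^ 2) by apply pow2_ge_0.
assert (he : 0 <= e) by (unfold e; lra).
intros r hr. assert (hw : 0 < / r ^ k) by (apply inv_pow_pos; lra). split.
{ eapply Rle_trans; [now apply S1|]. apply Rmult_le_compat_r; [lra|].
  apply Rmult_le_compat_r; lra. }
assert (hia : 0 < / apl) by now apply Rinv_0_lt_compat.
assert (hMb : exists Mb, m < 0 -> forall r, A <= r -> Rabs (phi' r) <= Mb).
{ destruct (Rlt_le_dec m 0) as [hneg|hpos].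
  - destruct (Mp hneg) as [Mb hMb]. now exists Mb.
  - exists 0. lra. }
destruct hMb as [Mb hMb].
assert (hsign : forall x, x <> 0 -> 0 < apl / (mu * x) -> 0 < x).
{ intros x hx h. apply Rnot_le_lt. intros hx'.
  assert (apl / (mu * x) < 0); [|lra].
  apply Rmult_pos_neg; trivial. apply Rinv_lt_0_compat. nra. }
assert (hsign' : forall x, x <> 0 -> apl / (mu * x) < 0 -> x < 0).
{ intros x hx h. apply Rnot_le_lt. intros hx'.
  assert (0 < apl / (mu * x)); [|lra].
  apply Rdiv_lt_0_compat; trivial. nra. }
eapply Rle_trans.
- apply (relaxation_estimate k A r0 (apl / (mu * m)) ltac:(lra) hAr
    (fun s => fz (state_at phi psi' I m s) / apl) phi' (Ch * e) Mb k); trivial.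
  + intros s hs. destruct (hb s (Rlt_le _ _ hs)) as [u1 _].
    destruct (hb' s (Rlt_le _ _ hs)) as [u2 _].
    destruct (bM _ (D s (Rlt_le _ _ hs))) as [_ [n1 _]].
    generalize (S1 s (Rlt_le _ _ hs)) (bI s (Rlt_le _ _ hs)). intros u3 u4.
    destruct (Wb_ge s) as [w1 [_ w3]]; [lra|].
    assert (hw' : 0 < / s ^ k) by (apply inv_pow_pos; lra).
    assert (hws : 0 < / s ^ S (S k)) by (apply inv_pow_pos; lra).
    (* [2 N = (N + 1) + k]: the weight [/ s^k] is split off from [m^2 Q], and the rest is bounded by
       [Wb]. *)
    assert (hwa : / s ^ (2 * S k) = / s ^ S (S k) * / s ^ k).
    { rewrite <- Rinv_mult, <- pow_add. do 2 f_equal. lia. }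
    assert (hQ : Rabs (Qz (state_at phi psi' I m s)) <= CQ * / s ^ k).
    { unfold Qz, state_at. cbn [pa pb pphi ppsi pI pm]. rewrite hwa in *.
      assert (hww : / s ^ S (S k) * / s ^ k <= Wb * / s ^ k) by (apply Rmult_le_compat_r; lra).
      apply Rle_trans with (Wb * / s ^ k * (2 * vp) + INR (S k) * (vp * (Wb * / s ^ k))).
      - apply Rabs_plus_le.
        + apply Rabs_mult_le.
          * rewrite Rabs_right; trivial. apply Rle_ge, Rmult_le_pos; lra.
          * apply Rle_trans with (vp + vp / 2); [|lra]. apply Rabs_plus_le; [rewrite Rabs_right|]; lra.
        + apply Rabs_mult_le.
          * rewrite Rabs_Ropp, Rabs_right; lra.
          * eapply Rle_trans; [apply u4|]. apply Rmult_le_compat_l; lra.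
      - right. unfold CQ. ring. }
    unfold Rdiv. apply Rle_trans with ((Rg * (Cs * M) + apl * (Wb * M) + CQ) * e * / s ^ k * / apl).
    * apply Rabs_mult_le; [|rewrite Rabs_right; lra].
      unfold state_at in *. unfold fz. cbn [pa pb pphi ppsi pI pm] in *.
      apply Rle_trans with (Rg * (Cs * eps * / s ^ k * M) +
        apl * (eta * / s ^ k * (eta * Wb * M)) + eps * (1 * (CQ * / s ^ k))).
      -- apply Rabs_plus_le; [apply Rabs_plus_le|].
         ++ apply Rabs_mult_le; [rewrite Rabs_right; lra|]. now apply Rabs_mult_le.
         ++ apply Rabs_mult_le; [rewrite Rabs_right; lra|]. apply Rabs_mult_le; trivial.
            now apply Rabs_mult_le.
         ++ apply Rabs_mult_le; trivial. apply Rabs_mult_le; trivial. lra.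
      -- replace ((Rg * (Cs * M) + apl * (Wb * M) + CQ) * e * / s ^ k) with
           (Rg * (Cs * eps * / s ^ k * M) + apl * (eta * / s ^ k * (eta * Wb * M)) +
            eps * (1 * (CQ * / s ^ k)) +
            (Rg * (Cs * M) * (eta ^ 2 * / s ^ k) + apl * (Wb * M) * (eps * / s ^ k) +
             CQ * (eta ^ 2 * / s ^ k))) by (unfold e; ring).
         assert (0 <= eta ^ 2 * / s ^ k) by (apply Rmult_le_pos; lra).
         assert (0 <= eps * / s ^ k) by (apply Rmult_le_pos; lra).
         assert (0 <= Rg * (Cs * M) * (eta ^ 2 * / s ^ k)) by (apply Rmult_le_pos; lra).
         assert (0 <= apl * (Wb * M) * (eps * / s ^ k)) by (apply Rmult_le_pos; lra).
         assert (0 <= CQ * (eta ^ 2 * / s ^ k)) by (apply Rmult_le_pos; lra).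
         lra.
    * replace (Ch * e * / s ^ k) with
        ((Rg * (Cs * M) + apl * (Wb * M) + CQ) * e * / s ^ k * / apl + r0 ^ k * (e * / s ^ k))
        by (unfold Ch, Rdiv; ring).
      assert (0 <= e * / s ^ k) by (apply Rmult_le_pos; lra).
      assert (0 <= r0 ^ k * (e * / s ^ k)) by (apply Rmult_le_pos; lra).
      lra.
  + apply Rmult_le_pos; lra.
  + intros hneg. apply hMb. now apply hsign'.
  + intros hpos. rewrite (p0 (hsign m hm0 hpos)).
    assert (0 < / r0 ^ k) by (apply inv_pow_pos; lra).
    replace (Ch * e * / r0 ^ k) with
      (eps + (eta ^ 2 + (Rg * (Cs * M) + apl * (Wb * M) + CQ) * / apl * (e * / r0 ^ k)))
      by (unfold Ch, Rdiv, e; field; split; lra).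
    assert (0 <= (Rg * (Cs * M) + apl * (Wb * M) + CQ) * / apl * (e * / r0 ^ k)).
    { apply Rmult_le_pos; apply Rmult_le_pos; lra. }
    lra.
- apply Rmult_le_compat_r; [lra|]. fold e. rewrite <- Rmult_assoc.
  apply Rmult_le_compat_r; lra.
Qed.

(* The mass flux [m = mm (phi r0)] is prescribed for inflow and depends on the unknown density at
   [r0] for outflow. *)
Definition flux_ok (mm : R -> R) (eps : R) :=
  ((exists m, 0 < m /\ forall x, mm x = m) \/ (forall x, Rabs x <= vp / 2 -> mm x < 0)) /\
  (forall x, Rabs x <= vp / 2 -> Rabs (mm x) <= eps) /\
  (forall x y, Rabs x <= vp / 2 -> Rabs y <= vp / 2 ->
     Rabs (mm x - mm y) <= 2 / vp * Rabs (x - y) * Rabs (mm y)).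

Lemma flux_ok_sign (mm : R -> R) (eps x y : R) : flux_ok mm eps ->
  Rabs x <= vp / 2 -> Rabs y <= vp / 2 ->
  0 < mm x /\ 0 < mm y \/ mm x < 0 /\ mm y < 0.
Proof.
intros [[[m [hm h]]|h] _] hx hy; [left; rewrite !h | right]; auto.
Qed.

(** The flux for which [2 k = b r0^(k+2)] with [b = apl / (mu m)]; smaller positive fluxes relax
    fast enough to follow a target decaying like [r^(-k)]. *)
Definition stiff_eps := apl * r0 ^ S (S k) / (2 * INR k * mu).

Lemma stiff_eps_pos : 0 < stiff_eps.
Proof.
assert (hkR : 0 < INR k) by (apply lt_0_INR; lia).
apply Rdiv_lt_0_compat.
- apply Rmult_lt_0_compat; [apply apl_pos | now apply pow_lt].
- repeat apply Rmult_lt_0_compat; lra.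
Qed.

Lemma stiff_adm (m : R) : 0 < m -> m <= stiff_eps ->
  2 * INR k <= apl / (mu * m) * r0 ^ S (S k).
Proof.
intros hm h. assert (hap := apl_pos).
assert (hkR : 0 < INR k) by (apply lt_0_INR; lia).
assert (hmm : 0 < mu * m) by now apply Rmult_lt_0_compat.
apply (Rmult_le_reg_r (mu * m)); trivial.
replace (apl / (mu * m) * r0 ^ S (S k) * (mu * m)) with (stiff_eps * (2 * INR k * mu))
  by (unfold stiff_eps; field; lra).
replace (2 * INR k * (mu * m)) with (m * (2 * INR k * mu)) by ring.
apply Rmult_le_compat_r; trivial. apply Rmult_le_pos; lra.
Qed.

(** For uniqueness, where the given solutions are compared on [[r0, oo)] only, so that no
    continuation to the left is involved. *)
Lemma adm_at_r0 (m : R) : m <> 0 -> Rabs m <= stiff_eps ->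
  relaxation_adm k r0 r0 (apl / (mu * m)).
Proof.
intros hm0 hm. assert (hap := apl_pos).
destruct (Rlt_le_dec m 0) as [hn|hp].
- left. apply Rmult_pos_neg; trivial. apply Rinv_lt_0_compat. nra.
- assert (hp' : 0 < m) by lra. right. split; [|split].
  + apply Rdiv_lt_0_compat; nra.
  + apply stiff_adm; trivial. rewrite Rabs_right in hm; lra.
  + rewrite Rminus_diag, Rmult_0_r. rewrite <- ln_1. apply ln_le; lra.
Qed.

(** For inflow the exponent vanishes at [A = r0], so by continuity it stays below [ln 2] slightly to
    the left. For outflow any [A] is admissible and [r0 / 2] is taken. *)
Lemma adm_left (mm : R -> R) (eps : R) : flux_ok mm eps -> eps <= stiff_eps ->
  exists A, r0 / 2 <= A < r0 /\
    forall x, Rabs x <= vp / 2 -> relaxation_adm k A r0 (apl / (mu * mm x)).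
Proof.
intros [[[m [hm h]]|h] [h1 _]] heps; assert (hap := apl_pos).
- set (b := apl / (mu * m)). assert (hb : 0 < b) by (apply Rdiv_lt_0_compat; nra).
  set (g := fun A => b * (r0 ^ S (S k) / INR (S (S k)) - A ^ S (S k) / INR (S (S k)))).
  assert (hg : continuous g r0).
  { apply (ex_derive_continuous g). unfold g. unfold Rdiv. auto_derive; trivial. }
  assert (hg0 : g r0 < ln 2).
  { unfold g. rewrite Rminus_diag, Rmult_0_r, <- ln_1. apply ln_increasing; lra. }
  assert (hl : locally r0 (fun A => g A < ln 2)).
  { apply (hg (fun y => y < ln 2)). now apply open_lt. }
  destruct hl as [e he].
  exists (Rmax (r0 / 2) (r0 - e / 2)).
  assert (hepos := cond_pos e).
  assert (hmax : r0 / 2 <= Rmax (r0 / 2) (r0 - e / 2) < r0).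
  { split; [apply Rmax_l|]. apply Rmax_lub_lt; lra. }
  split; trivial. intros x hx. rewrite h. right. fold b. split; [trivial | split].
  + apply stiff_adm; trivial. generalize (h1 x hx). rewrite h, Rabs_right; lra.
  + left. apply he. change (Rabs (Rmax (r0 / 2) (r0 - e / 2) - r0) < e).
    rewrite Rabs_left by lra. generalize (Rmax_r (r0 / 2) (r0 - e / 2)). lra.
- exists (r0 / 2). split; [lra|]. intros x hx. left.
  apply Rmult_pos_neg; trivial. apply Rinv_lt_0_compat. generalize (h x hx). nra.
Qed.

Lemma step_ext (A m phi0 psi0 : R) (phi psi chi xi phi' psi' I : R -> R) :
  (forall r, A <= r -> phi r = chi r /\ psi r = xi r) ->
  step A m phi0 psi0 phi psi phi' psi' I -> step A m phi0 psi0 chi xi phi' psi' I.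
Proof.
intros h [cI [dI [lI [cs [[K ds] [s0 [ls [cp [dp [p0 Mp]]]]]]]]]].
repeat apply conj; trivial.
- intros r hr. destruct (h r (Rlt_le _ _ hr)) as [<- _]. now apply dI.
- exists K. intros r hr. replace (state_at chi xi I m r) with (state_at phi psi I m r).
  + now apply ds.
  + unfold state_at. destruct (h r (Rlt_le _ _ hr)) as [-> ->]. reflexivity.
- intros r hr. replace (state_at chi psi' I m r) with (state_at phi psi' I m r).
  + now apply dp.
  + unfold state_at. destruct (h r (Rlt_le _ _ hr)) as [-> _]. reflexivity.
Qed.

(** Two fixed points are related by a step to themselves, so any common bound on their differences
    may be halved. Starting from [2 * delta], the differences are below every [2 * delta / 2^j]. The
    two fluxes need not be known to agree beforehand. *)
Lemma reduced_unique : exists delta eps1, 0 < delta /\ 0 < eps1 /\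
  forall (eps : R) (mm : R -> R) (phi0 psi0 : R) (phi1 psi1 I1 phi2 psi2 I2 : R -> R),
  eps <= eps1 -> flux_ok mm eps ->
  step r0 (mm (phi1 r0)) phi0 psi0 phi1 psi1 phi1 psi1 I1 ->
  step r0 (mm (phi2 r0)) phi0 psi0 phi2 psi2 phi2 psi2 I2 ->
  (forall r, r0 <= r -> Rabs (phi1 r) <= delta /\ Rabs (psi1 r) <= delta) ->
  (forall r, r0 <= r -> Rabs (phi2 r) <= delta /\ Rabs (psi2 r) <= delta) ->
  forall r, r0 <= r -> phi1 r = phi2 r /\ psi1 r = psi2 r.
Proof.
destruct step_contraction as [C [hC hstep]].
assert (hst := stiff_eps_pos).
assert (hC4 : 0 < / (4 * C)) by (apply Rinv_0_lt_compat; lra).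
assert (hC4' : C * / (4 * C) = / 4) by (field; lra).
(* [/ (4 * C)] in both places makes the contraction factor [C * (delta + eps)] at most [/ 2]. *)
exists (Rmin (/ (4 * C)) (Rmin (vp / 2) 1)), (Rmin (/ (4 * C)) (Rmin stiff_eps 1)).
set (delta := Rmin (/ (4 * C)) (Rmin (vp / 2) 1)).
set (eps1 := Rmin (/ (4 * C)) (Rmin stiff_eps 1)).
assert (d1 : delta <= / (4 * C)) by apply Rmin_l.
assert (d2 : delta <= vp / 2) by (eapply Rle_trans; [apply Rmin_r | apply Rmin_l]).
assert (d3 : delta <= 1) by (eapply Rle_trans; [apply Rmin_r | apply Rmin_r]).
assert (e1 : eps1 <= / (4 * C)) by apply Rmin_l.
assert (e2 : eps1 <= stiff_eps) by (eapply Rle_trans; [apply Rmin_r | apply Rmin_l]).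
assert (e3 : eps1 <= 1) by (eapply Rle_trans; [apply Rmin_r | apply Rmin_r]).
split; [repeat apply Rmin_glb_lt; lra|]. split; [repeat apply Rmin_glb_lt; lra|].
intros eps mm phi0 psi0 phi1 psi1 I1 phi2 psi2 I2 heps hf st1 st2 b1 b2.
destruct (b1 r0 ltac:(lra)) as [x1 _]. destruct (b2 r0 ltac:(lra)) as [x2 _].
assert (hsg := flux_ok_sign mm eps (phi1 r0) (phi2 r0) hf ltac:(lra) ltac:(lra)).
destruct hf as [_ [hf1 hf2]].
assert (he0 : 0 <= eps) by (eapply Rle_trans; [apply Rabs_pos | apply (hf1 (phi1 r0)); lra]).
assert (hd0 : 0 <= delta) by (eapply Rle_trans; [apply Rabs_pos | apply x1]).
assert (key : forall j r, r0 <= r -> Rabs (phi1 r - phi2 r) <= 2 * delta * (/ 2) ^ j /\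
  Rabs (psi1 r - psi2 r) <= 2 * delta * (/ 2) ^ j).
{ induction j as [|j IH]; intros r hr.
  - rewrite Rmult_1_r. replace (2 * delta) with (delta + delta) by ring.
    destruct (b1 r hr) as [u1 u2]. destruct (b2 r hr) as [u3 u4].
    split; apply Rabs_plus_le; trivial; rewrite Rabs_Ropp; trivial.
  - set (d := 2 * delta * (/ 2) ^ j) in *.
    assert (hd : 0 <= d) by (apply Rmult_le_pos; [lra | apply pow_le; lra]).
    replace (2 * delta * (/ 2) ^ S j) with (/ 2 * d) by (unfold d; simpl; ring).
    destruct (hstep r0 (mm (phi1 r0)) (mm (phi2 r0)) phi0 psi0 delta eps d
      phi1 psi1 phi1 psi1 I1 phi2 psi2 phi2 psi2 I2) with (r := r) as [v1 v2]; trivial; try lra.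
    + apply adm_at_r0; [lra|]. eapply Rle_trans; [apply hf1|]; lra.
    + apply hf1; lra.
    + apply hf1; lra.
    + eapply Rle_trans; [apply hf2; lra|]. apply Rmult_le_compat_r; [apply Rabs_pos|].
      apply Rmult_le_compat_l; [apply Rlt_le, Rdiv_lt_0_compat; lra|].
      apply IH. lra.
    + intros s hs. destruct (b1 s hs). tauto.
    + intros s hs. destruct (b2 s hs). tauto.
    + assert (q1 : C * delta <= / 4) by (rewrite <- hC4'; apply Rmult_le_compat_l; lra).
      assert (q2 : C * eps <= / 4) by (rewrite <- hC4'; apply Rmult_le_compat_l; lra).
      split; (eapply Rle_trans; [eassumption|]; apply Rmult_le_compat_r; lra). }
assert (lim0 : forall x, (forall j, Rabs x <= 2 * delta * (/ 2) ^ j) -> x = 0).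
{ intros x hx. assert (hc : is_lim_seq (fun j => 2 * delta * (/ 2) ^ j) 0).
  { replace (Finite 0) with (Rbar_mult (2 * delta) 0) by (simpl; f_equal; ring).
    apply is_lim_seq_scal_l, is_lim_seq_geom. rewrite Rabs_right; lra. }
  generalize (is_lim_seq_le _ _ _ _ hx (is_lim_seq_const _) hc). simpl. intros h.
  destruct (Req_dec x 0) as [|hn]; trivial. apply Rabs_pos_lt in hn. lra. }
intros r hr. split; apply Rminus_diag_uniq, lim0; intros j; now apply key.
Qed.

Lemma reduced_exists : exists eps1 C, 0 < eps1 /\ 0 < C /\
  forall (eps : R) (mm : R -> R) (phi0 psi0 : R),
  0 < eps <= eps1 -> flux_ok mm eps -> Rabs phi0 <= eps -> Rabs psi0 <= eps ->
  exists A phi psi I, 0 < A < r0 /\ step A (mm (phi r0)) phi0 psi0 phi psi phi psi I /\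
    forall r, A <= r -> Rabs (phi r) <= C * eps * / r ^ k /\ Rabs (psi r) <= C * eps * / r ^ k /\
      Rabs (phi r) <= vp / 2.
Proof.
destruct step_contraction as [C1 [hC1 hstep]].
destruct step_decay as [C2 [hC2 hdec]].
assert (hst := stiff_eps_pos). assert (hW1 := Wb_ge1).
(* The ball has radius [K * eps]. It is invariant when [C2 * (eps + (K * eps)^2) <= K * eps], which
   for [K = 2 * C2] amounts to [eps * K^2 <= 1]. *)
set (K := 2 * C2). assert (hK : 0 < K) by (unfold K; lra).
(* Each summand is a number [x] for which [eps * x <= 1] is needed below. *)
set (big := 1 + K * Wb * (2 / vp) + K * Wb + K ^ 2 + 2 * C1 * (K * Wb + 1) + / stiff_eps).
assert (hist : 0 < / stiff_eps) by now apply Rinv_0_lt_compat.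
assert (h2v : 0 < 2 / vp) by (apply Rdiv_lt_0_compat; lra).
assert (hKW : 0 < K * Wb) by (apply Rmult_lt_0_compat; lra).
assert (hKv : 0 < K * Wb * (2 / vp)) by (apply Rmult_lt_0_compat; lra).
assert (hK2 : 0 < K ^ 2) by now apply pow_lt.
assert (hCK : 0 < 2 * C1 * (K * Wb + 1)) by (apply Rmult_lt_0_compat; lra).
assert (hbig : 0 < big) by (unfold big; lra).
exists (/ big), K. split; [now apply Rinv_0_lt_compat|]. split; trivial.
intros eps mm phi0 psi0 [he0 he] hf hphi0 hpsi0.
assert (heb : eps * big <= 1).
{ replace 1 with (/ big * big) by (field; lra). apply Rmult_le_compat_r; lra. }
assert (small : forall x, 0 <= x -> x <= big -> eps * x <= 1).
{ intros x hx hxb. apply Rle_trans with (eps * big); trivial. apply Rmult_le_compat_l; lra. }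
assert (e1 : eps <= 1) by (rewrite <- (Rmult_1_r eps); apply small; unfold big; lra).
assert (e2 : K * eps * Wb <= vp / 2).
{ apply (Rmult_le_reg_r (2 / vp)); trivial. replace (vp / 2 * (2 / vp)) with 1 by (field; lra).
  replace (K * eps * Wb * (2 / vp)) with (eps * (K * Wb * (2 / vp))) by ring.
  apply small; unfold big; lra. }
assert (e3 : K * eps * Wb <= 1).
{ replace (K * eps * Wb) with (eps * (K * Wb)) by ring. apply small; unfold big; lra. }
assert (e4 : eps * K ^ 2 <= 1) by (apply small; unfold big; lra).
assert (e5 : C1 * (K * eps * Wb + eps) <= / 2).
{ replace (C1 * (K * eps * Wb + eps)) with (/ 2 * (eps * (2 * C1 * (K * Wb + 1)))) by field.
  rewrite <- (Rmult_1_r (/ 2)) at 2. apply Rmult_le_compat_l; [lra|]. apply small; unfold big; lra. }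
assert (e6 : eps <= stiff_eps).
{ apply (Rmult_le_reg_r (/ stiff_eps)); trivial. rewrite Rinv_r by lra.
  apply small; unfold big; lra. }
destruct (adm_left mm eps hf e6) as [A [[hA hAr] adm]].
assert (hKe : 0 < K * eps) by now apply Rmult_lt_0_compat.
assert (wb : forall r, A <= r -> K * eps * / r ^ k <= K * eps * Wb).
{ intros r hr. apply Rmult_le_compat_l; [lra|]. apply Wb_ge. lra. }
(* A pair of functions is encoded as one function on [bool * R]: [true] selects [phi] and [false]
   selects [psi], so that one sup bound covers both. *)
set (X := (bool * R)%type).
set (Dm := fun t : X => A <= snd t).
set (S := fun y : X -> R => (forall i, ccont A (fun r => y (i, r))) /\
  forall i r, A <= r -> Rabs (y (i, r)) <= K * eps * / r ^ k).
set (T := fun y z : X -> R => exists I, step A (mm (y (true, r0))) phi0 psi0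
  (fun r => y (true, r)) (fun r => y (false, r)) (fun r => z (true, r)) (fun r => z (false, r)) I).
assert (Sv : forall y, S y -> forall i r, A <= r -> Rabs (y (i, r)) <= K * eps * Wb).
{ intros y [_ hy] i r hr. eapply Rle_trans; [now apply hy|]. now apply wb. }
destruct (half_contraction_fixpoint X Dm S T (fun _ => 0) (2 * (K * eps * Wb)))
  as [y [z [hy [[I hT] [hz heq]]]]].
- split; [intros i; apply ccont_const|]. intros i r hr. rewrite Rabs_R0.
  apply Rmult_le_pos; [lra|]. apply Rlt_le, inv_pow_pos. lra.
- intros y hy. assert (hy1 := Sv y hy).
  assert (hx0 : Rabs (y (true, r0)) <= vp / 2) by (eapply Rle_trans; [apply hy1|]; lra).
  assert (hm0 : mm (y (true, r0)) <> 0) by (destruct (flux_ok_sign mm eps _ _ hf hx0 hx0); lra).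
  destruct hf as [_ [hf1 _]].
  destruct (step_exists A (mm (y (true, r0))) phi0 psi0 (fun r => y (true, r)) (fun r => y (false, r)))
    as [phi' [psi' [I st]]]; trivial; try lra.
  + eapply Rle_trans; [now apply hf1 | lra].
  + apply hy.
  + apply hy.
  + intros r hr. split; (eapply Rle_trans; [now apply hy1 | lra]).
  + exists (fun t : X => if fst t then phi' (snd t) else psi' (snd t)). split; [now exists I|].
    assert (dec := hdec A (mm (y (true, r0))) phi0 psi0 eps (K * eps) _ _ phi' psi' I
      ltac:(lra) (adm _ hx0) hm0 (hf1 _ hx0) e1 hphi0 hpsi0 ltac:(lra) e2 e3
      (fun r hr => conj (proj2 hy true r hr) (proj2 hy false r hr)) st).
    destruct st as [_ [_ [_ [cs [_ [_ [_ [cp _]]]]]]]].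
    split.
    * intros [|]; now apply ccont_of_continuous.
    * assert (h1 : C2 * eps <= K * eps) by (unfold K; nra).
      assert (h2 : C2 * (eps + (K * eps) ^ 2) <= K * eps).
      { replace (K * eps) with (C2 * (eps + eps)) at 2 by (unfold K; ring).
        apply Rmult_le_compat_l; [lra|]. replace ((K * eps) ^ 2) with (eps * (eps * K ^ 2)) by ring.
        nra. }
      intros [|] r hr; cbn [fst snd]; destruct (dec r hr) as [v1 v2];
        (eapply Rle_trans; [eassumption|]);
        (apply Rmult_le_compat_r; [apply Rlt_le, inv_pow_pos; lra | trivial]).
- intros y1 y2 z1 z2 d hy1 hy2 hz1 hz2 [I1 st1] [I2 st2] hd [i r] hr. unfold Dm in hr; simpl in hr.
  assert (Sd : forall (y z : X -> R) r, S y -> S z -> A <= r ->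
    Rabs (y (true, r)) <= K * eps * Wb /\ Rabs (y (false, r)) <= K * eps * Wb /\
    Rabs (z (true, r)) <= K * eps * Wb /\ Rabs (z (false, r)) <= K * eps * Wb)
    by (intros y z s hy hz hs; repeat split; now apply Sv).
  assert (x1 : Rabs (y1 (true, r0)) <= vp / 2) by (eapply Rle_trans; [apply (Sv y1 hy1); lra | lra]).
  assert (x2 : Rabs (y2 (true, r0)) <= vp / 2) by (eapply Rle_trans; [apply (Sv y2 hy2); lra | lra]).
  assert (hsg := flux_ok_sign mm eps _ _ hf x1 x2).
  destruct hf as [_ [hf1 hf2]].
  destruct (hstep A (mm (y1 (true, r0))) (mm (y2 (true, r0))) phi0 psi0 (K * eps * Wb) eps d
    (fun r => y1 (true, r)) (fun r => y1 (false, r)) (fun r => z1 (true, r)) (fun r => z1 (false, r)) I1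
    (fun r => y2 (true, r)) (fun r => y2 (false, r)) (fun r => z2 (true, r)) (fun r => z2 (false, r)) I2
    ltac:(lra) (adm _ x1) hsg (hf1 _ x1) (hf1 _ x2) e1) with (r := r)
    as [v1 v2]; try exact st1; try exact st2; trivial.
  + eapply Rle_trans; [now apply hf2|]. apply Rmult_le_compat_r; [apply Rabs_pos|].
    apply Rmult_le_compat_l; [lra|]. apply hd. unfold Dm; simpl; lra.
  + intros s hs. now apply Sd.
  + intros s hs. now apply Sd.
  + intros s hs. split; now apply hd.
  + assert (hd0 : 0 <= d) by (eapply Rle_trans; [apply Rabs_pos | now apply (hd (true, r))]).
    assert (0 < K * eps * Wb) by (apply Rmult_lt_0_compat; lra).
    destruct i; (eapply Rle_trans; [eassumption|]); apply Rmult_le_compat_r; trivial.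
    eapply Rle_trans; [|apply e5]. apply Rmult_le_compat_l; lra.
- intros y1 y2 hy1 hy2 [i r] hr. replace (2 * (K * eps * Wb)) with (K * eps * Wb + K * eps * Wb) by ring.
  apply Rabs_plus_le; [|rewrite Rabs_Ropp]; now apply Sv.
- intros u y hu hlim. split.
  + intros i. apply (ccont_uniform_limit A (fun j r => u j (i, r))).
    * intros j. apply hu.
    * intros e hep. destruct (hlim e hep) as [J hJ]. exists J. intros r hr. now apply (hJ J (le_n _) (i, r)).
  + intros i r hr. apply le_epsilon. intros e hep. destruct (hlim e hep) as [J hJ].
    generalize (hJ J (le_n _) (i, r) hr). intros h1.
    replace (y (i, r)) with (u J (i, r) + - (u J (i, r) - y (i, r))) by ring.
    apply Rabs_plus_le; [now apply hu | now rewrite Rabs_Ropp].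
- exists A, (fun r => z (true, r)), (fun r => z (false, r)), I. split; [lra|]. split.
  (* The limit and its image agree on [[A, oo)], so the step from [y] to [z] is also a step from [z]
     to itself. The flux agrees too, as [r0] lies in that half-line. *)
  + rewrite <- (heq (true, r0)) by (unfold Dm; simpl; lra).
    revert hT. apply step_ext. intros r hr. split; now apply heq.
  + intros r hr. repeat split; try now apply hz.
    eapply Rle_trans; [now apply Sv | lra].
Qed.

End Reduced.

(** * The stationary equations *)

Lemma Derive_eq (f : R -> R) (x l : R) : is_derive f x l -> Derive f x = l.
Proof. apply is_derive_unique. Qed.

(** The function is eta-expanded to match the form in which [auto_derive] leaves the derivative of
    an unknown function. *)
Ltac rewrite_derive H :=
  match type of H with
  | is_derive ?f ?x ?l => rewrite (Derive_eq (fun y : R => f y) x l H)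
  end.

Section Equations.
Variables (k : nat) (A cV Rg nu lambda kap vp tp m : R) (phi psi dpsi I rho u theta : R -> R).
Let mu := 2 * nu + lambda.
Let N := INR (S k).

(** The viscous stress [mu div u], as the momentum integral expresses it. *)
Definition Gf (r : R) :=
  Rg * ((tp + psi r) * / (vp + phi r)) + - ppl Rg vp tp +
  m * (m * (/ r ^ (2 * S k) * (vp + phi r) + - N * I r)).

Hypotheses (hA : 0 < A) (hm : m <> 0) (hmu : 0 < mu)
  (hv : forall s, A < s -> vp + phi s <> 0)
  (hrho : forall s, A < s -> rho s = / (vp + phi s))
  (hu : forall s, A < s -> u s = m * (vp + phi s) * / s ^ S k)
  (hth : forall s, A < s -> theta s = tp + psi s)
  (dI : forall s, A < s -> is_derive I s (- ((vp + phi s) * / s ^ S (2 * S k))))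
  (dphi : forall s, A < s -> is_derive phi s (s ^ S k * Gf s / (mu * m)))
  (dpsi_ok : forall s, A < s -> is_derive psi s (dpsi s)).

Lemma near_gt (P : R -> Prop) (r : R) : (forall s, A < s -> P s) -> A < r -> locally r P.
Proof. intros hP hr. generalize (locally_gt A r hr). now apply filter_imp. Qed.

Lemma is_derive_near (f g : R -> R) (r l : R) : A < r ->
  (forall s, A < s -> g s = f s) -> is_derive f r l -> is_derive g r l.
Proof.
intros hr h. apply is_derive_ext_loc. apply near_gt; trivial.
intros s hs. symmetry. now apply h.
Qed.

Lemma is_derive_Gf (r : R) : A < r -> is_derive Gf r
  (Rg * (dpsi r * / (vp + phi r) - (tp + psi r) * (r ^ S k * Gf r / (mu * m)) / (vp + phi r) ^ 2) +
   m ^ 2 * ((r ^ S k * Gf r / (mu * m)) / r ^ (2 * S k) - N * (vp + phi r) / r ^ S (2 * S k))).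
Proof.
intros hr. assert (hr0 : r <> 0) by lra.
assert (da := is_derive_inv_pow (2 * S k) r hr0).
assert (hp := dphi r hr). assert (hs := dpsi_ok r hr). assert (hI := dI r hr).
assert (hv' := hv r hr).
set (G0 := Gf r) in *. unfold Gf.
(* Hiding the inverse power behind a name makes [auto_derive] treat it as an unknown function, whose
   derivative is then replaced by the simple form in [da]. *)
set (al := fun s : R => / s ^ (2 * S k)).
change (is_derive al r (- INR (2 * S k) / r ^ S (2 * S k))) in da.
change (is_derive (fun r => Rg * ((tp + psi r) * / (vp + phi r)) + - ppl Rg vp tp +
  m * (m * (al r * (vp + phi r) + - N * I r))) r
  (Rg * (dpsi r * / (vp + phi r) - (tp + psi r) * (r ^ S k * G0 / (mu * m)) / (vp + phi r) ^ 2) +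
   m ^ 2 * ((r ^ S k * G0 / (mu * m)) / r ^ (2 * S k) - N * (vp + phi r) / r ^ S (2 * S k)))).
auto_derive.
- repeat split; trivial; eexists; eassumption.
- rewrite_derive da; rewrite_derive hp; rewrite_derive hs; rewrite_derive hI.
  unfold al. rewrite mult_INR. fold N. change (INR 2) with 2.
  rewrite <- (tech_pow_Rmult r (2 * S k)).
  assert (r ^ (2 * S k) <> 0) by now apply pow_nonzero.
  field. repeat split; trivial. lra.
Qed.

Lemma flux_eq (s : R) : A < s -> s ^ S k * rho s * u s = m.
Proof.
intros hs. rewrite hrho, hu by trivial. field. split; [apply pow_nonzero; lra | now apply hv].
Qed.

Lemma is_derive_u (r : R) : A < r ->
  is_derive u r (Gf r / mu - N * m * (vp + phi r) / r ^ S (S k)).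
Proof.
intros hr. assert (hr0 : r <> 0) by lra.
apply (is_derive_near (fun s => m * (vp + phi s) * / s ^ S k)); trivial.
assert (dg := is_derive_inv_pow (S k) r hr0). assert (hp := dphi r hr).
set (ga := fun s : R => / s ^ S k).
change (is_derive ga r (- INR (S k) / r ^ S (S k))) in dg.
change (is_derive (fun s => m * (vp + phi s) * ga s) r (Gf r / mu - N * m * (vp + phi r) / r ^ S (S k))).
auto_derive.
- repeat split; trivial; eexists; eassumption.
- rewrite_derive dg; rewrite_derive hp.
  unfold ga. fold N. rewrite <- (tech_pow_Rmult r (S k)).
  assert (r ^ S k <> 0) by now apply pow_nonzero.
  field. repeat split; trivial. lra.
Qed.

Lemma divu_eq (s : R) : A < s -> Derive (fun t => t ^ S k * u t) s / s ^ S k = Gf s / mu.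
Proof.
intros hs. assert (hs0 : s ^ S k <> 0) by (apply pow_nonzero; lra).
rewrite (Derive_eq _ s (m * (0 + s ^ S k * Gf s / (mu * m)))).
- field. repeat split; trivial. lra.
- apply (is_derive_near (fun t => m * (vp + phi t))); trivial.
  + intros t ht. rewrite hu by trivial. field. apply pow_nonzero. lra.
  + apply (is_derive_scal (fun t => vp + phi t)).
    apply (is_derive_plus (fun _ => vp) phi); auto. apply (@is_derive_const R_AbsRing).
Qed.

Lemma Derive_divu (r : R) : A < r ->
  Derive (fun s => Derive (fun t => t ^ S k * u t) s / s ^ S k) r = Derive Gf r / mu.
Proof.
intros hr. apply is_derive_unique.
apply (is_derive_near (fun s => / mu * Gf s)); trivial.
- intros s hs. rewrite divu_eq by trivial. unfold Rdiv. ring.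
- unfold Rdiv. rewrite Rmult_comm. apply (is_derive_scal Gf). apply Derive_correct.
  eexists. now apply is_derive_Gf.
Qed.

Lemma mass_eq (r : R) : A < r -> Derive (fun s => s ^ S k * rho s * u s) r / r ^ S k = 0.
Proof.
intros hr. rewrite (Derive_eq _ r 0); [unfold Rdiv; ring|].
apply (is_derive_near (fun _ => m)); trivial.
- exact flux_eq.
- apply (@is_derive_const R_AbsRing).
Qed.

Lemma pow_double (r : R) : r ^ (2 * S k) = r ^ S k * r ^ S k.
Proof. rewrite <- pow_add. f_equal. lia. Qed.

Lemma momentum_eq (r : R) : A < r ->
  Derive (fun s => s ^ S k * rho s * (u s) ^ 2) r / r ^ S k +
    Derive (fun s => Rg * rho s * theta s) r =
  mu * Derive (fun s => Derive (fun t => t ^ S k * u t) s / s ^ S k) r.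
Proof.
intros hr. rewrite Derive_divu by trivial.
rewrite (Derive_eq Gf _ _ (is_derive_Gf r hr)).
rewrite (Derive_eq (fun s => s ^ S k * rho s * (u s) ^ 2) r
  (m * (Gf r / mu - N * m * (vp + phi r) / r ^ S (S k)))).
2:{ apply (is_derive_near (fun s => m * u s)); trivial.
    - intros s hs. rewrite <- (flux_eq s hs) at 1. ring.
    - apply (is_derive_scal u). now apply is_derive_u. }
assert (hv' := hv r hr).
rewrite (Derive_eq (fun s => Rg * rho s * theta s) r
  (Rg * (dpsi r * / (vp + phi r) - (tp + psi r) * (r ^ S k * Gf r / (mu * m)) / (vp + phi r) ^ 2))).
2:{ apply (is_derive_near (fun s => Rg * ((tp + psi s) * / (vp + phi s)))); trivial.
    - intros s hs. rewrite hrho, hth by trivial. ring.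
    - assert (hp := dphi r hr). assert (hs := dpsi_ok r hr).
      auto_derive.
      + repeat split; trivial; eexists; eassumption.
      + rewrite_derive hp; rewrite_derive hs.
        field. repeat split; trivial. lra. }
rewrite <- (tech_pow_Rmult r (2 * S k)), <- (tech_pow_Rmult r (S k)), pow_double.
assert (r ^ S k <> 0) by (apply pow_nonzero; lra).
field. repeat split; trivial; lra.
Qed.

Let qr (s : R) := qz k cV Rg nu vp tp (state_at k phi psi I m s).

Lemma is_derive_qr (r : R) : A < r -> is_derive qr r
  (let dp := r ^ S k * Gf r / (mu * m) in let v := vp + phi r in
   cV * dpsi r + ppl Rg vp tp * dp +
   m * (dp * (m * (N * I r + - / 2 * (v * / r ^ (2 * S k))) + 2 * nu * N * (v * / r ^ S (S k))) +
     v * (m * (- N * (v * / r ^ S (2 * S k)) - / 2 * (dp * / r ^ (2 * S k) - 2 * N * v / r ^ S (2 * S k))) +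
       2 * nu * N * (dp * / r ^ S (S k) - (N + 1) * v / r ^ S (S (S k)))))).
Proof.
intros hr. assert (hr0 : r <> 0) by lra. cbv zeta.
assert (da := is_derive_inv_pow (2 * S k) r hr0).
assert (db := is_derive_inv_pow (S (S k)) r hr0).
assert (hp := dphi r hr). assert (hs := dpsi_ok r hr). assert (hI := dI r hr).
set (G0 := Gf r) in *. unfold qr, qz, state_at. cbn [pa pb pphi ppsi pI pm]. fold N.
set (al := fun s : R => / s ^ (2 * S k)).
change (is_derive al r (- INR (2 * S k) / r ^ S (2 * S k))) in da.
set (be := fun s : R => / s ^ S (S k)).
change (is_derive be r (- INR (S (S k)) / r ^ S (S (S k)))) in db.
match goal with |- is_derive _ r ?l => change (is_derive (fun s =>
  cV * psi s + ppl Rg vp tp * phi s + m * ((vp + phi s) *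
   (m * (N * I s + - / 2 * (al s * (vp + phi s))) + 2 * nu * N * (be s * (vp + phi s))))) r l) end.
auto_derive.
- repeat split; trivial; eexists; eassumption.
- rewrite_derive da; rewrite_derive db; rewrite_derive hp; rewrite_derive hs; rewrite_derive hI.
  unfold al, be. rewrite mult_INR, (S_INR (S k)). fold N. change (INR 2) with 2.
  rewrite <- (tech_pow_Rmult r (2 * S k)), <- (tech_pow_Rmult r (S (S k))).
  assert (r ^ (2 * S k) <> 0) by now apply pow_nonzero.
  assert (r ^ S (S k) <> 0) by now apply pow_nonzero.
  field. repeat split; trivial; lra.
Qed.

(** The defect of the energy equation is the derivative of its first integral. Stated as an
    identity, it serves both directions: the right-hand side vanishes for a fixed point, the
    left-hand side for a given solution. *)
Lemma energy_eq (r X : R) : A < r -> is_derive (fun s => s ^ S k * dpsi s) r X ->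
  Derive (fun s => s ^ S k * rho s * u s * (cV * theta s + / 2 * (u s) ^ 2)) r / r ^ S k +
  Derive (fun s => s ^ S k * (Rg * rho s * theta s) * u s) r / r ^ S k -
  (kap * Derive (fun s => s ^ S k * Derive theta s) r / r ^ S k +
   mu * Derive (fun s => Derive (fun t => t ^ S k * u t) s / s ^ S k) r * u r +
   (2 * nu * (Derive u r) ^ 2 + 2 * nu * INR (S k) * (u r / r) ^ 2 +
    lambda * (Derive u r + INR (S k) / r * u r) ^ 2)) =
  (m * Derive qr r - kap * X) / r ^ S k.
Proof.
intros hr hX.
assert (hp := dphi r hr). assert (hs := dpsi_ok r hr). assert (hv' := hv r hr).
assert (dth : forall s, A < s -> is_derive theta s (dpsi s)).
{ intros s hs'. apply (is_derive_near (fun t => tp + psi t)); trivial.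
  replace (dpsi s) with (0 + dpsi s) by ring.
  apply (is_derive_plus (fun _ => tp) psi); auto. apply (@is_derive_const R_AbsRing). }
rewrite Derive_divu by trivial.
rewrite (Derive_eq Gf _ _ (is_derive_Gf r hr)).
rewrite (Derive_eq u _ _ (is_derive_u r hr)).
rewrite (Derive_eq qr _ _ (is_derive_qr r hr)).
rewrite (Derive_eq (fun s => s ^ S k * Derive theta s) r X).
2:{ apply (is_derive_near (fun s => s ^ S k * dpsi s)); trivial.
    intros s hs'. now rewrite (Derive_eq theta s _ (dth s hs')). }
rewrite (Derive_eq (fun s => s ^ S k * (Rg * rho s * theta s) * u s) r (m * Rg * dpsi r)).
2:{ apply (is_derive_near (fun s => m * Rg * theta s)); trivial.
    - intros s hs'. rewrite <- (flux_eq s hs') at 1. ring.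
    - apply (is_derive_scal theta). now apply dth. }
rewrite (Derive_eq (fun s => s ^ S k * rho s * u s * (cV * theta s + / 2 * (u s) ^ 2)) r
  (m * (cV * dpsi r + u r * (Gf r / mu - N * m * (vp + phi r) / r ^ S (S k))))).
2:{ apply (is_derive_near (fun s => m * (cV * theta s + / 2 * (u s) ^ 2))); trivial.
    - intros s hs'. rewrite <- (flux_eq s hs') at 1. ring.
    - assert (d1 := dth r hr). assert (d2 := is_derive_u r hr).
      auto_derive.
      + repeat split; trivial; eexists; eassumption.
      + rewrite_derive d1; rewrite_derive d2. field.
        repeat split; trivial; [apply pow_nonzero|]; lra. }
rewrite (hu r hr). cbv zeta. fold N.
(* Eliminating the temperature in favour of [Gf] turns the goal into an identity between rational
   expressions in independent quantities, with [r^N] abstracted as [z], which [field] decides. *)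
assert (hG : Rg * (tp + psi r) =
  (Gf r + ppl Rg vp tp - m * (m * (/ r ^ (2 * S k) * (vp + phi r) - N * I r))) * (vp + phi r)).
{ unfold Gf. field. repeat split; trivial. apply pow_nonzero. lra. }
replace (Rg * (dpsi r * / (vp + phi r) -
  (tp + psi r) * (r ^ S k * Gf r / (mu * m)) / (vp + phi r) ^ 2)) with
  (Rg * dpsi r * / (vp + phi r) -
   Rg * (tp + psi r) * (r ^ S k * Gf r / (mu * m)) / (vp + phi r) ^ 2)
  by (unfold Rdiv; ring).
rewrite hG. generalize (Gf r) (ppl Rg vp tp). intros G P.
rewrite <- (tech_pow_Rmult r (2 * S k)), <- (tech_pow_Rmult r (S (S k))),
  <- (tech_pow_Rmult r (S k)), pow_double.
assert (hz : r ^ S k <> 0) by (apply pow_nonzero; lra).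
revert hz. generalize (r ^ S k). intros z hz.
replace lambda with (mu - 2 * nu) by (unfold mu; ring).
clearbody mu N. clear - hA hr hm hmu hv' hz.
field. repeat split; trivial; lra.
Qed.

End Equations.

(** * Fixed points versus stationary solutions, and the boundary value problem for a general flux
    law *)

Section Correspondence.
Variables (k : nat) (r0 cV Rg nu lambda kap vp tp : R).
Let mu := 2 * nu + lambda.
Hypotheses (hk : (1 <= k)%nat) (hr0 : 0 < r0) (hcV : 0 < cV) (hRg : 0 < Rg) (hnu : 0 < nu)
  (hkap : 0 < kap) (hmu : 0 < mu) (hvp : 0 < vp) (htp : 0 < tp).

Lemma relaxation_rhs_eq (m s : R) (phi psi I : R -> R) : m <> 0 -> vp + phi s <> 0 ->
  apl Rg vp tp / (mu * m) * s ^ S k *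
    (fz k Rg vp tp (state_at k phi psi I m s) / apl Rg vp tp - phi s) =
  s ^ S k * Gf k Rg vp tp m phi psi I s / (mu * m).
Proof.
intros hm hv. unfold fz, Qz, Gf, apl, ppl, state_at. cbn [pa pb pphi ppsi pI pm].
generalize (/ s ^ (2 * S k)). intros al. field. repeat split; trivial; lra.
Qed.

(** Bootstrapping: the right-hand sides are built from [phi], [psi], [I], powers of [r] and
    [/ (vp + phi)] by sums and products, so each round gains one derivative. *)
Lemma Ck_step (A m phi0 psi0 : R) (phi psi I : R -> R) : 0 < A ->
  (forall r, A < r -> vp + phi r <> 0) ->
  step k r0 cV Rg nu kap mu vp tp A m phi0 psi0 phi psi phi psi I ->
  forall j, Ck A j phi /\ Ck A j psi /\ Ck A j I.
Proof.
intros hA hv [cI [dI [lI [cs [[K ds] [s0 [ls [cp [dp _]]]]]]]]].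
assert (hip : forall i j, Ck A j (fun r => / r ^ i)).
{ intros i j. apply Ck_inv; [intros r hr; apply pow_nonzero; lra|]. apply Ck_pow, Ck_id. }
induction j as [|j [IHp [IHs IHI]]].
- split; [|split]; intros r hr; auto with real.
- assert (hvC : Ck A j (fun r => vp + phi r)) by (apply Ck_plus; [apply Ck_const | trivial]).
  assert (hiv : Ck A j (fun r => / (vp + phi r))) by now apply Ck_inv.
  assert (c : forall x, Ck A j (fun _ => x)) by (intros; apply Ck_const).
  split; [|split].
  + eexists. split; [exact dp|].
    unfold fz, Qz, state_at. cbn [pa pb pphi ppsi pI pm]. unfold Rdiv, Rminus.
    apply Ck_mult; [apply Ck_mult; [apply c | apply Ck_pow, Ck_id]|].
    apply Ck_plus.
    * repeat first [apply Ck_plus | apply Ck_mult]; auto.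
    * apply Ck_ext with (fun r => -1 * phi r); [intros; ring|]. apply Ck_mult; auto.
  + eexists. split; [exact ds|].
    unfold qz, state_at. cbn [pa pb pphi ppsi pI pm]. unfold Rdiv, Rminus.
    repeat first [apply Ck_plus | apply Ck_mult]; auto.
  + eexists. split; [exact dI|].
    apply Ck_ext with (fun r => -1 * ((vp + phi r) * / r ^ S (2 * S k))); [intros; ring|].
    repeat apply Ck_mult; auto.
Qed.

(** The limit of [phi] is a separate hypothesis because [step] does not prescribe it; it comes from
    the decay of the fixed point. *)
Lemma stationary_of_step (A m phi0 psi0 : R) (phi psi I : R -> R) : 0 < A < r0 -> m <> 0 ->
  step k r0 cV Rg nu kap mu vp tp A m phi0 psi0 phi psi phi psi I ->
  (forall r, A <= r -> Rabs (phi r) <= vp / 2) -> is_lim phi p_infty 0 ->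
  (forall r, r0 <= r -> Rabs (psi r) < tp) ->
  stationary_solution (S (S k)) r0 cV Rg nu lambda kap (/ vp) 0 tp
    (fun r => / (vp + phi r)) (fun r => m * (vp + phi r) * / r ^ S k) (fun r => tp + psi r).
Proof.
intros [hA hAr] hm st bp lp bs.
assert (hv : forall r, A <= r -> vp / 2 <= vp + phi r <= 2 * vp).
{ intros r hr. generalize (bp r hr). intros h. apply Rabs_le_between in h. lra. }
assert (hv0 : forall r, A < r -> vp + phi r <> 0) by (intros r hr; generalize (hv r ltac:(lra)); lra).
assert (hC := Ck_step A m phi0 psi0 phi psi I hA hv0 st).
assert (hvC : forall j, Ck A j (fun r => vp + phi r))
  by (intros j; apply Ck_plus; [apply Ck_const | apply hC]).
destruct st as [cI [dI [lI [cs [[K ds] [s0 [ls [cp [dp _]]]]]]]]].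
repeat apply conj.
- apply (smooth_of_Ck A); trivial. intros j. now apply Ck_inv.
- apply (smooth_of_Ck A); trivial. intros j.
  apply Ck_mult; [apply Ck_mult; [apply Ck_const | trivial]|].
  apply Ck_inv; [intros r hr; apply pow_nonzero; lra|]. apply Ck_pow, Ck_id.
- apply (smooth_of_Ck A); trivial. intros j.
  apply Ck_plus; [apply Ck_const | apply hC].
- intros r hr. split.
  + apply Rinv_0_lt_compat. generalize (hv r ltac:(lra)). lra.
  + generalize (bs r hr). intros h. apply Rabs_lt_between in h. lra.
- unfold stationary_eqs. cbv zeta beta. replace (S (S k) - 1)%nat with (S k) by lia.
  intros r hr0'. assert (hr : A < r) by lra.
  set (dpsi := fun s => (m * qz k cV Rg nu vp tp (state_at k phi psi I m s) / kap - K) / s ^ S k).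
  assert (dp' : forall s, A < s ->
    is_derive phi s (s ^ S k * Gf k Rg vp tp m phi psi I s / (mu * m))).
  { intros s hs. rewrite <- relaxation_rhs_eq; auto. }
  split; [|split].
  + now apply (mass_eq k A vp m phi).
  + apply (momentum_eq k A Rg nu lambda vp tp m phi psi dpsi I); auto.
  + assert (hX : is_derive (fun s => s ^ S k * dpsi s) r
      (/ kap * (m * Derive (fun s => qz k cV Rg nu vp tp (state_at k phi psi I m s)) r))).
    { apply (is_derive_near A (fun s => / kap *
        (m * qz k cV Rg nu vp tp (state_at k phi psi I m s)) + - K)); trivial.
      - intros s hs. assert (s ^ S k <> 0) by (apply pow_nonzero; lra).
        unfold dpsi. field. lra.
      - replace (/ kap * _) with
          (/ kap * (m * Derive (fun s => qz k cV Rg nu vp tp (state_at k phi psi I m s)) r) + 0) by ring.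
        apply (is_derive_plus (fun s => / kap * (m * qz k cV Rg nu vp tp (state_at k phi psi I m s)))
          (fun _ => - K)); [|apply (@is_derive_const R_AbsRing)].
        apply (is_derive_scal (fun s => m * qz k cV Rg nu vp tp (state_at k phi psi I m s))).
        apply (is_derive_scal (fun s => qz k cV Rg nu vp tp (state_at k phi psi I m s))).
        apply Derive_correct. eexists.
        apply (is_derive_qr k A cV Rg nu lambda vp tp m phi psi dpsi I); auto. }
    apply Rminus_diag_uniq.
    rewrite (energy_eq k A cV Rg nu lambda kap vp tp m phi psi dpsi I (fun s => / (vp + phi s))
      (fun s => m * (vp + phi s) * / s ^ S k) (fun s => tp + psi s) hA hm hmu hv0
      (fun _ _ => eq_refl) (fun _ _ => eq_refl) (fun _ _ => eq_refl) dI dp' ds r _ hr hX).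
    assert (r ^ S k <> 0) by (apply pow_nonzero; lra). field. lra.
- replace (/ vp) with (/ (vp + 0)) by (f_equal; ring).
  apply (is_lim_inv (fun r => vp + phi r) p_infty (vp + 0)).
  + apply is_lim_plus'; [apply is_lim_const | trivial].
  + intros h. injection h. lra.
- apply (is_lim_dominated _ (fun r => Rabs m * (2 * vp) * / r ^ S k) A).
  + intros r hr. apply Rabs_mult_le.
    * apply Rabs_mult_le; [lra|]. generalize (hv r hr). intros h. rewrite Rabs_right; lra.
    * rewrite Rabs_right; [lra|]. apply Rle_ge, Rlt_le, inv_pow_pos. lra.
  + apply is_lim_scal0, is_lim_inv_pow. lia.
- replace tp with (tp + 0) at 1 by ring. apply is_lim_plus'; [apply is_lim_const | trivial].
Qed.


(** If [c + l] were not 0, the right-hand side would eventually keep its sign and stay above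
    [|c + l| / 2] in size, and [b * phi] could not remain bounded. This identifies the constant of
    the momentum integral as [- p+]. *)
Lemma bounded_forces_balance (phi dphi g : R -> R) (A b B c l : R) : 0 <= A ->
  (forall s, A < s -> is_derive phi s (dphi s)) ->
  (forall s, A < s -> Rabs (phi s) <= B) ->
  (forall s, A < s -> b * dphi s = s ^ S k * (c + g s)) ->
  is_lim g p_infty l -> c + l = 0.
Proof.
intros hA dp bp heq hl.
destruct (Req_dec (c + l) 0) as [|hn]; trivial. exfalso.
set (e := Rabs (c + l)). assert (he : 0 < e) by now apply Rabs_pos_lt.
set (sg := if Rle_dec 0 (c + l) then 1 else -1).
assert (hs1 : sg * (c + l) = e).
{ unfold sg, e. destruct (Rle_dec 0 (c + l)); [rewrite Rabs_right | rewrite Rabs_left]; lra. }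
assert (hs2 : sg = 1 \/ sg = -1) by (unfold sg; destruct (Rle_dec 0 (c + l)); tauto).
apply is_lim_spec in hl. destruct (hl (mkposreal (e / 2) ltac:(lra))) as [S0 hS0]. simpl in hS0.
set (S1 := Rmax (Rmax S0 A) 1 + 1).
assert (hS1 : S0 < S1 /\ A < S1 /\ 1 < S1).
{ unfold S1. generalize (Rmax_l (Rmax S0 A) 1) (Rmax_r (Rmax S0 A) 1) (Rmax_l S0 A) (Rmax_r S0 A).
  lra. }
assert (hB : 0 <= B) by (eapply Rle_trans; [apply Rabs_pos | apply (bp S1); lra]).
(* A length over which the growth [e / 2 * t] exceeds by 1 the largest possible change [2 |b| B] of
   [b * phi]. *)
set (t := 2 / e * (2 * Rabs b * B + 1)).
assert (hb0 := Rabs_pos b).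
assert (hbB : 0 <= 2 * Rabs b * B) by (apply Rmult_le_pos; lra).
assert (ht : 0 < t) by (apply Rmult_lt_0_compat; [apply Rdiv_lt_0_compat|]; lra).
assert (hdec : e / 2 * (S1 + t) - sg * b * phi (S1 + t) <= e / 2 * S1 - sg * b * phi S1).
{ apply (decr_half_line (fun s => e / 2 * s - sg * b * phi s)
    (fun s => e / 2 * 1 - sg * b * dphi s) S1); try lra.
  - intros s hs. apply (ex_derive_continuous (fun s => e / 2 * s - sg * b * phi s)).
    eexists. apply (is_derive_minus (fun s => e / 2 * s) (fun s => sg * b * phi s)).
    + apply (is_derive_scal (fun s => s)). apply (@is_derive_id R_AbsRing).
    + apply (is_derive_scal phi). apply dp. lra.
  - intros s hs. apply (is_derive_minus (fun s => e / 2 * s) (fun s => sg * b * phi s)).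
    + apply (is_derive_scal (fun s => s)). apply (@is_derive_id R_AbsRing).
    + apply (is_derive_scal phi). apply dp. lra.
  - intros s hs. rewrite Rmult_assoc, (heq s) by lra.
    assert (hg := hS0 s ltac:(lra)). apply Rabs_lt_between in hg.
    assert (hp : 1 <= s ^ S k) by (apply pow_R1_Rle; lra).
    assert (e / 2 <= sg * (c + g s)) by (destruct hs2 as [h|h]; rewrite h in *; lra).
    replace (sg * (s ^ S k * (c + g s))) with (s ^ S k * (sg * (c + g s))) by ring.
    nra. }
assert (hte : e / 2 * t = 2 * Rabs b * B + 1) by (unfold t; field; lra).
assert (hdiff : Rabs (sg * b * (phi (S1 + t) - phi S1)) <= Rabs b * (B + B)).
{ apply Rabs_mult_le.
  - rewrite Rabs_mult. destruct hs2 as [h|h]; rewrite h; [rewrite Rabs_R1 | rewrite Rabs_m1]; lra.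
  - apply Rabs_plus_le; [apply bp; lra | rewrite Rabs_Ropp; apply bp; lra]. }
apply Rabs_le_between in hdiff. lra.
Qed.

(** Each equation is integrated once: mass at its value at [r0], momentum with the constant forced
    by boundedness of [phi], energy with a constant that becomes [K]. The identities hold for
    [r >= r0] only, so they are differentiated at [r > r0], and the step lives on [[r0, oo)]. *)
Lemma step_of_stationary (rho u theta : R -> R) (m phi0 : R) :
  stationary_solution (S (S k)) r0 cV Rg nu lambda kap (/ vp) 0 tp rho u theta ->
  r0 ^ S k * rho r0 * u r0 = m -> m <> 0 ->
  (forall r, r0 <= r -> Rabs (/ rho r - vp) <= vp / 2) ->
  (0 < m -> / rho r0 - vp = phi0) ->
  let phi := fun r => / rho r - vp in let psi := fun r => theta r - tp in
  (exists I, step k r0 cV Rg nu kap mu vp tp r0 m phi0 (theta r0 - tp) phi psi phi psi I) /\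
  (forall r, r0 <= r -> u r = m * / rho r * / r ^ S k).
Proof.
intros [sr [su [st [pos [eqs [lr [_ lt]]]]]]] hm hm0 bp hp0 phi psi.
unfold stationary_eqs in eqs. cbv zeta beta in eqs.
replace (S (S k) - 1)%nat with (S k) in eqs by lia.
assert (er : forall r, r0 <= r -> ex_derive rho r) by (intros r hr; exact (sr 0%nat r hr)).
assert (er2 : forall r, r0 <= r -> ex_derive (Derive rho) r) by (intros r hr; exact (sr 1%nat r hr)).
assert (eu : forall r, r0 <= r -> ex_derive u r) by (intros r hr; exact (su 0%nat r hr)).
assert (et : forall r, r0 <= r -> ex_derive theta r) by (intros r hr; exact (st 0%nat r hr)).
assert (et2 : forall r, r0 <= r -> ex_derive (Derive theta) r) by (intros r hr; exact (st 1%nat r hr)).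
assert (hrho : forall r, r0 <= r -> rho r <> 0) by (intros r hr; destruct (pos r hr); lra).
assert (hz : forall r, r0 <= r -> r ^ S k <> 0) by (intros r hr; apply pow_nonzero; lra).
assert (hflux : forall r, r0 <= r -> r ^ S k * rho r * u r = m).
{ intros r hr. rewrite <- hm.
  assert (eh : forall r, r0 <= r -> ex_derive (fun s => s ^ S k * rho s * u s) r).
  { intros s hs. auto_derive. repeat split; auto. }
  apply (const_half_line (fun s => s ^ S k * rho s * u s) r0); trivial.
  - intros s hs. apply (ex_derive_continuous (fun s => s ^ S k * rho s * u s)). now apply eh.
  - intros s hs. replace 0 with (Derive (fun s => s ^ S k * rho s * u s) s).
    + apply Derive_correct, eh. lra.
    + destruct (eqs s ltac:(lra)) as [e1 _]. assert (hz' := hz s ltac:(lra)).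
      apply (Rmult_eq_reg_r (/ s ^ S k)); [|now apply Rinv_neq_0_compat]. rewrite Rmult_0_l. exact e1. }
assert (huv : forall r, r0 <= r -> u r = m * / rho r * / r ^ S k).
{ intros r hr. rewrite <- (hflux r hr). field. split; auto. }
split; trivial.
assert (huv' : forall r, r0 < r -> u r = m * (vp + phi r) * / r ^ S k).
{ intros r hr. unfold phi. rewrite huv by lra. ring. }
assert (hrv : forall r, r0 < r -> rho r = / (vp + phi r)).
{ intros r hr. unfold phi. replace (vp + (/ rho r - vp)) with (/ rho r) by ring.
  now rewrite Rinv_inv. }
assert (hv : forall r, r0 <= r -> vp / 2 <= vp + phi r <= 2 * vp).
{ intros r hr. generalize (bp r hr). intros h. apply Rabs_le_between in h. unfold phi. lra. }
assert (hv0 : forall r, r0 < r -> vp + phi r <> 0) by (intros r hr; generalize (hv r ltac:(lra)); lra).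
assert (hthv : forall r, r0 < r -> theta r = tp + psi r) by (intros; unfold psi; ring).
assert (dph0 : forall r, r0 <= r -> is_derive phi r (- Derive rho r / rho r ^ 2)).
{ intros r hr. unfold phi. assert (hr' := hrho r hr). assert (er' := er r hr).
  assert (hd := Derive_correct rho r er').
  auto_derive; [now split|]. rewrite_derive hd. field. trivial. }
assert (dph : forall r, r0 <= r -> is_derive phi r (Derive phi r)).
{ intros r hr. apply Derive_correct. eexists. now apply dph0. }
assert (dph2 : forall r, r0 < r -> is_derive (Derive phi) r (Derive (Derive phi) r)).
{ intros r hr. apply Derive_correct.
  apply (ex_derive_ext_loc (fun s => - Derive rho s / rho s ^ 2)).
  - apply (near_gt r0); trivial. intros s hs. symmetry. apply Derive_eq, dph0. lra.
  - assert (er2' := er2 r ltac:(lra)). assert (er' := er r ltac:(lra)). assert (hr' := hrho r ltac:(lra)).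
    unfold Rdiv. auto_derive. repeat split; trivial. now apply (pow_nonzero _ 2). }
assert (cph : forall r, r0 <= r -> continuous phi r).
{ intros r hr. apply (ex_derive_continuous phi). eexists. now apply dph. }
assert (dps : forall r, r0 <= r -> is_derive psi r (Derive theta r)).
{ intros r hr. unfold psi. assert (et' := et r hr). auto_derive; trivial.
  apply Rmult_1_l. }
assert (cps : forall r, r0 <= r -> continuous psi r).
{ intros r hr. apply (ex_derive_continuous psi). eexists. now apply dps. }
destruct (tail_integral_exists k vp) with (A := r0) (phi := phi) as [I [dI0 [_ lI]]]; trivial.
{ now apply ccont_of_continuous. }
assert (dI : forall r, r0 < r -> is_derive I r (- ((vp + phi r) * / r ^ S (2 * S k)))).
{ intros r hr. apply dI0. lra. }
set (N := INR (S k)).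
set (QQ := fun s => / s ^ (2 * S k) * (vp + phi s) + - N * I s).
(* [mu div u - p - m^2 Q]: the momentum equation says that it is constant. The term [N I] in [QQ]
   accounts for the part of the inertia that is not an exact derivative. *)
set (Phi := fun s => mu * (m * (Derive phi s * / s ^ S k)) - (Rg * rho s * theta s + m * (m * QQ s))).
assert (dPhi : forall r, r0 < r -> is_derive Phi r 0).
{ intros r hr. assert (hr1 : r <> 0) by lra. assert (hr2 : r0 <= r) by lra.
  assert (hz' := hz r hr2).
  destruct (eqs r hr2) as [_ [e2 _]].
  assert (dg := is_derive_inv_pow (S k) r hr1). assert (da := is_derive_inv_pow (2 * S k) r hr1).
  set (ga := fun s : R => / s ^ S k).
change (is_derive ga r (- INR (S k) / r ^ S (S k))) in dg.
  set (al := fun s : R => / s ^ (2 * S k)).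
  change (is_derive al r (- INR (2 * S k) / r ^ S (2 * S k))) in da.
  assert (d1 := dph r hr2). assert (d2 := dph2 r hr). assert (hI := dI r hr).
  set (ddphi := Derive (Derive phi) r) in *.
  assert (du : is_derive u r (m * (Derive phi r * ga r + (vp + phi r) * (- N / r ^ S (S k))))).
  { apply (is_derive_near r0 (fun s => m * ((vp + phi s) * ga s))); trivial.
    - intros s hs. rewrite huv' by trivial. unfold ga. ring.
    - auto_derive; [repeat split; eexists; eassumption|].
      rewrite_derive dg; rewrite_derive d1. unfold N. ring. }
  assert (dd : is_derive (fun s => Derive (fun t => t ^ S k * u t) s / s ^ S k) r
    (m * (ddphi * ga r + Derive phi r * (- N / r ^ S (S k))))).
  { apply (is_derive_near r0 (fun s => m * (Derive phi s * ga s))); trivial.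
    - intros s hs. rewrite (Derive_eq (fun t => t ^ S k * u t) s (m * Derive phi s)).
      + unfold ga, Rdiv. ring.
      + apply (is_derive_near r0 (fun t => m * (vp + phi t))); trivial.
        * intros t ht. rewrite huv' by trivial. field. apply hz. lra.
        * assert (d1' := dph s ltac:(lra)). auto_derive; [eexists; eassumption|].
          rewrite_derive d1'. ring.
    - auto_derive; [repeat split; eexists; eassumption|].
      rewrite_derive dg; rewrite_derive d2. unfold N. ring. }
  assert (dm : is_derive (fun s => s ^ S k * rho s * u s ^ 2) r
    (m * (m * (Derive phi r * ga r + (vp + phi r) * (- N / r ^ S (S k)))))).
  { apply (is_derive_near r0 (fun s => m * u s)); trivial.
    - intros s hs. rewrite <- (hflux s) at 1 by lra. ring.
    - now apply (is_derive_scal u). }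
  rewrite (Derive_eq (fun s => s ^ S k * rho s * u s ^ 2) _ _ dm),
    (Derive_eq (fun s => Derive (fun t => t ^ S k * u t) s / s ^ S k) _ _ dd) in e2.
  assert (dpr : is_derive (fun s => Rg * rho s * theta s) r (Derive (fun s => Rg * rho s * theta s) r)).
  { apply Derive_correct. auto_derive. repeat split; auto. }
  set (pr := fun s : R => Rg * rho s * theta s) in *.
  set (dp1 := Derive pr r) in *. change (is_derive pr r dp1) in dpr.
  unfold Phi, QQ.
  change (is_derive (fun s => mu * (m * (Derive phi s * ga s)) -
    (pr s + m * (m * (al s * (vp + phi s) + - N * I s)))) r 0).
  auto_derive; [repeat split; eexists; eassumption|].
  rewrite_derive dg; rewrite_derive da; rewrite_derive d2; rewrite_derive hI; rewrite_derive d1;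
    rewrite_derive dpr.
  unfold al, ga in *. rewrite mult_INR. fold N. change (INR 2) with 2.
  fold mu in e2. rewrite <- (tech_pow_Rmult r (2 * S k)), <- (tech_pow_Rmult r (S k)) in *.
  rewrite (pow_double k) in *.
  replace dp1 with (mu * (m * (ddphi * / r ^ S k + Derive phi r * (- N / (r * r ^ S k)))) -
    m * (m * (Derive phi r * / r ^ S k + (vp + phi r) * (- N / (r * r ^ S k)))) / r ^ S k) by lra.
  field. split; trivial. }
assert (hPhi : forall s, r0 < s -> Phi s = - ppl Rg vp tp).
{ intros s hs.
  assert (hc : forall x, r0 < x -> Phi x = Phi (r0 + 1)).
  { intros x hx. apply (const_open_half_line Phi r0); trivial. lra. }
  enough (Phi (r0 + 1) + ppl Rg vp tp = 0) by (rewrite (hc s hs); lra).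
  apply (bounded_forces_balance phi (Derive phi)
    (fun s => Rg * rho s * theta s + m * (m * QQ s)) r0 (mu * m) (vp / 2)).
  - lra.
  - intros x hx. apply dph. lra.
  - intros x hx. apply bp. lra.
  - intros x hx. rewrite <- (hc x hx). unfold Phi. field. apply hz. lra.
  - replace (ppl Rg vp tp) with (Rg * / vp * tp + 0) by (unfold ppl, Rdiv; ring).
    apply is_lim_plus'.
    + apply (is_lim_mult (fun s => Rg * rho s) theta p_infty (Rg * / vp) tp); trivial; [|easy].
      apply (is_lim_scal_l rho Rg p_infty (/ vp)). exact lr.
    + apply is_lim_scal0, is_lim_scal0, is_lim_plus0; [|now apply is_lim_scal0].
      apply (is_lim_dominated _ (fun s => / s ^ (2 * S k) * (2 * vp)) r0).
      * intros x hx. apply Rabs_mult_le.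
        -- rewrite Rabs_right; [lra|]. apply Rle_ge, Rlt_le, inv_pow_pos. lra.
        -- generalize (hv x hx). intros h. rewrite Rabs_right; lra.
      * apply is_lim_ext with (fun s => 2 * vp * / s ^ (2 * S k)); [intros; ring|].
        apply is_lim_scal0, is_lim_inv_pow. lia. }
assert (dphG : forall s, r0 < s ->
  is_derive phi s (s ^ S k * Gf k Rg vp tp m phi psi I s / (mu * m))).
{ intros s hs. assert (hz' := hz s ltac:(lra)).
  replace (s ^ S k * Gf k Rg vp tp m phi psi I s / (mu * m)) with (Derive phi s).
  - apply dph. lra.
  - unfold Gf. rewrite <- (hPhi s hs). unfold Phi. rewrite <- (hthv s hs), <- (hrv s hs).
    fold N. unfold QQ. field. repeat split; trivial. apply pow_nonzero. lra. lra. }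
set (qr := fun s => qz k cV Rg nu vp tp (state_at k phi psi I m s)).
assert (dps' : forall s, r0 < s -> is_derive psi s (Derive theta s)).
{ intros s hs. apply dps. lra. }
assert (dE : forall r, r0 < r ->
  is_derive (fun s => / kap * (m * qr s) - s ^ S k * Derive theta s) r 0).
{ intros r hr. assert (hz' := hz r ltac:(lra)).
  destruct (eqs r ltac:(lra)) as [_ [_ e3]].
  assert (hX : is_derive (fun s => s ^ S k * Derive theta s) r
    (Derive (fun s => s ^ S k * Derive theta s) r)).
  { apply Derive_correct. assert (et2' := et2 r ltac:(lra)). auto_derive. repeat split; trivial. }
  assert (hE := energy_eq k r0 cV Rg nu lambda kap vp tp m phi psi (Derive theta) I rho u theta
    hr0 hm0 hmu hv0 hrv huv' hthv dI dphG dps' r _ hr hX).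
  fold qr in hE. rewrite e3 in hE.
  set (X := Derive (fun s => s ^ S k * Derive theta s) r) in *.
  assert (hq : is_derive qr r (Derive qr r)).
  { apply Derive_correct. eexists.
    apply (is_derive_qr k r0 cV Rg nu lambda vp tp m phi psi (Derive theta) I); auto. }
  replace 0 with (/ kap * (m * Derive qr r) - X).
  - apply (is_derive_minus (fun s => / kap * (m * qr s)) (fun s => s ^ S k * Derive theta s)); trivial.
    apply (is_derive_scal (fun s => m * qr s)). now apply (is_derive_scal qr).
  - assert (hE' : m * Derive qr r - kap * X = 0).
    { apply (Rmult_eq_reg_r (/ r ^ S k)); [|now apply Rinv_neq_0_compat].
      rewrite Rmult_0_l. unfold Rdiv in hE. rewrite <- hE. ring. }
    replace (m * Derive qr r) with (kap * X) by lra. field. lra. }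
exists I. repeat apply conj; trivial.
- intros r hr. apply (ex_derive_continuous I). eexists. now apply dI0.
- exists (/ kap * (m * qr (r0 + 1)) - (r0 + 1) ^ S k * Derive theta (r0 + 1)).
  intros r hr. assert (hz' := hz r ltac:(lra)).
  rewrite <- (const_open_half_line _ r0 dE r (r0 + 1) hr ltac:(lra)).
  replace (_ / r ^ S k) with (Derive theta r); [now apply dps'|].
  unfold qr. field. split; trivial. lra.
- replace 0 with (tp + -1 * tp) by ring.
  apply is_lim_ext with (fun r => theta r + -1 * tp); [intros; unfold psi; ring|].
  apply is_lim_plus'; [trivial | apply is_lim_const].
- intros r hr. rewrite relaxation_rhs_eq; auto.
- intros _. exists (vp / 2). exact bp.
Qed.

Definition boundary_solution (bcond : R -> Prop) (um thm E C : R) (rho u theta : R -> R) :=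
  stationary_solution (S (S k)) r0 cV Rg nu lambda kap (/ vp) 0 tp rho u theta /\
  bcond (rho r0) /\ u r0 = um /\ theta r0 = thm /\
  (forall r, r0 <= r ->
     Rabs (rho r - / vp) <= C / r ^ k * E /\ Rabs (theta r - tp) <= C / r ^ k * E /\
     / C / r ^ S k * Rabs um <= Rabs (u r) /\ Rabs (u r) <= C / r ^ S k * Rabs um).

(* Inflow and outflow differ only in the flux law [mm] and in the condition [bcond] imposed on the
   density at [r0]. *)
Lemma boundary_problem (L : R) : 0 < L -> exists eps0 C, 0 < eps0 /\ 0 < C /\
  forall (E um thm phi0 : R) (mm : R -> R) (bcond : R -> Prop),
  0 < E <= eps0 -> um <> 0 -> Rabs (thm - tp) <= L * E -> Rabs phi0 <= L * E ->
  flux_ok vp mm (L * E) ->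
  (forall x, Rabs x <= vp / 2 -> (0 < mm x -> x = phi0) ->
     bcond (/ (vp + x)) /\ mm x * (vp + x) = r0 ^ S k * um) ->
  (forall y, 0 < y -> bcond y -> Rabs (/ y - vp) <= vp / 2 ->
     r0 ^ S k * y * um = mm (/ y - vp) /\ (0 < mm (/ y - vp) -> / y - vp = phi0)) ->
  (exists rho u theta, boundary_solution bcond um thm E C rho u theta) /\
  (forall rho1 u1 theta1 rho2 u2 theta2,
     boundary_solution bcond um thm E C rho1 u1 theta1 ->
     boundary_solution bcond um thm E C rho2 u2 theta2 ->
     forall r, r0 <= r -> rho1 r = rho2 r /\ u1 r = u2 r /\ theta1 r = theta2 r).
Proof.
intros hL.
destruct (reduced_unique k r0 cV Rg nu kap mu vp tp) as [delta [epsu [hdel [hepsu huniq]]]]; trivial.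
destruct (reduced_exists k r0 cV Rg nu kap mu vp tp) as [epse [Ce [hepse [hCe hex]]]]; trivial.
assert (hzN : 0 < r0 ^ S k) by now apply pow_lt.
assert (hzk : 0 < r0 ^ k) by now apply pow_lt.
assert (hizk : 0 < / r0 ^ k) by now apply Rinv_0_lt_compat.
assert (hizN : 0 < / r0 ^ S k) by now apply Rinv_0_lt_compat.
assert (hivp : 0 < / vp) by now apply Rinv_0_lt_compat.
assert (hivp2 : 0 < 2 * / vp * / vp) by (apply Rmult_lt_0_compat; lra).
assert (hCL : 0 < Ce * L) by now apply Rmult_lt_0_compat.
(* The factor [2 / vp^2] converts a bound on [phi] into one on [rho]. In the velocity bounds [|u|]
   is compared with its value at [r0]; the ratio of specific volumes is at most 3 either way, which
   the two factors 4 cover. *)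
set (C := 1 + Ce * L * (1 + 2 * / vp * / vp) + 4 * r0 ^ S k + 4 * / r0 ^ S k).
assert (hCL2 : 0 < Ce * L * (2 * / vp * / vp)) by now apply Rmult_lt_0_compat.
assert (hC : 0 < C) by (unfold C; lra).
assert (hCk : 0 < C * / r0 ^ k) by now apply Rmult_lt_0_compat.
(* [e1] and [e2] make the existence and uniqueness results applicable, [e3] keeps the temperature
   positive, [e4] keeps a given density above half of its limit, and [e5] and [e6] bring [phi] and
   [psi] of a given solution into the ball of uniqueness. *)
destruct (small_enough L epse) as [e1 [he1 s1]]; [lra | trivial |].
destruct (small_enough L epsu) as [e2 [he2 s2]]; [lra | trivial |].
destruct (small_enough (Ce * L * / r0 ^ k) (tp / 2)) as [e3 [he3 s3]];
  [apply Rmult_le_pos; lra | lra |].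
destruct (small_enough (C * / r0 ^ k) (/ vp / 2)) as [e4 [he4 s4]]; [lra | lra |].
destruct (small_enough (2 * vp * vp * (C * / r0 ^ k)) (Rmin delta (vp / 2))) as [e5 [he5 s5]];
  [apply Rmult_le_pos; nra | apply Rmin_glb_lt; lra |].
destruct (small_enough (C * / r0 ^ k) delta) as [e6 [he6 s6]]; [lra | trivial |].
exists (Rmin (Rmin e1 (Rmin e2 e3)) (Rmin e4 (Rmin e5 e6))), C.
split; [repeat apply Rmin_glb_lt; trivial|]. split; trivial.
intros E um thm phi0 mm bcond [hE0 hE] hum hthm hphi0 hf hmx hmy.
assert (hEi : E <= e1 /\ E <= e2 /\ E <= e3 /\ E <= e4 /\ E <= e5 /\ E <= e6).
{ generalize (Rmin_l (Rmin e1 (Rmin e2 e3)) (Rmin e4 (Rmin e5 e6)))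
    (Rmin_r (Rmin e1 (Rmin e2 e3)) (Rmin e4 (Rmin e5 e6)))
    (Rmin_l e1 (Rmin e2 e3)) (Rmin_r e1 (Rmin e2 e3)) (Rmin_l e2 e3) (Rmin_r e2 e3)
    (Rmin_l e4 (Rmin e5 e6)) (Rmin_r e4 (Rmin e5 e6)) (Rmin_l e5 e6) (Rmin_r e5 e6).
  intros; repeat split; lra. }
destruct hEi as [hE1 [hE2 [hE3 [hE4 [hE5 hE6]]]]].
assert (hLE : 0 < L * E) by now apply Rmult_lt_0_compat.
split.
- destruct (hex (L * E) mm phi0 (thm - tp)) as [A [phi [psi [I [[hA hAr] [st bd]]]]]]; auto.
  assert (hx0 : Rabs (phi r0) <= vp / 2) by (apply bd; lra).
  assert (hm0 : mm (phi r0) <> 0) by (destruct (flux_ok_sign vp mm _ _ _ hf hx0 hx0); lra).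
  assert (hpl : 0 < mm (phi r0) -> phi r0 = phi0) by apply st.
  assert (hs0 : psi r0 = thm - tp) by apply st.
  destruct (hmx (phi r0) hx0 hpl) as [hbc hmv].
  assert (hv : forall r, A <= r -> vp / 2 <= vp + phi r <= 3 / 2 * vp).
  { intros r hr. destruct (bd r hr) as [_ [_ h]]. apply Rabs_le_between in h. lra. }
  set (m := mm (phi r0)) in *.
  exists (fun r => / (vp + phi r)), (fun r => m * (vp + phi r) * / r ^ S k), (fun r => tp + psi r).
  split; [|split; [|split; [|split]]]; trivial.
  + apply (stationary_of_step A m phi0 (thm - tp) phi psi I); trivial; [lra | | |].
    * intros r hr. now apply bd.
    * apply (is_lim_dominated _ (fun r => Ce * (L * E) * / r ^ k) A).
      -- intros r hr. now apply bd.
      -- apply is_lim_scal0. now apply is_lim_inv_pow.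
    * intros r hr. apply Rle_lt_trans with (Ce * L * / r0 ^ k * E); [|generalize (s3 E hE3); lra].
      destruct (bd r ltac:(lra)) as [_ [h _]]. eapply Rle_trans; [apply h|].
      replace (Ce * L * / r0 ^ k * E) with (Ce * (L * E) * / r0 ^ k) by ring.
      apply Rmult_le_compat_l; [apply Rmult_le_pos; lra|]. now apply inv_pow_antitone.
  + cbv beta. rewrite hmv. field. lra.
  + cbv beta. rewrite hs0. ring.
  + intros r hr. destruct (bd r ltac:(lra)) as [h1 [h2 _]].
    assert (hvr := hv r ltac:(lra)). assert (hv0 := hv r0 ltac:(lra)).
    assert (hrk : 0 < / r ^ k) by (apply inv_pow_pos; lra).
    assert (hrN : 0 < / r ^ S k) by (apply inv_pow_pos; lra).
    assert (hEk : 0 < E * / r ^ k) by now apply Rmult_lt_0_compat.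
    assert (hR : r0 ^ S k * Rabs um = Rabs m * (vp + phi r0)).
    { rewrite <- (Rabs_right (r0 ^ S k)), <- (Rabs_right (vp + phi r0)), <- !Rabs_mult by lra.
      now rewrite hmv. }
    assert (hRm := Rabs_pos m). assert (hRu := Rabs_pos um).
    assert (hu : Rabs (m * (vp + phi r) * / r ^ S k) = Rabs m * (vp + phi r) * / r ^ S k).
    { rewrite !Rabs_mult, (Rabs_right (/ r ^ S k)), (Rabs_right (vp + phi r)) by lra. reflexivity. }
    repeat split.
    * replace (/ (vp + phi r) - / vp) with (- (phi r * (/ (vp + phi r) * / vp))) by (field; lra).
      rewrite Rabs_Ropp.
      apply Rle_trans with (Ce * (L * E) * / r ^ k * (2 * / vp * / vp)).
      -- apply Rabs_mult_le; trivial.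
         assert (hi : 0 < / (vp + phi r) <= 2 * / vp).
         { split; [apply Rinv_0_lt_compat; lra|].
           replace (2 * / vp) with (/ (vp / 2)) by (field; lra). apply Rinv_le_contravar; lra. }
         rewrite Rabs_right by (apply Rle_ge, Rmult_le_pos; lra). apply Rmult_le_compat_r; lra.
      -- replace (Ce * (L * E) * / r ^ k * (2 * / vp * / vp)) with
           (Ce * L * (2 * / vp * / vp) * (E * / r ^ k)) by ring.
         replace (C / r ^ k * E) with (C * (E * / r ^ k)) by (unfold Rdiv; ring).
         apply Rmult_le_compat_r; [lra|]. unfold C. lra.
    * replace (tp + psi r - tp) with (psi r) by ring. eapply Rle_trans; [apply h2|].
      replace (Ce * (L * E) * / r ^ k) with (Ce * L * (E * / r ^ k)) by ring.
      replace (C / r ^ k * E) with (C * (E * / r ^ k)) by (unfold Rdiv; ring).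
      apply Rmult_le_compat_r; [lra|]. unfold C. lra.
    * rewrite hu. unfold Rdiv.
      replace (/ C * / r ^ S k * Rabs um) with (/ C * Rabs um * / r ^ S k) by ring.
      apply Rmult_le_compat_r; [lra|].
      assert (hCi : / C <= r0 ^ S k / 4).
      { replace (r0 ^ S k / 4) with (/ (4 * / r0 ^ S k)) by (field; lra).
        apply Rinv_le_contravar; [lra | unfold C; lra]. }
      apply Rle_trans with (r0 ^ S k / 4 * Rabs um); [now apply Rmult_le_compat_r|].
      replace (r0 ^ S k / 4 * Rabs um) with (r0 ^ S k * Rabs um / 4) by field.
      rewrite hR. unfold Rdiv. rewrite Rmult_assoc. apply Rmult_le_compat_l; lra.
    * rewrite hu. unfold Rdiv.
      replace (C * / r ^ S k * Rabs um) with (C * Rabs um * / r ^ S k) by ring.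
      apply Rmult_le_compat_r; [lra|].
      apply Rle_trans with (4 * (r0 ^ S k * Rabs um)).
      -- rewrite hR. replace (4 * (Rabs m * (vp + phi r0))) with (Rabs m * (4 * (vp + phi r0))) by ring.
         apply Rmult_le_compat_l; lra.
      -- replace (4 * (r0 ^ S k * Rabs um)) with (4 * r0 ^ S k * Rabs um) by ring.
         apply Rmult_le_compat_r; trivial. unfold C. lra.
- assert (main : forall rho u theta, boundary_solution bcond um thm E C rho u theta ->
    let phi := fun r => / rho r - vp in let psi := fun r => theta r - tp in
    (exists I, step k r0 cV Rg nu kap mu vp tp r0 (mm (phi r0)) phi0 (thm - tp) phi psi phi psi I) /\
    (forall r, r0 <= r -> Rabs (phi r) <= delta /\ Rabs (psi r) <= delta) /\
    (forall r, r0 <= r -> 0 < rho r /\ u r = mm (phi r0) * / rho r * / r ^ S k)).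
  { intros rho u theta [sol [hbc [hu0 [ht0 bd]]]] phi psi.
    assert (pos : forall r, r0 <= r -> 0 < rho r) by (intros r hr; now apply sol).
    assert (bd1 : forall r, r0 <= r -> Rabs (rho r - / vp) <= C * / r0 ^ k * E /\
      Rabs (psi r) <= C * / r0 ^ k * E).
    { intros r hr. destruct (bd r hr) as [h1 [h2 _]].
      assert (C / r ^ k * E <= C * / r0 ^ k * E).
      { apply Rmult_le_compat_r; [lra|]. apply Rmult_le_compat_l; [lra|].
        now apply inv_pow_antitone. }
      unfold psi. split; lra. }
    assert (bphi : forall r, r0 <= r -> Rabs (phi r) <= Rmin delta (vp / 2)).
    { intros r hr. destruct (bd1 r hr) as [h1 _]. assert (hp := pos r hr).
      assert (h4 := s4 E hE4).
      assert (hlow : / vp / 2 <= rho r) by (apply Rabs_le_between in h1; lra).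
      eapply Rle_trans; [|apply (s5 E hE5)].
      replace (phi r) with (- ((rho r - / vp) * (vp * / rho r))) by (unfold phi; field; lra).
      replace (2 * vp * vp * (C * / r0 ^ k) * E) with (C * / r0 ^ k * E * (vp * (2 * vp))) by ring.
      rewrite Rabs_Ropp. apply Rabs_mult_le; trivial.
      assert (hi : 0 < / rho r <= 2 * vp).
      { split; [now apply Rinv_0_lt_compat|].
        replace (2 * vp) with (/ (/ vp / 2)) by (field; lra). apply Rinv_le_contravar; lra. }
      rewrite Rabs_right by (apply Rle_ge, Rmult_le_pos; lra). apply Rmult_le_compat_l; lra. }
    assert (bphi1 : forall r, r0 <= r -> Rabs (phi r) <= vp / 2).
    { intros r hr. eapply Rle_trans; [now apply bphi | apply Rmin_r]. }
    destruct (hmy (rho r0) (pos r0 ltac:(lra)) hbc (bphi1 r0 ltac:(lra))) as [hm hp0].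
    change (/ rho r0 - vp) with (phi r0) in hm, hp0.
    assert (hm0 : mm (phi r0) <> 0).
    { rewrite <- hm. assert (hp := pos r0 ltac:(lra)).
      apply Rmult_integral_contrapositive_currified; trivial.
      apply Rmult_integral_contrapositive_currified; lra. }
    rewrite <- hu0 in hm. rewrite <- ht0.
    destruct (step_of_stationary rho u theta (mm (phi r0)) phi0 sol hm hm0 bphi1 hp0) as [hI hu].
    split; [exact hI|]. split.
    - intros r hr. split.
      + eapply Rle_trans; [now apply bphi | apply Rmin_l].
      + destruct (bd1 r hr) as [_ h]. generalize (s6 E hE6). lra.
    - intros r hr. split; auto. }
  intros rho1 u1 theta1 rho2 u2 theta2 P1 P2.
  destruct (main _ _ _ P1) as [[I1 st1] [b1 c1]]. destruct (main _ _ _ P2) as [[I2 st2] [b2 c2]].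
  clear main.
  assert (heq := huniq (L * E) mm phi0 (thm - tp) _ _ I1 _ _ I2 (s2 E hE2) hf st1 st2 b1 b2).
  cbv beta in heq.
  assert (hr : forall r, r0 <= r -> rho1 r = rho2 r).
  { intros r hr. destruct (heq r hr) as [h _]. apply Rinv_eq_reg. lra. }
  intros r hr'. destruct (c1 r hr') as [_ ->]. destruct (c2 r hr') as [_ ->].
  rewrite (hr r hr'), (hr r0) by lra. destruct (heq r hr') as [_ h]. repeat split; lra.
Qed.

End Correspondence.

(** * The flux laws for inflow and outflow, and the theorem *)

Lemma flux_ok_inflow (vp eps m : R) : 0 < vp -> 0 < m <= eps -> flux_ok vp (fun _ => m) eps.
Proof.
intros hvp [hm he]. split; [|split].
- left. now exists m.
- intros x _. rewrite Rabs_right; lra.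
- intros x y _ _. rewrite Rminus_diag, Rabs_R0.
  apply Rmult_le_pos; [apply Rmult_le_pos|]; auto using Rabs_pos.
  apply Rlt_le, Rdiv_lt_0_compat; lra.
Qed.

(** Here [c = r0^N u_-], so that [c / (vp + x)] is the mass flux for the density [/ (vp + x)] at
    [r0]. A difference of two such quotients is one of them times [(y - x) / (vp + x)]; hence the
    relative form of the Lipschitz condition, with the constant [2 / vp]. *)
Lemma flux_ok_outflow (vp eps c : R) : 0 < vp -> c < 0 -> 2 * / vp * - c <= eps ->
  flux_ok vp (fun x => c / (vp + x)) eps.
Proof.
intros hvp hc he.
assert (hi : forall x, Rabs x <= vp / 2 -> vp / 2 <= vp + x /\ 0 < / (vp + x) <= 2 * / vp).
{ intros x hx. apply Rabs_le_between in hx. split; [lra|]. split; [apply Rinv_0_lt_compat; lra|].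
  replace (2 * / vp) with (/ (vp / 2)) by (field; lra). apply Rinv_le_contravar; lra. }
split; [|split].
- right. intros x hx. destruct (hi x hx) as [_ h]. unfold Rdiv. nra.
- intros x hx. destruct (hi x hx) as [_ h]. unfold Rdiv.
  eapply Rle_trans; [|apply he]. rewrite (Rmult_comm (2 * / vp)). apply Rabs_mult_le.
  + rewrite Rabs_left; lra.
  + rewrite Rabs_right; lra.
- intros x y hx hy. destruct (hi x hx) as [h1 h2]. destruct (hi y hy) as [h3 _].
  replace (c / (vp + x) - c / (vp + y)) with (/ (vp + x) * - (x - y) * (c / (vp + y)))
    by (field; lra).
  rewrite !Rabs_mult, Rabs_Ropp. apply Rmult_le_compat_r; [apply Rabs_pos|].
  apply Rmult_le_compat_r; [apply Rabs_pos|]. rewrite Rabs_right; [exact (proj2 h2) | lra].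
Qed.

Theorem theorem1p1 (n : nat) (r0 cV Rgas nu lambda kappa : R) :
  (3 <= n)%nat -> 0 < r0 -> 0 < cV -> 0 < Rgas -> 0 < nu ->
  0 <= 2 * nu + INR n * lambda -> 0 < kappa -> 0 < 2 * nu + lambda ->
  forall rho_p theta_p : R, 0 < rho_p -> 0 < theta_p ->
  exists eps0 C : R, 0 < eps0 /\ 0 < C /\
  (* (I) inflow problem, u_+ = 0 *)
  (forall rho_m u_m theta_m : R, 0 < rho_m -> 0 < theta_m -> 0 < u_m ->
     Rabs u_m + Rabs (rho_m - rho_p) + Rabs (theta_m - theta_p) <= eps0 ->
     let P := fun rho u theta : R -> R =>
       stationary_solution n r0 cV Rgas nu lambda kappa rho_p 0 theta_p
         rho u theta /\
       rho r0 = rho_m /\ u r0 = u_m /\ theta r0 = theta_m /\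
       (forall r, r0 <= r ->
          Rabs (rho r - rho_p) <= C / r ^ (n - 2)
            * (Rabs u_m + Rabs (rho_m - rho_p) + Rabs (theta_m - theta_p)) /\
          Rabs (theta r - theta_p) <= C / r ^ (n - 2)
            * (Rabs u_m + Rabs (rho_m - rho_p) + Rabs (theta_m - theta_p)) /\
          / C / r ^ (n - 1) * Rabs u_m <= Rabs (u r) /\
          Rabs (u r) <= C / r ^ (n - 1) * Rabs u_m) in
     (exists rho u theta, P rho u theta) /\
     (forall rho1 u1 theta1 rho2 u2 theta2,
        P rho1 u1 theta1 -> P rho2 u2 theta2 ->
        forall r, r0 <= r ->
          rho1 r = rho2 r /\ u1 r = u2 r /\ theta1 r = theta2 r)) /\
  (* (II) outflow problem, u_+ = 0 *)
  (forall u_m theta_m : R, 0 < theta_m -> u_m < 0 ->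
     Rabs u_m + Rabs (theta_m - theta_p) <= eps0 ->
     let P := fun rho u theta : R -> R =>
       stationary_solution n r0 cV Rgas nu lambda kappa rho_p 0 theta_p
         rho u theta /\
       u r0 = u_m /\ theta r0 = theta_m /\
       (forall r, r0 <= r ->
          Rabs (rho r - rho_p) <= C / r ^ (n - 2)
            * (Rabs u_m + Rabs (theta_m - theta_p)) /\
          Rabs (theta r - theta_p) <= C / r ^ (n - 2)
            * (Rabs u_m + Rabs (theta_m - theta_p)) /\
          / C / r ^ (n - 1) * Rabs u_m <= Rabs (u r) /\
          Rabs (u r) <= C / r ^ (n - 1) * Rabs u_m) in
     (exists rho u theta, P rho u theta) /\
     (forall rho1 u1 theta1 rho2 u2 theta2,
        P rho1 u1 theta1 -> P rho2 u2 theta2 ->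
        forall r, r0 <= r ->
          rho1 r = rho2 r /\ u1 r = u2 r /\ theta1 r = theta2 r)).
Proof.
intros hn hr0 hcV hRg hnu _ hkap hmu rho_p theta_p hrho htp.
destruct n as [|[|k]]; [lia | lia |].
replace (S (S k) - 1)%nat with (S k) by lia. replace (S (S k) - 2)%nat with k by lia.
set (vp := / rho_p). assert (hvp : 0 < vp) by now apply Rinv_0_lt_compat.
assert (hivp : / vp = rho_p) by apply Rinv_inv.
assert (hz : 0 < r0 ^ S k) by now apply pow_lt.
(* The summands convert the size [E] of the data into bounds on [theta_m - theta_p], on
   [phi0 = / rho_m - vp], and on the mass flux. *)
set (L := 1 + 2 * vp * vp + 2 * r0 ^ S k * rho_p).
assert (hv2 : 0 < 2 * vp * vp) by (repeat apply Rmult_lt_0_compat; lra).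
assert (hzr : 0 < 2 * r0 ^ S k * rho_p) by (apply Rmult_lt_0_compat; lra).
assert (hL : 0 < L) by (unfold L; lra).
destruct (boundary_problem k r0 cV Rgas nu lambda kappa vp theta_p) with (L := L)
  as [eps0 [C [heps [hC main]]]]; trivial; [lia|].
(* The second entry keeps the inflow density between [rho_p / 2] and [3 / 2 * rho_p]. *)
exists (Rmin eps0 (rho_p / 2)), C.
assert (hm1 : forall E, E <= Rmin eps0 (rho_p / 2) -> E <= eps0 /\ E <= rho_p / 2).
{ intros E hE. generalize (Rmin_l eps0 (rho_p / 2)) (Rmin_r eps0 (rho_p / 2)). lra. }
split; [apply Rmin_glb_lt; lra|]. split; [trivial|]. split.
- intros rho_m u_m theta_m hrm htm hum hE P.
  set (E := Rabs u_m + Rabs (rho_m - rho_p) + Rabs (theta_m - theta_p)) in *.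
  destruct (hm1 E hE) as [hE1 hE2].
  assert (q1 := Rabs_pos (rho_m - rho_p)). assert (q2 := Rabs_pos (theta_m - theta_p)).
  assert (hua : Rabs u_m = u_m) by (apply Rabs_right; lra).
  assert (hEp : 0 < E) by (unfold E; lra).
  assert (hrE : Rabs (rho_m - rho_p) <= E) by (unfold E; lra).
  assert (huE : u_m <= E) by (unfold E; lra).
  assert (hrr : rho_p / 2 <= rho_m <= 3 / 2 * rho_p)
    by (generalize hrE; intros h; apply Rabs_le_between in h; lra).
  set (m := r0 ^ S k * rho_m * u_m).
  assert (hm : 0 < m) by (apply Rmult_lt_0_compat; [apply Rmult_lt_0_compat|]; trivial).
  destruct (main E u_m theta_m (/ rho_m - vp) (fun _ => m) (fun y => y = rho_m)) as [ex un]; try lra.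
  + apply Rle_trans with (1 * E); [unfold E; lra|]. apply Rmult_le_compat_r; unfold L; lra.
  + apply Rle_trans with (2 * vp * vp * E); [|apply Rmult_le_compat_r; unfold L; lra].
    replace (/ rho_m - vp) with (/ rho_m * vp * - (rho_m - rho_p)) by (unfold vp; field; lra).
    apply Rabs_mult_le; [|now rewrite Rabs_Ropp].
    assert (hi : 0 < / rho_m <= 2 * vp).
    { split; [now apply Rinv_0_lt_compat|].
      replace (2 * vp) with (/ (rho_p / 2)) by (unfold vp; field; lra). apply Rinv_le_contravar; lra. }
    rewrite Rabs_right; [|apply Rle_ge, Rmult_le_pos; lra]. apply Rmult_le_compat_r; lra.
  + apply flux_ok_inflow; trivial. split; trivial.
    apply Rle_trans with (2 * r0 ^ S k * rho_p * E); [|apply Rmult_le_compat_r; unfold L; lra].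
    unfold m. apply Rmult_le_compat; [apply Rmult_le_pos; lra | lra | | trivial].
    replace (2 * r0 ^ S k * rho_p) with (r0 ^ S k * (2 * rho_p)) by ring.
    apply Rmult_le_compat_l; lra.
  + intros x _ hx. rewrite (hx hm). replace (vp + (/ rho_m - vp)) with (/ rho_m) by ring.
    split; [apply Rinv_inv|]. unfold m. field. lra.
  + intros y _ -> _. split; [reflexivity | trivial].
  + unfold boundary_solution in ex, un. rewrite hivp in ex, un. split; [exact ex | exact un].
- intros u_m theta_m htm hum hE P.
  set (E := Rabs u_m + Rabs (theta_m - theta_p)) in *.
  destruct (hm1 E hE) as [hE1 hE2].
  assert (q2 := Rabs_pos (theta_m - theta_p)).
  assert (hua : Rabs u_m = - u_m) by (apply Rabs_left; lra).
  assert (hEp : 0 < E) by (unfold E; lra).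
  (* The value 0 for [phi0] is a placeholder: [phi0] is consulted only when the flux is positive. *)
  destruct (main E u_m theta_m 0 (fun x => r0 ^ S k * u_m / (vp + x)) (fun _ => True)) as [ex un];
    try lra.
  + apply Rle_trans with (1 * E); [unfold E; lra|]. apply Rmult_le_compat_r; unfold L; lra.
  + rewrite Rabs_R0. apply Rmult_le_pos; lra.
  + apply flux_ok_outflow; trivial; [nra|]. rewrite hivp.
    apply Rle_trans with (2 * r0 ^ S k * rho_p * E); [|apply Rmult_le_compat_r; unfold L; lra].
    replace (2 * rho_p * - (r0 ^ S k * u_m)) with (2 * r0 ^ S k * rho_p * - u_m) by ring.
    apply Rmult_le_compat_l; unfold E; lra.
  + intros x hx _. apply Rabs_le_between in hx. split; trivial. field. lra.
  + intros y hy _ hx. cbv beta. replace (vp + (/ y - vp)) with (/ y) by ring. split; [field; lra|].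
    intros hpos. exfalso.
    assert (hneg : r0 ^ S k * u_m < 0) by nra.
    assert (hneg' : r0 ^ S k * u_m * y < 0) by nra.
    unfold Rdiv in hpos. rewrite Rinv_inv in hpos. lra.
  + unfold boundary_solution in ex, un. rewrite hivp in ex, un. split.
    * destruct ex as [rho [u [theta [h1 [_ h2]]]]]. exists rho, u, theta. now split.
    * intros rho1 u1 theta1 rho2 u2 theta2 [h1 h2] [h3 h4]. apply un; now (split; [|split]).
Qed.
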